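(* Let $M$ be a closed manifold. Let $\mathcal{T}$ be the set of Tonelli Lagrangians $L:TM\to\mathbb{R}$, and let $\mathcal{T}'\subset\mathcal{T}$ be the subset of those Tonelli Lagrangians $L$ such that $e_0(L)<c_{\mathrm{u}}(L)$. Then $\mathcal{T}'$ is $C^0$-open and $C^1$-dense in $\mathcal{T}$.
   Context: A Tonelli Lagrangian is a smooth function $L:TM\to\mathbb{R}$ whose restriction to the fibers of $TM$ is superlinear with positive definite Hessian. Its energy is $E(q,v)=\partial_vL(q,v)v-L(q,v)$, and $e_0(L):=\max_{q\in M}E(q,0)$. For $e\in\mathbb{R}$, the free-period action of an absolutely continuous periodic curve $\gamma:\mathbb{R}/p\mathbb{Z}\to M$, $p>0$, is $\mathcal{S}_e(\gamma)=\int_0^pL(\gamma(t),\dot\gamma(t))\,dt+p\,e\in\mathbb{R}\cup\{+\infty\}$. The Mañé critical value of a Tonelli Lagrangian is the minimal $e\in\mathbb{R}$ such that $\mathcal{S}_e$ is non-negative on periodic curves of arbitrary period, and $c_{\mathrm{u}}(L)$ is the Mañé critical value of the lift of $L$ to the tangent bundle of the universal cover of $M$. $C^0$-open and $C^1$-dense refer to the (possibly infinite) distances $|L-L'|_{C^0}=\sup_{TM}|L-L'|$ and $|L-L'|_{C^1}=\sup_{TM}\big(|L-L'|+|d(L-L')|\big)$, where the norm of the differential on $TM$ is induced by an auxiliary Riemannian metric on $M$.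
   Formalization: The closed manifold M is assumed to have dimension at least 2; in dimensions 0 and 1 (e.g. the circle) one always has c_u(L) = e_0(L), so T' is empty and not dense in T. *)

(* Defs.v *)
From HB Require Import structures.
From mathcomp Require Import all_boot all_order all_algebra.
From mathcomp Require Import all_classical all_reals all_analysis.
Set Implicit Arguments.
Unset Strict Implicit.
Unset Printing Implicit Defensive.
Import Order.TTheory GRing.Theory Num.Theory.
Import numFieldNormedType.Exports.
Local Open Scope classical_set_scope.
Local Open Scope ring_scope.

(* To be used on an open subset U of a finite-dimensional space, where being
   C^(k+1) amounts to being differentiable with C^k directional derivatives. *)
Fixpoint Ck (R : realType) (V W : normedModType R) (k : nat) (U : set V)
    (f : V -> W) : Prop :=
  match k with
  | 0 => {in U, continuous f}
  | k'.+1 => (forall x, U x -> differentiable f x) /\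
             (forall v, Ck k' U (fun x => 'D_v f x))
  end.

Definition smooth_on (R : realType) (V W : normedModType R) (U : set V)
    (f : V -> W) : Prop := forall k, Ck k U f.

Record chart (R : realType) (n : nat) (M : topologicalType) := Chart {
  cdom : set M;
  cmap : M -> 'rV[R]_n;
  cinv : 'rV[R]_n -> M;
  open_cdom : open cdom;
  open_ccodom : open (cmap @` cdom);
  cmapK : {in cdom, cancel cmap cinv};
  cmap_continuous : {in cdom, continuous cmap};
  cinv_continuous : {in cmap @` cdom, continuous cinv} }.

(* The atlas is indexed by the points of the manifold, the chart with index x
   being defined at x.  Having one distinguished chart at each point allows one
   to represent tangent vectors by elements of R^n, see below. *)
Record manifold (R : realType) (n : nat) := Manifold {
  carrier :> topologicalType;
  manifold_hausdorff : hausdorff_space carrier;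
  manifold_second_countable : @second_countable carrier;
  chart_at : carrier -> chart R n carrier;
  mem_chart_at : forall x, cdom (chart_at x) x;
  smooth_transition : forall x y,
    smooth_on (cmap (chart_at x) @` (cdom (chart_at x) `&` cdom (chart_at y)))
              (cmap (chart_at y) \o cinv (chart_at x)) }.

Definition closed_manifold (R : realType) (n : nat) (M : manifold R n) : Prop :=
  [/\ compact [set: M], connected [set: M] & [set: M] !=set0].

Definition phi (R : realType) (n : nat) (M : manifold R n) (x : M) :
  M -> 'rV[R]_n := cmap (chart_at x).

Definition phi_inv (R : realType) (n : nat) (M : manifold R n) (x : M) :
  'rV[R]_n -> M := cinv (chart_at x).

Definition phi_dom (R : realType) (n : nat) (M : manifold R n) (x : M) :
  set M := cdom (chart_at x).

Definition smooth_map_on (R : realType) (n : nat) (M N : manifold R n)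
    (U : set M) (f : M -> N) : Prop :=
  {in U, continuous f} /\
  forall x y, smooth_on (phi x @` (phi_dom x `&` U `&` f @^-1` phi_dom y))
                        (phi y \o f \o phi_inv x).

(* A tangent vector of M at q is represented by its components in the
   distinguished chart at q, so the total space TM is M * 'rV[R]_n, and a
   function on TM is curried as M -> 'rV[R]_n -> R.  The smooth structure of TM
   is not the product one: it is given by the charts induced by those of M.
   The map [to_fiber x z] takes the components in the chart x of a tangent
   vector at the point with coordinates z to its components in the
   distinguished chart at that point. *)
Definition to_fiber (R : realType) (n : nat) (M : manifold R n) (x : M)
    (z : 'rV[R]_n) : 'rV[R]_n -> 'rV[R]_n :=
  'd (phi (phi_inv x z) \o phi_inv x) z.

Definition TM_local (R : realType) (n : nat) (M : manifold R n) (x : M)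
    (F : M -> 'rV[R]_n -> R) : 'rV[R]_n * 'rV[R]_n -> R :=
  fun z => F (phi_inv x z.1) (to_fiber x z.1 z.2).

Definition TM_smooth (R : realType) (n : nat) (M : manifold R n)
    (F : M -> 'rV[R]_n -> R) : Prop :=
  forall x, smooth_on ((phi x @` phi_dom x) `*` setT) (TM_local x F).

Definition tangent_map (R : realType) (n : nat) (N M : manifold R n)
    (f : N -> M) (q : N) : 'rV[R]_n -> 'rV[R]_n :=
  'd (phi (f q) \o f \o phi_inv q) (phi q q).

Definition velocity (R : realType) (n : nat) (M : manifold R n)
    (gamma : R -> M) (t : R) : 'rV[R]_n :=
  derive1 (phi (gamma t) \o gamma) t.

Definition simply_connected (R : realType) (N : topologicalType) : Prop :=
  (forall x y : N, exists2 c : R -> N, continuous c & c 0 = x /\ c 1 = y) /\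
  (forall c : R -> N, {within `[0, 1], continuous c} -> c 0 = c 1 ->
    exists2 h : R * R -> N, {within `[0, 1] `*` `[0, 1], continuous h} &
      forall t, 0 <= t <= 1 ->
        [/\ h (0, t) = c t, h (1, t) = c 0, h (t, 0) = c 0 & h (t, 1) = c 0]).

Definition smooth_covering (R : realType) (n : nat) (N M : manifold R n)
    (rho : N -> M) : Prop :=
  [/\ smooth_map_on setT rho,
      (forall q, exists x, rho x = q) &
      forall q, exists (U : set M) (sheets : set (set N)),
        [/\ open U, U q, trivIset sheets id,
            \bigcup_(S in sheets) S = rho @^-1` U &
            forall S, sheets S -> open S /\
              exists s : M -> N,
                [/\ smooth_map_on U s,
                    forall y, U y -> S (s y) /\ rho (s y) = y &
                    forall x, S x -> s (rho x) = x]]].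

Definition universal_cover (R : realType) (n : nat) (N M : manifold R n)
    (rho : N -> M) : Prop :=
  simply_connected R N /\ smooth_covering rho.

Definition tonelli (R : realType) (n : nat) (M : manifold R n)
    (L : M -> 'rV[R]_n -> R) : Prop :=
  [/\ TM_smooth L,
      (forall q (A : R), exists r : R, forall v, r <= `|v| -> A * `|v| <= L q v) &
      forall q v w, w != 0 -> 0 < 'D_w (fun u => 'D_w (L q) u) v].

Definition energy (R : realType) (n : nat) (M : manifold R n)
    (L : M -> 'rV[R]_n -> R) (q : M) (v : 'rV[R]_n) : R :=
  'd (L q) v v - L q v.

(* Default value 0 if there is no maximum (resp. minimum); both are attained
   in the uses below. *)
Definition set_max (R : realType) (A : set R) : R :=
  xget 0 [set m | A m /\ forall x, A x -> x <= m].
Definition set_min (R : realType) (A : set R) : R :=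
  xget 0 [set m | A m /\ forall x, A x -> m <= x].

Definition e0 (R : realType) (n : nat) (M : manifold R n)
    (L : M -> 'rV[R]_n -> R) : R :=
  set_max [set energy L q 0 | q in [set: M]].

Definition abs_continuous (R : realType) (V : normedModType R) (a b : R)
    (f : R -> V) : Prop :=
  forall eps : R, 0 < eps -> exists2 delta : R, 0 < delta &
    forall (m : nat) (s t : 'I_m -> R),
      (forall i, [/\ a <= s i, s i <= t i & t i <= b]) ->
      (forall i j, i != j -> t i <= s j \/ t j <= s i) ->
      \sum_(i < m) (t i - s i) < delta ->
      \sum_(i < m) `|f (t i) - f (s i)| < eps.

Definition abs_continuous_curve (R : realType) (n : nat) (M : manifold R n)
    (gamma : R -> M) : Prop :=
  continuous gamma /\
  forall (x : M) (a b : R), gamma @` `[a, b] `<=` phi_dom x ->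
    abs_continuous a b (phi x \o gamma).

Definition ac_periodic_curve (R : realType) (n : nat) (M : manifold R n)
    (p : R) (gamma : R -> M) : Prop :=
  abs_continuous_curve gamma /\ forall t, gamma (t + p) = gamma t.

(* The velocity exists almost everywhere, and the integrand is bounded below
   for a Tonelli Lagrangian on a closed manifold and for its lifts. *)
Definition free_period_action (R : realType) (n : nat) (M : manifold R n)
    (L : M -> 'rV[R]_n -> R) (e p : R) (gamma : R -> M) : \bar R :=
  (\int[lebesgue_measure]_(t in `[0%R, p])
     (L (gamma t) (velocity gamma t))%:E + (p * e)%:E)%E.

Definition mane_critical_value (R : realType) (n : nat) (M : manifold R n)
    (L : M -> 'rV[R]_n -> R) : R :=
  set_min [set e | forall (p : R) (gamma : R -> M),
    0 < p -> ac_periodic_curve p gamma ->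
    (0 <= free_period_action L e p gamma)%E].

Definition lift_lagrangian (R : realType) (n : nat) (N M : manifold R n) (rho : N -> M)
    (L : M -> 'rV[R]_n -> R) : N -> 'rV[R]_n -> R :=
  fun q v => L (rho q) (tangent_map rho q v).

Definition c_u (R : realType) (n : nat) (N M : manifold R n) (rho : N -> M)
    (L : M -> 'rV[R]_n -> R) : R :=
  mane_critical_value (lift_lagrangian rho L).

Definition inner (R : realType) (n : nat) (G : 'M[R]_n) (u w : 'rV[R]_n) : R :=
  (u *m G *m w^T) 0 0.

Definition metric_local (R : realType) (n : nat) (M : manifold R n)
    (g : M -> 'M[R]_n) (x : M) (u w : 'rV[R]_n) : 'rV[R]_n -> R :=
  fun z => inner (g (phi_inv x z)) (to_fiber x z u) (to_fiber x z w).

(* [g q] is the matrix of the metric at q in the distinguished chart at q. *)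
Definition riemannian_metric (R : realType) (n : nat) (M : manifold R n)
    (g : M -> 'M[R]_n) : Prop :=
  [/\ forall q, (g q)^T = g q,
      forall q u, u != 0 -> 0 < inner (g q) u u &
      forall x u w, smooth_on (phi x @` phi_dom x) (metric_local g x u w)].

(* Christoffel symbols Gamma(a, b) of the Levi-Civita connection at q, in the
   distinguished chart at q, obtained from the Koszul formula
   2 g(Gamma(a, b), c) = D_a g(b, c) + D_b g(a, c) - D_c g(a, b). *)
Definition christoffel (R : realType) (n : nat) (M : manifold R n)
    (g : M -> 'M[R]_n) (q : M) (a b : 'rV[R]_n) : 'rV[R]_n :=
  let Dg c u w := 'D_c (metric_local g q u w) (phi q q) in
  let e k : 'rV[R]_n := delta_mx 0 k in
  (\row_k (2^-1 * (Dg a b (e k) + Dg b a (e k) - Dg (e k) a b)))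
    *m invmx (g q).

(* Square of the norm, for the Sasaki metric on TM induced by g, of a vector
   xi tangent to TM at (q, v), with components (xi.1, xi.2) in the chart of TM
   induced by the distinguished chart at q: xi.1 is the projection of xi to
   the tangent space of M, and xi.2 + Gamma(xi.1, v) its vertical part. *)
Definition sasaki_sqnorm (R : realType) (n : nat) (M : manifold R n)
    (g : M -> 'M[R]_n) (q : M) (v : 'rV[R]_n) (xi : 'rV[R]_n * 'rV[R]_n) : R :=
  let k := xi.2 + christoffel g q xi.1 v in
  inner (g q) xi.1 xi.1 + inner (g q) k k.

Definition diff_norm (R : realType) (n : nat) (M : manifold R n)
    (g : M -> 'M[R]_n) (F : M -> 'rV[R]_n -> R) (q : M) (v : 'rV[R]_n) : \bar R :=
  ereal_sup [set (`|'d (TM_local q F) (phi q q, v) xi|)%:E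
            | xi in [set xi | sasaki_sqnorm g q v xi <= 1]].

Definition C0_dist (R : realType) (n : nat) (M : manifold R n)
    (L L' : M -> 'rV[R]_n -> R) : \bar R :=
  ereal_sup [set (`|L z.1 z.2 - L' z.1 z.2|)%:E | z in [set: M * 'rV[R]_n]].

Definition C1_dist (R : realType) (n : nat) (M : manifold R n)
    (g : M -> 'M[R]_n) (L L' : M -> 'rV[R]_n -> R) : \bar R :=
  ereal_sup [set ((`|L z.1 z.2 - L' z.1 z.2|)%:E +
                  diff_norm g (fun q v => (L q v - L' q v)%R) z.1 z.2)%E
            | z in [set: M * 'rV[R]_n]].

Definition open_in (R : realType) (X : Type) (dist : X -> X -> \bar R)
    (T A : set X) : Prop :=
  forall L, A L -> exists2 eps : R, 0 < eps &
    forall L', T L' -> (dist L L' < eps%:E)%E -> A L'.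

Definition dense_in (R : realType) (X : Type) (dist : X -> X -> \bar R)
    (T A : set X) : Prop :=
  forall L, T L -> forall eps : R, 0 < eps ->
    exists2 L', A L' & (dist L L' < eps%:E)%E.

Definition tonelli_lt (R : realType) (n : nat) (N M : manifold R n)
    (rho : N -> M) : set (M -> 'rV[R]_n -> R) :=
  [set L | tonelli L /\ e0 L < c_u rho L].

(* Main.v *)
(* Since E(q, 0) = - L(q, 0), one has e0(L) = - min_q L(q, 0).  Hence e0 and c_u
   both move by at most |L - L'|_C0, which gives openness.

   For density, let q0 minimize L(q, 0).  In a chart at q0, the potential
   chi (L(q0, 0) - L(q, 0)) with a cutoff chi supported in a ball of radius 2r
   is C^1-small as r tends to 0, since L(q, 0) is flat to first order at q0.
   Adding it makes L(., 0) constant and minimal on a circle of radius r around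
   q0 without changing e0.  Add also s times a non-closed 1-form, cut off in q
   and v.  Travel along the circle at small speed om in one direction for s = 0,
   and in the other for the given s > 0.  The circle is contractible, so it
   lifts to the universal cover.  At energy e0 the first order terms in om of
   L along the two loops cancel, leaving the sum of the two actions equal to
   o(1) minus s times the positive flux of the 1-form.  So one of the two
   actions is negative and e0 < c_u for one of the two perturbations, both of
   which are Tonelli and C^1-close to L when s is small. *)
Require Import Defs.
From HB Require Import structures.
From mathcomp Require Import all_boot all_order all_algebra.
From mathcomp Require Import all_classical all_reals all_analysis.
From mathcomp Require Import measurable_realfun ring lra.
Set Implicit Arguments.
Unset Strict Implicit.
Unset Printing Implicit Defensive.
Import Order.TTheory GRing.Theory Num.Theory.
Import numFieldNormedType.Exports.
Local Open Scope classical_set_scope.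
Local Open Scope ring_scope.

(** * Calculus of C^k maps *)

(** A vector at [q] is given in the distinguished chart at [q], which depends on [q] without any
    continuity. Uniform estimates are therefore made in the single chart at [q0]. For the Sasaki
    norm this takes the transformation law of the Christoffel symbols: its inhomogeneous term
    matches the second derivatives of the transition map that occur when charts of TM are changed. A
    nonzero 1-form is linear in v, hence unbounded on TM. The cutoff in v makes it bounded but
    destroys linearity, so convexity has to be recovered from compactness bounds on fiber Hessians.
    The constants are chosen in the order r, s, om: the size of s depends on r, and om comes last
    because a gain of order s r^2 om per unit of time must beat a remainder o(om). For openness,
    actions are compared over all absolutely continuous loops. These actions may be infinite and the
    velocity may fail to exist at some times, so the comparison rests on measurability and a uniform
    lower bound of the integrand. The hypothesis n > 1 provides a plane for the circle. In dimension
    one every 1-form is closed, and convexity gives c_u = e0. *)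

Lemma near_eq_differentiable (R : realType) (V W : normedModType R)
    (f g : V -> W) (x : V) : {near x, f =1 g} -> differentiable f x ->
  differentiable g x /\ 'd g x = 'd f x :> (V -> W).
Proof.
move=> fg df; pose e := g - f.
have eo : e \o shift x = cst (e x) + (\0 : V -> W) +o_ 0 id.
  apply/eqaddoP => eps eps0 /=.
  have : \forall h \near (0:V), f (h + x) = g (h + x).
    have := fg; rewrite {1}(near_shift 0 x) /=.
    by apply: filterS => h /=; rewrite subr0.
  apply: filterS => h fgh; rewrite !fctE /= /e !fctE fgh (nbhs_singleton fg) !subrr.
  by rewrite addr0 subrr normr0 mulr_ge0 // ltW.
have ce : continuous (\0 : V -> W) by move=> ?; exact: cvg_cst.
have de : 'd e x = (\0 : V -> W) :> (V -> W) by apply: diff_unique.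
have dife : differentiable e x by apply/diff_locallyP; rewrite de; split.
have -> : g = f + e by rewrite funeqE => y; rewrite !fctE /e !fctE addrC subrK.
split; first exact: differentiableD.
by rewrite (diffD df dife) de; apply: addr0.
Qed.

Section Ck.
Variable R : realType.
Implicit Types V W X : normedModType R.

Lemma open_near_eq V W (U : set V) (f g : V -> W) x :
  open U -> U x -> (forall x, U x -> f x = g x) -> {near x, f =1 g}.
Proof.
move=> oU Ux fg; have := open_nbhs_nbhs (conj oU Ux).
by apply: filterS => y; exact: fg.
Qed.

Lemma Ck_ext V W k (U : set V) (f g : V -> W) :
  open U -> (forall x, U x -> f x = g x) -> Ck k U f -> Ck k U g.
Proof.
move=> oU; elim: k f g => [|k IH] f g fg /=.
  move=> cf x /set_mem Ux; have nfg := open_near_eq oU Ux fg.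
  have := cf x (mem_set Ux); rewrite /continuous_at (fg _ Ux) => h.
  by apply: cvg_trans h; apply: near_eq_cvg.
move=> [df Dk]; split=> [x Ux|v].
  by have [] := near_eq_differentiable (open_near_eq oU Ux fg) (df x Ux).
apply: IH (Dk v) => x Ux; exact: near_eq_derive (open_near_eq oU Ux fg).
Qed.

Lemma Ck_sub V W k (U U' : set V) (f : V -> W) : U' `<=` U -> Ck k U f -> Ck k U' f.
Proof.
move=> UU'; elim: k f => [|k IH] f /=.
  by move=> cf x /set_mem /UU' Ux; apply: cf; exact: mem_set.
by case=> df Dk; split=> [x /UU'|v]; [exact: df|exact: IH].
Qed.

(** [Ck] constrains the total function [f] only at the points of [U], derivatives being taken in the
    whole space; hence it passes to arbitrary unions and can be checked around each point. *)
Lemma CkU V W k (I : Type) (U : I -> set V) (f : V -> W) :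
  (forall i, Ck k (U i) f) -> Ck k (\bigcup_i U i) f.
Proof.
elim: k f => [|k IH] f /=.
  by move=> cf x /set_mem [i _ Ux]; apply: (cf i); exact: mem_set.
move=> h; split=> [x [i _ Ux]|v]; first exact: (h i).1.
by apply: IH => i; exact: (h i).2.
Qed.

Lemma Ck_local V W k (U : set V) (f : V -> W) :
  (forall x, U x -> exists2 B : set V, B x & Ck k B f) -> Ck k U f.
Proof.
move=> h; pose I := {B : set V | Ck k B f}.
apply: (@Ck_sub _ _ _ (\bigcup_(i : I) sval i)); last by apply: CkU => -[].
by move=> x Ux; have [B Ox cO] := h x Ux; exists (exist _ B cO).
Qed.

Lemma Ck_pred V W k (U : set V) (f : V -> W) : Ck k.+1 U f -> Ck k U f.
Proof.
elim: k f => [|k IH] f [df Dk] /=.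
  by move=> x /set_mem Ux; exact: differentiable_continuous (df x Ux).
by split => // v; apply: IH; exact: Dk.
Qed.

Lemma Ck_cst V W k (U : set V) (a : W) : Ck k U (cst a).
Proof.
elim: k a => [|k IH] a /=; first by move=> x _; exact: cvg_cst.
split=> [x _|v]; first exact: differentiable_cst.
rewrite (_ : (fun x => _) = cst 0); first exact: IH.
by rewrite funeqE => x; exact: derive_cst.
Qed.

Lemma Ck_lin V W k (U : set V) (f : {linear V -> W}) : continuous f -> Ck k U f.
Proof.
case: k => [|k] cf /=; first by move=> x _; exact: cf.
split=> [x _|v]; first exact: linear_differentiable.
rewrite (_ : (fun x => _) = cst (f v)); first exact: Ck_cst.
by rewrite funeqE => x; rewrite deriveE ?diff_lin //; exact: linear_differentiable.
Qed.

Lemma CkD V W k (U : set V) (f g : V -> W) : open U ->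
  Ck k U f -> Ck k U g -> Ck k U (fun x => f x + g x).
Proof.
move=> oU; elim: k f g => [|k IH] f g /=.
  by move=> cf cg x Ux; apply: cvgD; [exact: cf|exact: cg].
move=> [df Df] [dg Dg]; split=> [x Ux|v].
  by apply: differentiableD; [exact: df|exact: dg].
apply: (Ck_ext (f := fun x => 'D_v f x + 'D_v g x)) => // [x Ux|]; last exact: IH.
by rewrite deriveD //; apply: diff_derivable; [exact: df|exact: dg].
Qed.

Lemma Ck_sum V W k (U : set V) (I : Type) (r : seq I) (P : pred I) (f : I -> V -> W) :
  open U -> (forall i, P i -> Ck k U (f i)) -> Ck k U (fun x => \sum_(i <- r | P i) f i x).
Proof.
move=> oU h; elim: r => [|i r IH].
  by rewrite (_ : (fun x => _) = cst 0); [exact: Ck_cst | rewrite funeqE=> x; rewrite big_nil].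
case Pi: (P i); last first.
  by apply: Ck_ext IH => // x _; rewrite big_cons Pi.
apply: (Ck_ext (f := fun x => f i x + \sum_(j <- r | P j) f j x)) => // [x _|].
  by rewrite big_cons Pi.
by apply: CkD => //; exact: h.
Qed.

Lemma linear_diff V W (f : V -> W) : linear f -> continuous f ->
  forall x, differentiable f x /\ 'd f x = f :> (V -> W).
Proof.
move=> lf cf x; pose dlM := GRing.isLinear.Build _ _ _ _ f lf.
pose dL : {linear V -> W} := HB.pack f dlM.
split; first exact: (@linear_differentiable _ _ _ dL x cf).
exact: (@diff_lin _ _ _ dL x cf).
Qed.

Lemma Ck_linear V W X k (U : set V) (f : V -> W) (l : W -> X) : open U ->
  linear l -> continuous l -> Ck k U f -> Ck k U (fun x => l (f x)).
Proof.
move=> oU ll cl; elim: k f => [|k IH] f /=.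
  by move=> cf x Ux; apply: continuous_comp; [exact: cf|exact: cl].
move=> [df Df]; split=> [x Ux|v].
  by apply: (differentiable_comp (df x Ux)); have [] := linear_diff ll cl (f x).
apply: (Ck_ext (f := fun x => l ('D_v f x))) => // [x Ux|]; last exact: IH.
have [dl El] := linear_diff ll cl (f x).
rewrite [in RHS]deriveE; last exact: differentiable_comp (df x Ux) dl.
by rewrite (diff_comp (df x Ux) dl) /= El deriveE //; exact: df.
Qed.

Lemma CkN V W k (U : set V) (f : V -> W) : open U ->
  Ck k U f -> Ck k U (fun x => - f x).
Proof.
move=> oU; apply: Ck_linear => //; last exact: oppr_continuous.
by move=> a u v; rewrite opprD scalerN.
Qed.

Lemma CkB V W k (U : set V) (f g : V -> W) : open U ->
  Ck k U f -> Ck k U g -> Ck k U (fun x => f x - g x).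
Proof. by move=> oU cf cg; apply: CkD => //; exact: CkN. Qed.

Lemma CkZl V W k (U : set V) (f : V -> R) (w : W) : open U ->
  Ck k U f -> Ck k U (fun x => f x *: w).
Proof.
move=> oU; apply: (@Ck_linear _ _ _ k U f (fun a : R => a *: w)) => //.
  by move=> a u v; rewrite scalerDl scalerA.
by move=> a; apply: cvgZr_tmp; exact: cvg_id.
Qed.

Lemma CkM V k (U : set V) (f g : V -> R) : open U ->
  Ck k U f -> Ck k U g -> Ck k U (fun x => f x * g x).
Proof.
move=> oU; elim: k f g => [|k IH] f g.
  by move=> /= cf cg x Ux; apply: cvgM; [exact: cf|exact: cg].
move=> Cf Cg; have [df Df] := Cf; have [dg Dg] := Cg; split=> [x Ux|v].
  by apply: differentiableM; [exact: df|exact: dg].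
apply: (Ck_ext (f := fun x => f x * 'D_v g x + g x * 'D_v f x)) => // [x Ux|].
  by rewrite deriveM //; apply: diff_derivable; [exact: df|exact: dg].
by apply: CkD => //; apply: IH => //; first [exact: Dg|exact: Df|exact: Ck_pred].
Qed.

(** Finite dimension, through continuous linear coordinates. In the chain rule the direction
    ['D_v f x] in which [g] is differentiated varies with [x]; expanding it over finitely many fixed
    directions produces products to which induction on the order of differentiability applies. *)
Definition has_basis V := exists m (e : 'I_m -> V) (c : 'I_m -> V -> R),
  (forall i, linear (c i) /\ continuous (c i)) /\ forall v, v = \sum_i c i v *: e i.

Lemma Ck_comp0 V W k (U : set V) (B : set W) (f : V -> W) (g : W -> R) :
  has_basis W -> open U -> open B -> (forall x, U x -> B (f x)) ->
  Ck k U f -> Ck k B g -> Ck k U (g \o f).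
Proof.
move=> [m [e [c [lc cE]]]] oU oB UB; elim: k g f UB => [|k IH] g f UB.
  move=> /= cf cg x /[dup] Ux /set_mem/UB Ofx.
  by apply: continuous_comp; [exact: cf | exact: cg (mem_set Ofx)].
move=> Cf Cg; have [df Df] := Cf; have [dg Dg] := Cg; split=> [x Ux|v].
  by apply: differentiable_comp; [exact: df|exact/dg/UB].
apply: (Ck_ext (f := fun x => \sum_i c i ('D_v f x) * ('D_(e i) g \o f) x)) => //.
  move=> x Ux; have dgx : differentiable g (f x) by exact/dg/UB.
  rewrite [in RHS]deriveE; last exact: differentiable_comp (df x Ux) dgx.
  rewrite (diff_comp (df x Ux) dgx) /= [in RHS](cE ('d f x v)) linear_sum /=.
  apply: eq_bigr => i _; rewrite linearZ /= -(deriveE (e i) dgx).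
  by rewrite -(deriveE v (df x Ux)).
apply: Ck_sum => // i _; apply: CkM => //.
  have [l1 l2] := lc i.
  by apply: (@Ck_linear _ _ _ k U (fun x => 'D_v f x) (c i)) => //; exact: Df.
by apply: IH => //; first [exact: Dg|exact: Ck_pred].
Qed.

Lemma Ck_basis V W k (U : set V) (f : V -> W) m (e : 'I_m -> W) (c : 'I_m -> W -> R) :
  open U -> (forall v, v = \sum_i c i v *: e i) ->
  (forall i, Ck k U (c i \o f)) -> Ck k U f.
Proof.
move=> oU cE h.
apply: (@Ck_ext _ _ k U (fun x => \sum_i c i (f x) *: e i) f oU) => [x Ux|].
  exact/esym/cE.
by apply: Ck_sum => // i _; apply: CkZl => //; exact: h.
Qed.

Lemma Ck_comp V W X k (U : set V) (B : set W) (f : V -> W) (g : W -> X) :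
  has_basis W -> has_basis X ->
  open U -> open B -> (forall x, U x -> B (f x)) ->
  Ck k U f -> Ck k B g -> Ck k U (g \o f).
Proof.
move=> hW [m [e [c [lc cE]]]] oU oB UB Cf Cg.
apply: (Ck_basis oU cE) => i; apply: (Ck_comp0 (g := c i \o g) hW oU oB UB Cf).
by have [l1 l2] := lc i; exact: (@Ck_linear _ _ _ k B g (c i)).
Qed.

Lemma has_basis_R : has_basis R.
Proof.
exists 1%N, (fun _ => 1), (fun _ => id); split.
  by move=> _; split=> // x; exact: cvg_id.
by move=> v; rewrite big_ord1 /GRing.scale /= mulr1.
Qed.

Lemma linear_entry n (i : 'I_n) : linear (fun v : 'rV[R]_n => v 0 i).
Proof. by move=> a u v; rewrite !mxE. Qed.

Lemma has_basis_rV n : has_basis 'rV[R]_n.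
Proof.
exists n, (fun i => delta_mx 0 i), (fun i (v : 'rV[R]_n) => v 0 i); split.
  by move=> i; split; [exact: linear_entry|exact: coord_continuous].
exact: row_sum_delta.
Qed.

Lemma has_basis_prod V W : has_basis V -> has_basis W -> has_basis (V * W)%type.
Proof.
move=> [m [e [c [lc cE]]]] [m' [e' [c' [lc' cE']]]].
exists (m + m')%N, (fun i : 'I_(m + m') => match fintype.split i with inl j => (e j, 0) | inr j => (0, e' j) end),
  (fun (i : 'I_(m + m')) (v : V * W) => match fintype.split i with inl j => c j v.1 | inr j => c' j v.2 end).
split=> [i|[v w]].
  case: (fintype.split i) => j; [have [l1 l2] := lc j|have [l1 l2] := lc' j]; split.
  - by move=> a u v /=; rewrite l1.
  - by move=> v; apply: (continuous_comp (@cvg_fst _ _ _ _ _)); exact: l2.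
  - by move=> a u v /=; rewrite l1.
  - by move=> v; apply: (continuous_comp (@cvg_snd _ _ _ _ _)); exact: l2.
rewrite big_split_ord /=.
under eq_bigr do rewrite (unsplitK (inl _)).
under [X in _ + X]eq_bigr do rewrite (unsplitK (inr _)).
rewrite {1}[v]cE {1}[w]cE'.
have fE (I : Type) (r : seq I) (F : I -> V * W) : (\sum_(i <- r) F i).1 = \sum_(i <- r) (F i).1.
  by elim/big_rec2: _ => //= i y1 y2 _ ->.
have sE (I : Type) (r : seq I) (F : I -> V * W) : (\sum_(i <- r) F i).2 = \sum_(i <- r) (F i).2.
  by elim/big_rec2: _ => //= i y1 y2 _ ->.
apply: injective_projections; rewrite /= ?fE ?sE /=.
  by rewrite [X in _ = _ + X]big1 ?addr0 // => i _; exact: scaler0.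
by rewrite [X in _ = X + _]big1 ?add0r // => i _; exact: scaler0.
Qed.
End Ck.

Section Ck2.
Variable R : realType.
Implicit Types V W X : normedModType R.

Lemma CkSc V W k (U : set V) (f : V -> R) (g : V -> W) : has_basis W -> open U ->
  Ck k U f -> Ck k U g -> Ck k U (fun x => f x *: g x).
Proof.
move=> [m [e [c [lc cE]]]] oU Cf Cg; apply: (Ck_basis oU cE) => i.
have [l1 l2] := lc i.
apply: (@Ck_ext _ _ _ _ _ (fun x => f x * c i (g x))) => // [x _|].
  have := l1 (f x) (g x) 0; rewrite addr0 /= => ->.
  suff -> : c i 0 = 0 by rewrite addr0.
  by have := l1 (-1) 0 0; rewrite scaler0 addr0 scaleN1r addNr.
by apply: CkM => //; exact: (Ck_linear (l := c i)).
Qed.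

Lemma continuous_fst V W : continuous (@fst V W).
Proof. by move=> x; exact: cvg_fst. Qed.

Lemma continuous_snd V W : continuous (@snd V W).
Proof. by move=> x; exact: cvg_snd. Qed.

Lemma linear_fst V W : linear (@fst V W). Proof. by []. Qed.
Lemma linear_snd V W : linear (@snd V W). Proof. by []. Qed.

Lemma linear_inl V W : linear (fun v : V => (v, 0 : W)).
Proof. by move=> a u v; apply: injective_projections => //=; rewrite scaler0 addr0. Qed.
Lemma linear_inr V W : linear (fun w : W => (0 : V, w)).
Proof. by move=> a u v; apply: injective_projections => //=; rewrite scaler0 addr0. Qed.
Lemma continuous_inl V W : continuous (fun v : V => (v, 0 : W)).
Proof. by move=> v; apply: cvg_pair; [exact: cvg_id|exact: cvg_cst]. Qed.
Lemma continuous_inr V W : continuous (fun w : W => (0 : V, w)).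
Proof. by move=> v; apply: cvg_pair; [exact: cvg_cst|exact: cvg_id]. Qed.

Lemma Ck_pair V W X k (U : set V) (f : V -> W) (g : V -> X) : open U ->
  Ck k U f -> Ck k U g -> Ck k U (fun x => (f x, g x)).
Proof.
move=> oU Cf Cg.
apply: (@Ck_ext _ _ _ _ _ (fun x => (f x, 0) + (0, g x))) => // [x _|].
  by apply: injective_projections; rewrite /= ?addr0 ?add0r.
apply: CkD => //.
  exact: (Ck_linear oU (@linear_inl _ _) (@continuous_inl _ _)).
exact: (Ck_linear oU (@linear_inr _ _) (@continuous_inr _ _)).
Qed.

Lemma Ck_fst V W k (U : set (V * W)%type) : Ck k U fst.
Proof.
case: k => [|k] /=; first by move=> x _; exact: cvg_fst.
split=> [x _|v].
  by have [] := linear_diff (@linear_fst V W) (@continuous_fst V W) x.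
rewrite (_ : (fun x => _) = cst v.1); first exact: Ck_cst.
rewrite funeqE => x; have [d1 d2] := linear_diff (@linear_fst V W) (@continuous_fst V W) x.
by rewrite deriveE // d2.
Qed.

Lemma Ck_snd V W k (U : set (V * W)%type) : Ck k U snd.
Proof.
case: k => [|k] /=; first by move=> x _; exact: cvg_snd.
split=> [x _|v].
  by have [] := linear_diff (@linear_snd V W) (@continuous_snd V W) x.
rewrite (_ : (fun x => _) = cst v.2); first exact: Ck_cst.
rewrite funeqE => x; have [d1 d2] := linear_diff (@linear_snd V W) (@continuous_snd V W) x.
by rewrite deriveE // d2.
Qed.

Lemma Ck_id V k (U : set V) : Ck k U id.
Proof.
apply: (@Ck_lin _ _ _ k U idfun); by move=> x; exact: cvg_id.
Qed.

Lemma open_setXT V W (U : set V) : open U -> open (U `*` [set: W]).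
Proof.
rewrite openE => oU; rewrite openE => -[x y] [/= /oU Ux _].
by exists (U, setT) => //; split => //=; exact: filterT.
Qed.

(** The vector enters linearly: expanding it in a basis leaves derivatives of [f] in fixed
    directions, which depend on the base point only. *)
Lemma Ck_tangent V W k (U : set V) (f : V -> W) : has_basis V -> has_basis W -> open U ->
  Ck k.+1 U f -> Ck k (U `*` [set: V]) (fun x : V * V => 'd f (x.1 : V) x.2).
Proof.
move=> hV hW oU Cf; have [df Df] := Cf; have oUT := @open_setXT V V U oU.
have [m [e [c [lc cE]]]] := hV.
apply: (@Ck_ext _ _ _ _ _ (fun x => \sum_i c i x.2 *: 'D_(e i) f x.1)) => //.
  move=> [x w] [/= Ux _]; rewrite [in RHS](cE w) linear_sum; apply: eq_bigr => i _.
  by rewrite linearZ /= deriveE //; exact: df.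
apply: Ck_sum => // i _; apply: CkSc => //.
  have [l1 l2] := lc i.
  by apply: (Ck_linear (l := c i)) => //; exact: Ck_snd.
apply: (@Ck_comp _ _ _ _ _ _ U fst ('D_(e i) f)) => //; last exact: Df.
  by move=> x [].
exact: Ck_fst.
Qed.

Lemma is_derive_diff_comp V W (f : V -> W) (c : R -> V) t dc :
  differentiable f (c t) -> is_derive t 1 c dc -> is_derive t 1 (f \o c) ('d f (c t) dc).
Proof.
move=> df [dct <-]; have dct' : differentiable c t by apply/derivable1_diffP.
have dfc := differentiable_comp dct' df.
apply: DeriveDef; first exact: diff_derivable.
by rewrite deriveE // (diff_comp dct' df) /= deriveE.
Qed.

Lemma is_derive_line V (x u : V) (s : R) : is_derive s 1 (fun s => x + s *: u) u.
Proof.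
have ll : linear (fun s : R => s *: u) by move=> a p q; rewrite scalerDl scalerA.
have cl : continuous (fun s : R => s *: u) by move=> p; apply: cvgZr_tmp; exact: cvg_id.
have [d1 d2] := linear_diff ll cl s.
have : is_derive s 1 (fun s : R => s *: u) u.
  by apply: DeriveDef; [exact: diff_derivable | rewrite deriveE // d2 scale1r].
move=> h; rewrite -[X in is_derive _ _ _ X]add0r.
exact: (is_deriveD (f := cst x)).
Qed.

(** The mean value theorem is applied along [u] to the difference between the values of [f] on two
    opposite edges of the square, then along [v] to ['D_u f]. *)
Lemma mixed_difference V (U : set V) (f : V -> R) (x u v : V) (h : R) : Ck 2 U f -> 0 < h ->
  (forall a b, 0 <= a <= h -> 0 <= b <= h -> U (x + a *: u + b *: v)) ->
  exists a b, [/\ 0 <= a <= h, 0 <= b <= h &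
   f (x + h *: u + h *: v) - f (x + h *: u) - f (x + h *: v) + f x =
   h * h * 'D_v ('D_u f) (x + a *: u + b *: v)].
Proof.
move=> [df Df] h0 hU.
pose p s := f (x + s *: u + h *: v) - f (x + s *: u + 0 *: v).
pose dp s := 'D_u f (x + s *: u + h *: v) - 'D_u f (x + s *: u + 0 *: v).
have h00 : 0 <= (0:R) <= h by rewrite lexx ltW.
have hhh : 0 <= h <= h by rewrite lexx ltW.
have line s w : U (x + s *: u + w) -> is_derive s 1 (fun s => f (x + s *: u + w)) ('D_u f (x + s *: u + w)).
  move=> Us; rewrite deriveE; last exact: df.
  apply: (is_derive_diff_comp (c := fun s => x + s *: u + w)); first exact: df.
  have := is_derive_line (x + w) u s.
  by rewrite (_ : (fun s => _) = (fun s => x + s *: u + w)) // funeqE => y; rewrite addrAC.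
have [a] : exists2 a, a \in `]0, h[ & p h - p 0 = dp a * (h - 0).
  apply: (@MVT _ p dp); [exact: h0|move=> s|].
    rewrite in_itv /= => /andP[s0 sh]; apply: is_deriveB; apply: line; apply: hU => //; exact/andP/(conj (ltW _) (ltW _)).
  apply: derivable_within_continuous => s; rewrite in_itv /= => sh.
  by apply: derivableB; apply: ex_derive; apply: line; exact: hU.
rewrite in_itv /= => /andP[a0 ah] pE.
pose q s := 'D_u f (x + a *: u + s *: v).
have ah' : 0 <= a <= h by rewrite !ltW.
have lq s : 0 <= s <= h -> is_derive s 1 q ('D_v ('D_u f) (x + a *: u + s *: v)).
  move=> sh; have [dD _] := Df u.
  have dd : differentiable ('D_u f) (x + a *: u + s *: v) by apply: dD; exact: hU.
  rewrite deriveE //.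
  apply: (is_derive_diff_comp (f := 'D_u f) (c := fun s => x + a *: u + s *: v)) => //.
  exact: is_derive_line.
have [b] : exists2 b, b \in `]0, h[ & q h - q 0 = 'D_v ('D_u f) (x + a *: u + b *: v) * (h - 0).
  apply: (@MVT _ q (fun b => 'D_v ('D_u f) (x + a *: u + b *: v))); [exact: h0|move=> s|].
    by rewrite in_itv /= => /andP[s0 sh]; apply: lq; rewrite !ltW.
  apply: derivable_within_continuous => s; rewrite in_itv /= => sh.
  by apply: ex_derive; exact: lq.
rewrite in_itv /= => /andP[b0 bh] qE.
exists a, b; split; rewrite ?(ltW a0) ?(ltW ah) ?(ltW b0) ?(ltW bh) //.
move: pE; rewrite /p /dp -/(q h) -/(q 0) qE !subr0 !scale0r !addr0 => pE.
by rewrite mulrC mulrA -pE; ring.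
Qed.

(** The second difference over a square is symmetric in [u] and [v], so each small square contains a
    point for each mixed derivative where the two take the same value; continuity at [x] concludes.
    It gives the symmetry of the second derivatives of transition maps, hence the transformation law
    of Christoffel symbols. *)
Lemma schwarz V (U : set V) (f : V -> R) (x u v : V) : open U -> Ck 2 U f -> U x ->
  'D_v ('D_u f) x = 'D_u ('D_v f) x.
Proof.
move=> oU Cf Ux; have [df Df] := Cf.
have [_ D1] := Df u; have [_ D2] := Df v.
have c1 : {for x, continuous ('D_v ('D_u f))} by apply: D1; exact: mem_set.
have c2 : {for x, continuous ('D_u ('D_v f))} by apply: D2; exact: mem_set.
have cl : continuous (fun z : R * R => x + z.1 *: u + z.2 *: v).
  move=> z; apply: cvgD; first apply: cvgD; first exact: cvg_cst.
    by apply: cvgZr_tmp; exact: cvg_fst.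
  by apply: cvgZr_tmp; exact: cvg_snd.
have l0 : x + (0:R) *: u + (0:R) *: v = x by rewrite !scale0r !addr0.
have clx : (x + z.1 *: u + z.2 *: v) @[z --> ((0:R), (0:R))] --> x.
  by have := cl (0, 0); rewrite /continuous_at /= l0.
apply/eqP; rewrite -subr_eq0 -normr_le0; apply/ler_addgt0Pl => e e0; rewrite addr0.
have nU : \forall z \near ((0:R), (0:R)), U (x + z.1 *: u + z.2 *: v).
  by apply: clx; exact: open_nbhs_nbhs.
have e2 : 0 < e / 2 by rewrite divr_gt0.
have n1 : \forall z \near ((0:R), (0:R)), `|'D_v ('D_u f) x - 'D_v ('D_u f) (x + z.1 *: u + z.2 *: v)| < e / 2.
  by move/cvgrPdist_lt : c1 => h; exact: (clx _ (h _ e2)).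
have n2 : \forall z \near ((0:R), (0:R)), `|'D_u ('D_v f) x - 'D_u ('D_v f) (x + z.1 *: u + z.2 *: v)| < e / 2.
  by move/cvgrPdist_lt : c2 => h; exact: (clx _ (h _ e2)).
have nn := filterI nU (filterI n1 n2).
have [d /= d0 hd] := (@nbhs_ballP R (R * R)%type _ _).1 (nn _ _).
have hb a b : 0 <= a <= d / 2 -> 0 <= b <= d / 2 -> ball ((0:R), (0:R)) d (a, b).
  move=> /andP[a0 ad] /andP[b0 bd]; split; rewrite /= /ball /= sub0r normrN ger0_norm //;
  lra.
have d2 : 0 < d / 2 by rewrite divr_gt0.
have [a [b [ha hb' E1]]] : exists a b, [/\ 0 <= a <= d/2, 0 <= b <= d/2 &
   f (x + (d/2) *: u + (d/2) *: v) - f (x + (d/2) *: u) - f (x + (d/2) *: v) + f x =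
   (d/2) * (d/2) * 'D_v ('D_u f) (x + a *: u + b *: v)].
  by apply: mixed_difference Cf d2 _ => a b ha hb'; have [] := hd _ (hb a b ha hb').
have [b' [a' [hb1 ha1 E2]]] : exists a b, [/\ 0 <= a <= d/2, 0 <= b <= d/2 &
   f (x + (d/2) *: v + (d/2) *: u) - f (x + (d/2) *: v) - f (x + (d/2) *: u) + f x =
   (d/2) * (d/2) * 'D_u ('D_v f) (x + a *: v + b *: u)].
  apply: mixed_difference Cf d2 _ => b' a' hb1 ha1.
  by have [] := hd _ (hb a' b' ha1 hb1); rewrite /= addrAC.
have EE : 'D_v ('D_u f) (x + a *: u + b *: v) = 'D_u ('D_v f) (x + b' *: v + a' *: u).
  apply: (@mulfI _ ((d / 2) * (d / 2))); first by rewrite mulf_neq0 // gt_eqF.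
  apply: etrans (esym E1) _; apply: etrans _ E2; congr (_ + _).
  by rewrite [RHS]addrAC; congr (f _ - _ - _); rewrite addrAC.
rewrite [x + b' *: v + _]addrAC in EE.
have [_ [h1 _]] := hd _ (hb a b ha hb').
have [_ [_ h2]] := hd _ (hb a' b' ha1 hb1).
rewrite /= in h1 h2; rewrite EE in h1.
rewrite [e]splitr -(subrKA ('D_u ('D_v f) (x + a' *: u + b' *: v))).
apply: (le_trans (ler_normD _ _)); apply: lerD; first exact: ltW h1.
by rewrite distrC; exact: ltW h2.
Qed.

End Ck2.

(** * Tangent vectors in charts *)

Section Charts.
Variables (R : realType) (n : nat) (M : manifold R n).
Implicit Types (x y : M) (z w v : 'rV[R]_n).

Definition chart_img x : set 'rV[R]_n := phi x @` phi_dom x.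
Definition trans x y : 'rV[R]_n -> 'rV[R]_n := phi y \o phi_inv x.
Definition tdom x y : set 'rV[R]_n := phi x @` (phi_dom x `&` phi_dom y).
(** Inverse of [to_fiber]: from the components in the distinguished chart at [q] to those in the
    chart [x]. *)
Definition vcoord x q : 'rV[R]_n -> 'rV[R]_n := 'd (trans q x) (phi q q).

Lemma phiK x q : phi_dom x q -> phi_inv x (phi x q) = q.
Proof. by move=> xq; apply: cmapK; exact: mem_set. Qed.

Lemma phi_dom_self x : phi_dom x x.
Proof. exact: mem_chart_at. Qed.

Lemma chart_imgP x z : chart_img x z <-> phi_dom x (phi_inv x z) /\ phi x (phi_inv x z) = z.
Proof.
split=> [[q xq <-]|[h <-]]; first by rewrite phiK.
by exists (phi_inv x z).
Qed.

Lemma phi_chart_img x q : phi_dom x q -> chart_img x (phi x q).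
Proof. by exists q. Qed.

Lemma open_chart_img x : open (chart_img x).
Proof. exact: open_ccodom. Qed.

Lemma open_phi_dom x : open (phi_dom x).
Proof. exact: open_cdom. Qed.

Lemma phi_continuous x q : phi_dom x q -> {for q, continuous (phi x)}.
Proof. by move=> xq; apply: cmap_continuous; exact: mem_set. Qed.

Lemma nbhs_phi x q A : phi_dom x q -> nbhs (phi x q) A -> nbhs q (phi x @^-1` A).
Proof. by move=> xq; exact: (phi_continuous xq). Qed.

Lemma phi_inv_continuous x z : chart_img x z -> {for z, continuous (phi_inv x)}.
Proof. by move=> xq; apply: cinv_continuous; exact: mem_set. Qed.

Lemma tdomE x y z : tdom x y z <-> chart_img x z /\ phi_dom y (phi_inv x z).
Proof.
split=> [[q [xq yq] <-]|[[q xq <-]]].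
  by split; [exists q|rewrite phiK].
by rewrite phiK // => yq; exists q.
Qed.

Lemma nbhs_phi_dom x q : phi_dom x q -> nbhs q (phi_dom x).
Proof. by move=> xq; apply: open_nbhs_nbhs; split=> //; exact: open_phi_dom. Qed.

Lemma nbhs_chart_img x z : chart_img x z -> nbhs z (chart_img x).
Proof. by move=> xq; apply: open_nbhs_nbhs; split=> //; exact: open_chart_img. Qed.

Lemma open_tdom x y : open (tdom x y).
Proof.
rewrite openE => z /tdomE[xz yz].
have h1 := nbhs_chart_img xz.
have h2 : nbhs z (phi_inv x @^-1` phi_dom y).
  exact: (phi_inv_continuous xz (nbhs_phi_dom yz)).
by apply: filterS (filterI h1 h2) => t [? ?]; apply/tdomE.
Qed.

Lemma nbhs_tdom x y z : tdom x y z -> nbhs z (tdom x y).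
Proof. by move=> xq; apply: open_nbhs_nbhs; split=> //; exact: open_tdom. Qed.

Lemma Ck_trans k x y : Ck k (tdom x y) (trans x y).
Proof. exact: smooth_transition. Qed.

Lemma differentiable_trans x y z : tdom x y z -> differentiable (trans x y) z.
Proof. by move=> h; have [+ _] := Ck_trans 1 x y; exact. Qed.

Lemma phi_inv_trans x y z : tdom x y z -> phi_inv y (trans x y z) = phi_inv x z.
Proof. by move=> /tdomE[_ yz]; rewrite /trans /= phiK. Qed.

Lemma trans_tdom x y (t : M) z : tdom x y z -> tdom x t z -> tdom y t (trans x y z).
Proof.
move=> xyz /tdomE[xz wz]; apply/tdomE; rewrite phi_inv_trans //; split=> //.
by move/tdomE: xyz => [_]; exact: phi_chart_img.
Qed.

Lemma dtrans_comp x y (t : M) z v : tdom x y z -> tdom x t z ->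
  'd (trans x t) z v = 'd (trans y t) (trans x y z) ('d (trans x y) z v).
Proof.
move=> xyz xtz; have d1 := differentiable_trans xyz.
have d2 := differentiable_trans (trans_tdom xyz xtz).
have E : {near z, trans y t \o trans x y =1 trans x t}.
  by apply: filterS (nbhs_tdom xyz) => s h; rewrite /trans /= phi_inv_trans.
have [_ E'] := near_eq_differentiable E (differentiable_comp d1 d2).
transitivity ('d (trans y t \o trans x y) z v); first exact: (congr1 (@^~ v) E').
exact: (congr1 (@^~ v) (diff_comp d1 d2)).
Qed.

Lemma dtrans_id x z v : chart_img x z -> 'd (trans x x) z v = v.
Proof.
move=> xz.
have [_ ->] : differentiable (trans x x) z /\
    'd (trans x x) z = 'd (@id 'rV[R]_n) z :> (_ -> _).
  apply: near_eq_differentiable; last exact: ex_diff.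
  by apply: filterS (nbhs_chart_img xz) => s /chart_imgP[_ h].
by rewrite diff_val.
Qed.

Lemma trans_phi x y q : phi_dom x q -> trans x y (phi x q) = phi y q.
Proof. by move=> xq; rewrite /trans /= phiK. Qed.

Lemma tdom_self x z : chart_img x z -> tdom x (phi_inv x z) z.
Proof. by move=> xz; apply/tdomE; split=> //; exact: phi_dom_self. Qed.

Lemma tdom_phi x y q : phi_dom x q -> phi_dom y q -> tdom x y (phi x q).
Proof. by exists q. Qed.

Lemma to_fiber_trans x y z v : tdom x y z ->
  to_fiber x z v = to_fiber y (trans x y z) ('d (trans x y) z v).
Proof.
move=> xyz; have [xz yz] := (tdomE x y z).1 xyz.
rewrite /to_fiber -/(trans _ _) phi_inv_trans // -/(trans _ _).
exact: dtrans_comp xyz (tdom_self xz).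
Qed.

Lemma to_fiber_id (q : M) v : to_fiber q (phi q q) v = v.
Proof.
rewrite /to_fiber phiK; last exact: phi_dom_self.
by apply: dtrans_id; apply: phi_chart_img; exact: phi_dom_self.
Qed.

Lemma to_fiberE x q v : phi_dom x q -> to_fiber x (phi x q) v = 'd (trans x q) (phi x q) v.
Proof. by move=> xq; rewrite /to_fiber phiK. Qed.

Lemma vcoordK x q v : phi_dom x q -> to_fiber x (phi x q) (vcoord x q v) = v.
Proof.
move=> xq; have qq := phi_dom_self q.
rewrite -[RHS](to_fiber_id q) [RHS](to_fiber_trans (y := x)); last exact: tdom_phi.
by rewrite trans_phi //.
Qed.

Lemma to_fiberK x q v : phi_dom x q -> vcoord x q (to_fiber x (phi x q) v) = v.
Proof.
move=> xq; have qq := phi_dom_self q.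
have E := dtrans_comp v (tdom_phi xq qq) (tdom_phi xq xq).
rewrite (trans_phi q xq) in E; rewrite to_fiberE //.
exact: etrans (esym E) (dtrans_id v (phi_chart_img xq)).
Qed.

Lemma TM_local_trans x y (F : M -> 'rV[R]_n -> R) z v : tdom x y z ->
  TM_local x F (z, v) = TM_local y F (trans x y z, 'd (trans x y) z v).
Proof. by move=> xyz; rewrite /TM_local /= -to_fiber_trans // phi_inv_trans. Qed.

Lemma TM_local_phi x q (F : M -> 'rV[R]_n -> R) w : phi_dom x q ->
  TM_local x F (phi x q, w) = F q (to_fiber x (phi x q) w).
Proof. by move=> xq; rewrite /TM_local /= phiK. Qed.

Lemma TM_local_vcoord x q (F : M -> 'rV[R]_n -> R) v : phi_dom x q ->
  F q v = TM_local x F (phi x q, vcoord x q v).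
Proof. by move=> xq; rewrite TM_local_phi // vcoordK. Qed.

Lemma TM_local_id q (F : M -> 'rV[R]_n -> R) v : TM_local q F (phi q q, v) = F q v.
Proof. by rewrite TM_local_phi ?to_fiber_id //; exact: phi_dom_self. Qed.

Definition ext_TM x (F : 'rV[R]_n * 'rV[R]_n -> R) (q : M) (v : 'rV[R]_n) : R :=
  if `[< phi_dom x q >] then F (phi x q, vcoord x q v) else 0.

Lemma ext_TME x F q v : phi_dom x q -> ext_TM x F q v = F (phi x q, vcoord x q v).
Proof. by move=> xq; rewrite /ext_TM asboolT. Qed.

Lemma TM_local_ext x F z v : chart_img x z -> TM_local x (ext_TM x F) (z, v) = F (z, v).
Proof.
move=> [q xq <-]; rewrite TM_local_phi // ext_TME // to_fiberK //.
Qed.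

Lemma TM_local_ext_trans x y F z v : tdom y x z ->
  TM_local y (ext_TM x F) (z, v) = F (trans y x z, 'd (trans y x) z v).
Proof.
move=> yxz; rewrite (TM_local_trans _ _ yxz) TM_local_ext //.
have [yz xz] := (tdomE y x z).1 yxz; exact: phi_chart_img.
Qed.

Lemma Ck_TM_trans k x y (F : 'rV[R]_n * 'rV[R]_n -> R) : Ck k (chart_img y `*` setT) F ->
  Ck k (tdom x y `*` setT) (fun p => F (trans x y p.1, 'd (trans x y) (p.1 : 'rV[R]_n) p.2)).
Proof.
move=> CF; have oT := @open_setXT R _ 'rV[R]_n _ (@open_tdom x y).
have oC := @open_setXT R _ 'rV[R]_n _ (@open_chart_img y).
apply: (Ck_comp0 (f := fun p => (trans x y p.1, 'd (trans x y) (p.1 : 'rV[R]_n) p.2))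
  (g := F) (B := chart_img y `*` setT)) => //.
- exact: has_basis_prod (has_basis_rV _ _) (has_basis_rV _ _).
- by move=> p [/= /tdomE[_ h] _]; split=> //=; exact: phi_chart_img.
apply: Ck_pair => //.
  apply: (Ck_comp (f := fst) (g := trans x y) (B := tdom x y)) => //.
  - exact: has_basis_rV.
  - exact: has_basis_rV.
  - exact: open_tdom.
  - by move=> p [].
  - exact: Ck_fst.
  - exact: Ck_trans.
apply: Ck_tangent; [exact: has_basis_rV|exact: has_basis_rV|exact: open_tdom|].
exact: Ck_trans.
Qed.

(** The delicate points are those outside the domain of the chart [x], where the extension by zero
    could jump. The image of [K] in the manifold is compact, hence closed because the manifold is
    Hausdorff, so such a point has a neighborhood on which the extension vanishes. *)
Lemma ext_TM_smooth x (F : 'rV[R]_n * 'rV[R]_n -> R) (K : set 'rV[R]_n) :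
  compact K -> K `<=` chart_img x -> smooth_on (chart_img x `*` setT) F ->
  (forall z v, ~ K z -> F (z, v) = 0) -> TM_smooth (ext_TM x F).
Proof.
move=> cK Kx sF F0 y k; apply: Ck_local => -[z w] [/= yz _].
pose KM := phi_inv x @` K.
have cKM : closed KM.
  apply: compact_closed; first exact: manifold_hausdorff.
  apply: continuous_compact => //; apply: continuous_in_subspaceT => t /set_mem Kt.
  exact/phi_inv_continuous/Kx.
have [yx|nyx] := pselect (tdom y x z).
  exists (tdom y x `*` setT) => //.
  apply: (Ck_ext (f := fun p => F (trans y x p.1, 'd (trans y x) (p.1 : 'rV[R]_n) p.2))).
  - exact/open_setXT/open_tdom.
  - by move=> [t v] [/= tyx _]; rewrite TM_local_ext_trans.
  - by apply: Ck_TM_trans; exact: sF.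
pose B := chart_img y `&` phi_inv y @^-1` (~` KM).
have oB : open B.
  rewrite openE => t [yt KMt]; apply: filterI; first exact: nbhs_chart_img.
  apply: (phi_inv_continuous yt); apply: open_nbhs_nbhs; split => //.
  exact: closed_openC.
exists (B `*` setT).
  split=> //; split=> // -[t Kt tz]; apply: nyx; apply/tdomE; split=> //.
  by rewrite -tz; have /chart_imgP[] := Kx _ Kt.
apply: (Ck_ext (f := cst 0)); [exact: open_setXT| |exact: Ck_cst].
move=> [t v] [/= [yt KMt] _]; rewrite /TM_local /ext_TM /=.
case: asboolP => // xt; rewrite F0 // => Kt; apply: KMt.
by exists (phi x (phi_inv y t)) => //; rewrite phiK.
Qed.
End Charts.

(** * Tonelli Lagrangians *)

Lemma set_maxE (R : realType) (A : set R) m :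
  A m -> (forall x, A x -> x <= m) -> set_max A = m.
Proof.
move=> Am hm; apply: xget_unique => // y [Ay hy].
by apply/eqP; rewrite eq_le hm //= hy.
Qed.

Lemma set_minE (R : realType) (A : set R) m :
  A m -> (forall x, A x -> m <= x) -> set_min A = m.
Proof.
move=> Am hm; apply: xget_unique => // y [Ay hy].
by apply/eqP; rewrite eq_le hm // andbT hy.
Qed.

(** A form of the tube lemma; it turns pointwise inequalities at one parameter into inequalities
    uniform over a compact set for nearby parameters. *)
Lemma compact_near_pos (R : realType) (T V : topologicalType) (K : set V) (t0 : T)
    (G : T * V -> R) : compact K -> (forall v, K v -> {for (t0, v), continuous G}) ->
  (forall v, K v -> 0 < G (t0, v)) -> \forall t \near t0, forall v, K v -> 0 < G (t, v).
Proof.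
move=> /compact_near_coveringP cK cG pG.
apply: (cK T (nbhs t0) (fun t v => 0 < G (t, v))) => v Kv.
have [[A B] /= [At Bv] AB] : nbhs (t0, v) (G @^-1` [set y | 0 < y]).
  by apply: (cG v Kv); apply: open_nbhs_nbhs; split; [exact: open_gt|exact: pG].
exists (B, A) => //= -[v' t'] [/= Bv' At'].
exact: (AB (t', v')).
Qed.

Lemma compact_norm_le (R : realType) n (r : R) : compact [set v : 'rV[R]_n | `|v| <= r].
Proof.
apply: bounded_closed_compact.
  exists r; split; first exact: num_real.
  by move=> s rs v /= vr; exact: le_trans vr (ltW rs).
apply: (@preimage_closed _ _ (fun v : 'rV[R]_n => `|v|) [set y | y <= r]); last exact: closed_le.
by move=> v _; exact: norm_continuous.
Qed.

Lemma continuous_pair_at (T U V : topologicalType) (f : T -> U) (g : T -> V) t :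
  {for t, continuous f} -> {for t, continuous g} -> {for t, continuous (fun s => (f s, g s))}.
Proof. by move=> cf cg; exact: (cvg_pair cf cg). Qed.

Section Tonelli.
Variables (R : realType) (n : nat) (M : manifold R n).
Implicit Types (F L : M -> 'rV[R]_n -> R).

Lemma fiber_Ck F q k : TM_smooth F -> Ck k setT (F q).
Proof.
move=> sF.
apply: (@Ck_ext _ _ _ _ _ (TM_local q F \o (fun v => (phi q q, v)))).
- exact: openT.
- by move=> v _; rewrite /= TM_local_id.
apply: (@Ck_comp0 _ _ _ k setT (chart_img q `*` setT) (fun v => (phi q q, v)) (TM_local q F)).
- exact: has_basis_prod (has_basis_rV _ _) (has_basis_rV _ _).
- exact: openT.
- exact/open_setXT/open_chart_img.
- by move=> v _; split => //; exact/phi_chart_img/phi_dom_self.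
- by apply: Ck_pair; [exact: openT|exact: Ck_cst|exact: Ck_id].
- exact: sF.
Qed.

Lemma TM_local_continuous F x z v : TM_smooth F -> chart_img x z ->
  {for (z, v), continuous (TM_local x F)}.
Proof. by move=> sF xz; apply: (sF x 0); apply: mem_set; split. Qed.

Lemma to_fiber0 (x : M) z : to_fiber x z 0 = 0.
Proof. exact: linear0. Qed.

Lemma zero_section_local F x q : phi_dom x q -> F q 0 = TM_local x F (phi x q, 0 : 'rV[R]_n).
Proof. by move=> xq; rewrite TM_local_phi // to_fiber0. Qed.

Lemma zero_section_continuous F : TM_smooth F -> continuous (fun q => F q 0).
Proof.
move=> sF q; have qq := phi_dom_self q; have oq := nbhs_phi_dom qq.
have h : (TM_local q F \o (fun p => (phi q p, 0 : 'rV[R]_n))) p @[p --> q] --> F q 0.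
  rewrite (zero_section_local F qq).
  apply: (@continuous_comp _ _ _ (fun p => (phi q p, 0 : 'rV[R]_n)) (TM_local q F) q); last first.
    exact: (TM_local_continuous sF (phi_chart_img qq)).
  by apply: continuous_pair_at; [exact: phi_continuous|exact: cvg_cst].
apply: cvg_trans h; apply: near_eq_cvg; apply: filterS oq => p qp /=.
by rewrite -zero_section_local.
Qed.

Lemma energy0 L q : energy L q 0 = - L q 0.
Proof. by rewrite /energy linear0 sub0r. Qed.

Lemma e0E L q0 : (forall q, L q0 0 <= L q 0) -> e0 L = - L q0 0.
Proof.
move=> h; apply: set_maxE; first by exists q0 => //; rewrite energy0.
by move=> _ [q _ <-]; rewrite energy0 lerN2.
Qed.

Lemma zero_section_min L : closed_manifold M -> TM_smooth L ->
  exists q0, forall q, L q0 0 <= L q 0.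
Proof.
move=> [cM _ M0] sL.
have [|q0 _ h] := @compact_EVT_min _ _ (fun q => L q 0) _ M0 cM.
  by apply: continuous_subspaceT; exact: zero_section_continuous.
by exists q0 => q; apply: h; rewrite inE.
Qed.

(** Convexity along the ray through [w]: the value rises between [0] and [w], so the slope is
    positive somewhere before [w], and the slope does not decrease afterwards. *)
Lemma fiber_ray_ge L q w (l : R) : tonelli L -> L q 0 < L q w -> 1 <= l -> L q 0 <= L q (l *: w).
Proof.
move=> [sL _ cL] h01 l1.
have w0 : w != 0 by apply/eqP => w0; move: h01; rewrite w0 ltxx.
have [dL D1] := fiber_Ck q 2 sL; have [dD _] := D1 w.
pose g s := L q (s *: w); pose g' s := 'D_w (L q) (s *: w).
have line (s : R) : is_derive s 1 (fun s : R => s *: w) w.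
  have := @is_derive_line R 'rV[R]_n 0 w s.
  by rewrite (_ : (fun s => 0 + s *: w) = (fun s => s *: w)) // funeqE => y; rewrite add0r.
have dg (s : R) : is_derive s 1 g (g' s).
  rewrite /g' deriveE; last exact: dL.
  by apply: (is_derive_diff_comp (c := fun s => s *: w)); first [exact: dL|exact: line].
have dg' (s : R) : is_derive s 1 g' ('D_w ('D_w (L q)) (s *: w)).
  rewrite deriveE; last exact: dD.
  by apply: (is_derive_diff_comp (f := 'D_w (L q)) (c := fun s => s *: w)); first [exact: dD|exact: line].
have cg (a b : R) : {within `[a, b], continuous g}.
  by apply: derivable_within_continuous => s _; apply: ex_derive; exact: dg.
have cg' (a b : R) : {within `[a, b], continuous g'}.
  by apply: derivable_within_continuous => s _; apply: ex_derive; exact: dg'.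
have [a a01 ga] := MVT ltr01 (fun x _ => dg x) (cg _ _).
have g'a : 0 < g' a.
  by move: ga; rewrite subr0 mulr1 => <-; rewrite subr_gt0 /g scale0r scale1r.
have mono (s t : R) : s <= t -> g' s <= g' t.
  move=> st; have [c _ E] := MVT_segment st (fun x _ => dg' x) (cg' _ _).
  rewrite -subr_ge0 E mulr_ge0 ?subr_ge0 // ltW //; exact: cL.
have [c ca E] := MVT_segment l1 (fun x _ => dg x) (cg _ _).
apply: (le_trans (ltW h01)); rewrite -subr_ge0.
have -> : L q (l *: w) - L q w = g l - g 1 by rewrite /g scale1r.
rewrite E mulr_ge0 ?subr_ge0 //.
apply: ltW; apply: (lt_le_trans g'a); apply: mono.
move: a01 ca; rewrite !in_itv /= => /andP[_ a1] /andP[c1 _].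
exact: ltW (lt_le_trans a1 c1).
Qed.

(** Superlinearity is assumed in each fiber, with no uniformity in [q], and convexity supplies what
    is missing. On a large sphere [L] exceeds its value at zero velocity; by compactness of the
    sphere this persists for [q] near [q0], and [fiber_ray_ge] then bounds [L q] from below outside
    the ball. Inside, compactness of the ball suffices. *)
Lemma tonelli_lower_bound_local L (q0 : M) : tonelli L ->
  exists B : R, nbhs q0 [set q | forall v, B <= L q v].
Proof.
move=> tL; have [sL supL _] := tL.
pose x := q0; pose z0 := phi q0 q0.
have [r0 hr0] := supL q0 (`|L q0 0| + 1).
pose r := Num.max r0 1.
have r1 : 1 <= r by rewrite le_max lexx orbT.
have rpos : 0 < r by exact: lt_le_trans r1.
have hr v : `|v| = r -> L q0 0 + 1 <= L q0 v.
  move=> vr; have := hr0 v; rewrite vr le_max lexx => /(_ isT); apply: le_trans.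
  apply: (@le_trans _ _ (`|L q0 0| + 1)); first by rewrite lerD2r ler_norm.
  by rewrite ler_peMr // addr_ge0.
pose K := [set v : 'rV[R]_n | `|v| <= r].
have cK : compact K by exact: compact_norm_le.
have z0c : chart_img x z0 by exact/phi_chart_img/phi_dom_self.
have cT v : {for (z0, v), continuous (TM_local x L)} by exact: TM_local_continuous.
have [v0 _ hv0] : exists2 v0, v0 \in K & forall v, v \in K -> L q0 v0 <= L q0 v.
  apply: compact_EVT_min => //; first by exists 0; rewrite /K /= normr0 ltW.
  apply: continuous_subspaceT => v; have := fiber_Ck q0 0 sL; apply.
  by rewrite inE.
pose B := L q0 v0 - 1.
pose S := [set v : 'rV[R]_n | `|v| = r].
have cS : compact S.
  apply: (@subclosed_compact _ _ K) => //; last by move=> v; rewrite /S /K /= => ->.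
  apply: (@preimage_closed _ _ (fun v : 'rV[R]_n => `|v|) [set y | y = r]); last exact: closed_eq.
  by move=> v _; exact: norm_continuous.
pose A1 := [set z | forall v, K v -> 0 < TM_local x L (z, v) - B].
have n1 : nbhs z0 A1.
  apply: (compact_near_pos (G := fun p => TM_local x L p - B)) => // [v Kv|v Kv].
    by apply: continuousB; [exact: cT|exact: cvg_cst].
  rewrite TM_local_id subr_gt0 /B ltrBlDr; apply: (le_lt_trans (hv0 v _)).
    by rewrite inE.
  by rewrite ltrDl.
pose A2 := [set z | forall v, S v -> 0 < TM_local x L (z, v) - TM_local x L (z, 0 : 'rV[R]_n)].
have n2 : nbhs z0 A2.
  apply: (compact_near_pos (G := fun p => TM_local x L p - TM_local x L (p.1, 0 : 'rV[R]_n))) => // [v Kv|v Kv].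
    apply: continuousB; first exact: cT.
    apply: (continuous_comp (f := fun p : 'rV[R]_n * 'rV[R]_n => (p.1, 0 : 'rV[R]_n))); last exact: cT.
    by apply: continuous_pair_at; [exact: cvg_fst|exact: cvg_cst].
  rewrite /= !TM_local_id subr_gt0; apply: (lt_le_trans _ (hr v Kv)).
  by rewrite ltrDl.
exists B.
have m1 : nbhs q0 (phi x @^-1` A1)  := nbhs_phi (phi_dom_self q0) n1.
have m2 : nbhs q0 (phi x @^-1` A2)  := nbhs_phi (phi_dom_self q0) n2.
have m0 := nbhs_phi_dom (phi_dom_self q0).
apply: filterS (filterI m0 (filterI m1 m2)) => q [xq [h1 h2]] v.
have K0 : K 0 by rewrite /K /= normr0 ltW.
rewrite (TM_local_vcoord (x := x)) //; set w := vcoord x q v.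
have [wr|wr] := lerP `|w| r; first by rewrite -subr_ge0 ltW //; exact: h1.
have wpos : 0 < `|w| by exact: lt_trans rpos wr.
pose w1 := (r / `|w|) *: w.
have w1S : S w1 by rewrite /S /= normrZ normrM normfV normr_id gtr0_norm // divfK ?gt_eqF.
have wE : w = (`|w| / r) *: w1.
  by rewrite scalerA mulrA divfK ?gt_eqF // divff ?gt_eqF // scale1r.
have h3 := h2 _ w1S; rewrite !TM_local_phi // to_fiber0 subr_gt0 in h3.
have h4 := h1 _ K0; rewrite !TM_local_phi // to_fiber0 subr_gt0 in h4.
apply: (le_trans (ltW h4)); rewrite TM_local_phi // wE /to_fiber linearZ.
apply: fiber_ray_ge => //.
by rewrite ler_pdivlMr // mul1r ltW.
Qed.

Lemma tonelli_lower_bound L : closed_manifold M -> tonelli L ->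
  exists C, forall q v, C <= L q v.
Proof.
move=> [/compact_near_coveringP cM _ _] tL.
(* Compactness in its near-covering form, with the filter of constants tending to minus infinity: a
   local bound makes every smaller constant work nearby, so some constant works everywhere. *)
have : \forall C \near -oo, setT `<=` (fun q => forall v, C <= L q v).
  apply: cM => q _; have [B hB] := tonelli_lower_bound_local q tL.
  have hC : \forall C \near -oo, C <= B by apply: nbhs_ninfty_le; exact: num_real.
  exists ([set q | forall v, B <= L q v], [set C | C <= B]) => //.
  by move=> [q' C] [/= h1 h2] v; exact: le_trans h2 (h1 v).
move=> h; have [C hC] := filter_ex h.
by exists C => q; apply: hC.
Qed.
End Tonelli.

(** * Velocities of curves and measurability *)

Section Velocity.
Variables (R : realType) (n : nat).
Implicit Types M N : manifold R n.

Lemma phi_curve_near M (x : M) (c : R -> M) t : {for t, continuous c} ->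
  phi_dom x (c t) -> \forall s \near t, phi_dom x (c s).
Proof. by move=> cc xt; exact: (cc _ (nbhs_phi_dom xt)). Qed.

Lemma open_curve_preimage M (x : M) (c : R -> M) : continuous c -> open (c @^-1` phi_dom x).
Proof. by move/continuousP; apply; exact: open_phi_dom. Qed.

Lemma velocity_chart M (x : M) (c : R -> M) t w : {for t, continuous c} ->
  phi_dom x (c t) -> is_derive t 1 (phi x \o c) w ->
  is_derive t 1 (phi (c t) \o c) (to_fiber x (phi x (c t)) w).
Proof.
move=> cc xt dc.
have dtr := differentiable_trans (tdom_phi xt (phi_dom_self (c t))).
have h := is_derive_diff_comp (c := phi x \o c) dtr dc.
rewrite to_fiberE //; apply: near_eq_is_derive h.
apply: filterS (phi_curve_near cc xt) => s xs.
by rewrite /= trans_phi.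
Qed.

Lemma velocityE M (x : M) (c : R -> M) t w : {for t, continuous c} ->
  phi_dom x (c t) -> is_derive t 1 (phi x \o c) w ->
  velocity c t = to_fiber x (phi x (c t)) w.
Proof.
move=> cc xt dc; rewrite /velocity derive1E.
by have [_ ->] := velocity_chart cc xt dc.
Qed.

Lemma derivable_chart M (x y : M) (c : R -> M) t : {for t, continuous c} ->
  phi_dom x (c t) -> phi_dom y (c t) -> derivable (phi x \o c) t 1 ->
  derivable (phi y \o c) t 1.
Proof.
move=> cc xt yt /derivableP dc.
have dtr := differentiable_trans (tdom_phi xt yt).
have h := is_derive_diff_comp (c := phi x \o c) dtr dc.
apply: near_eq_derivable (ex_derive (is_derive := h)).
apply: filterS (phi_curve_near cc xt) => s xs.
by rewrite /= trans_phi.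
Qed.

(* Outside the differentiability set, [derive1] is the limit of a divergent filter,
   whose junk value is 0. *)
Lemma velocity0 M (c : R -> M) t : ~ derivable (phi (c t) \o c) t 1 -> velocity c t = 0.
Proof.
move=> nd; rewrite /velocity derive1E /derive dvgP //.
by apply/rowP => i; rewrite !mxE.
Qed.

Lemma smooth_map_local N M (U : set N) (f : N -> M) (y : N) (x : M) k : smooth_map_on U f ->
  Ck k (phi y @` (phi_dom y `&` U `&` f @^-1` phi_dom x)) (phi x \o f \o phi_inv y).
Proof. by move=> [_ h]; exact: h. Qed.

Lemma tangent_velocity N M (f : N -> M) (U : set N) (c : R -> N) t : smooth_map_on U f ->
  U (c t) -> {for t, continuous c} -> derivable (phi (c t) \o c) t 1 ->
  is_derive t 1 (phi (f (c t)) \o (f \o c)) (tangent_map f (c t) (velocity c t)).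
Proof.
move=> sf Uc cc dc; set q := c t.
have [df _] := smooth_map_local q (f q) 1 sf.
have dq : differentiable (phi (f q) \o f \o phi_inv q) (phi q q).
  by apply: df; exists q => //; split; [split=> //|]; exact: phi_dom_self.
have dc' : is_derive t 1 (phi q \o c) (velocity c t).
  by rewrite /velocity derive1E; apply/derivableP.
have h := is_derive_diff_comp (c := phi q \o c) dq dc'.
apply: near_eq_is_derive h.
apply: filterS (phi_curve_near cc (phi_dom_self q)) => s xs.
by rewrite /= phiK.
Qed.

Lemma tangent_velocityE N M (f : N -> M) (U : set N) (c : R -> N) t : smooth_map_on U f ->
  U (c t) -> {for t, continuous c} -> derivable (phi (c t) \o c) t 1 ->
  tangent_map f (c t) (velocity c t) = velocity (f \o c) t.
Proof.
by move=> sf Uc cc dc; have [_ <-] := tangent_velocity sf Uc cc dc; rewrite /velocity derive1E.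
Qed.

End Velocity.

(** * Measurability of a Lagrangian along a continuous curve *)

Section Measurability.
Variable R : realType.

(** The rational intervals whose trace on [D] is measurable are countably many and cover [D]; the
    other intervals are made to contribute [set0]. *)
Lemma measurable_locally (D : set R) :
  (forall t, exists2 V : set R, open V /\ V t & measurable (D `&` V)) -> measurable D.
Proof.
move=> h.
pose I (q : rat * rat) : set R := `]ratr q.1, ratr q.2[%classic.
pose J q := if `[< measurable (D `&` I q) >] then D `&` I q else set0.
have -> : D = \bigcup_q J q.
  rewrite eqEsubset; split=> [t Dt|t [q _]]; last first.
    by rewrite /J; case: asboolP => // _ [].
  have [V [oV Vt] mV] := h t.
  have [e /= e0 eV] := (nbhs_ballP t V).1 (open_nbhs_nbhs (conj oV Vt)).
  have [a] := @rat_in_itvoo R (t - e) t ltac:(by rewrite ltrBlDr ltrDl).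
  have [b] := @rat_in_itvoo R t (t + e) ltac:(by rewrite ltrDl).
  rewrite !in_itv /= => /andP[tb be] /andP[ea at'].
  have IV : I (a, b) `<=` V.
    move=> s; rewrite /I /= in_itv /= => /andP[s1 s2]; apply: eV.
    rewrite /ball /= ltr_distlC (lt_trans ea s1) /=.
    exact: lt_trans s2 be.
  exists (a, b) => //; rewrite /J asboolT.
    by split=> //; rewrite /I /= in_itv /= at' tb.
  by rewrite -(setIidr IV) setIA; apply: measurableI => //; exact: measurable_itv.
apply: countable_bigcupT_measurable; first exact: countableP.
by move=> q; rewrite /J; case: asboolP.
Qed.

Lemma measurable_fun_locally (f : R -> R) :
  (forall t, exists2 V : set R, open V /\ V t & measurable_fun V f) ->
  measurable_fun setT f.
Proof.
move=> h _ Y mY; rewrite setTI; apply: measurable_locally => t.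
have [V [oV Vt] mV] := h t; exists V => //.
by rewrite setIC; apply: mV => //; exact: open_measurable.
Qed.

(* By the Cauchy criterion for difference quotients, whose failure at a given
   scale and with a given gap is an open condition. *)
Lemma derivable_measurable_open (V : set R) (f : R -> R) : open V ->
  {in V, continuous f} -> measurable [set t | V t /\ derivable f t 1].
Proof.
move=> oV cf.
pose q h t : R := h^-1 * (f (h + t) - f t).
pose B (k m : nat) := [set t | V t /\ exists h h', [/\ `|h| < k.+1%:R^-1, `|h'| < k.+1%:R^-1,
   h != 0 /\ h' != 0, V (h + t) /\ V (h' + t) & m.+1%:R^-1 < `|q h t - q h' t|]].
have cq h t : V t -> V (h + t) -> {for t, continuous (q h)}.
  move=> Vt Vht; apply: continuousM; first exact: cvg_cst.
  apply: continuousB; last by apply: cf; rewrite inE.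
  apply: (continuous_comp (f := fun t => h + t)); last by apply: cf; rewrite inE.
  by apply: continuousD; [exact: cvg_cst|exact: cvg_id].
have shiftV h t : V (h + t) -> \forall s \near t, V (h + s).
  move=> Vht.
  have : {for t, continuous (fun s => h + s)} by apply: continuousD; [exact: cvg_cst|exact: cvg_id].
  by apply; exact: open_nbhs_nbhs.
have oB k m : open (B k m).
  rewrite openE => t [Vt [h [h' [hk hk' hh' [Vh Vh'] lt]]]].
  have n1 : \forall s \near t, V s by exact: open_nbhs_nbhs.
  have n2 : \forall s \near t, m.+1%:R^-1 < `|q h s - q h' s|.
    have cc : {for t, continuous (fun s => `|q h s - q h' s|)}.
      apply: (continuous_comp (f := fun s => q h s - q h' s)); last exact: norm_continuous.
      by apply: continuousB; exact: cq.
    by apply: (cc [set y | m.+1%:R^-1 < y]); apply: open_nbhs_nbhs; split=> //; exact: open_gt.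
  apply: filterS (filterI (filterI n1 n2) (filterI (shiftV _ _ Vh) (shiftV _ _ Vh'))).
  by move=> s [[V1 l1] [V2 V3]]; split=> //; exists h, h'.
have derE t : derivable f t 1 <-> cvg (q h t @[h --> 0^']).
  rewrite /derivable (_ : (fun h => _) = q^~ t) // funeqE => h.
  by rewrite /q /= /GRing.scale /= mulr1.
have -> : [set t | V t /\ derivable f t 1] = \bigcap_m \bigcup_k (V `\` B k m).
  rewrite eqEsubset; split=> [t [Vt]|t ht].
    move/derE/cvg_ex => [l /cvgrPdist_lt ql] m _.
    have e0 : 0 < m.+1%:R^-1 / 2 :> R by rewrite divr_gt0.
    have [d /= d0 hd] := ql _ e0.
    have [k _ kd] := near_infty_natSinv_lt (PosNum d0).
    exists k => //; split=> // -[_ [h [h' [hk hk' [h0 h0'] _]]]].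
    apply/negP; rewrite -leNgt.
    have h1 := hd h; rewrite /= sub0r normrN in h1.
    have h2 := hd h'; rewrite /= sub0r normrN in h2.
    have kd' := kd k (leqnn k).
    rewrite (splitr m.+1%:R^-1) -(subrKA l).
    apply: le_trans (ler_normD _ _) _; apply: lerD; apply: ltW.
      by rewrite distrC; apply: h1 => //; exact: lt_trans hk kd'.
    by apply: h2 => //; exact: lt_trans hk' kd'.
  have [k0 _ [Vt _]] := ht 0%N I.
  split=> //; apply/derE/cauchy_cvgP/cauchy_ballP => e e0.
  have [m _ me] := near_infty_natSinv_lt (PosNum e0).
  have [k _ [_ nB]] := ht m I.
  pose A := [set y | exists h, [/\ `|h| < k.+1%:R^-1, h != 0, V (h + t) & y = q h t]].
  have FA : (q h t @[h --> 0^']) A.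
    have k0' : 0 < k.+1%:R^-1 :> R by [].
    have n1 : \forall h \near (0:R)^', `|h| < k.+1%:R^-1 :> R.
      exact: dnbhs0_lt.
    have n2 : \forall h \near (0:R)^', h != 0 :> R by exact: nbhs_dnbhs_neq.
    have n3 : \forall h \near (0:R)^', V (h + t).
      apply: nbhs_dnbhs.
      have : {for (0:R), continuous (fun s => s + t)} by apply: continuousD; [exact: cvg_id|exact: cvg_cst].
      by apply; rewrite /= add0r; exact: open_nbhs_nbhs.
    by apply: filterS (filterI n1 (filterI n2 n3)) => h [? [? ?]]; exists h.
  exists (A, A) => //= -[y y'] [/= [h [hk h0 Vh ->]] [h' [hk' h0' Vh' ->]]].
  rewrite /ball /=; apply: (le_lt_trans _ (me m (leqnn m))).
  rewrite leNgt; apply/negP => lt; apply: nB; split=> //.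
  by exists h, h'.
apply: bigcapT_measurable => m; apply: bigcupT_measurable => k.
by apply: measurableD; exact: open_measurable.
Qed.

Lemma derivable_measurable n (N : manifold R n) (c : R -> N) : continuous c ->
  measurable [set t | derivable (phi (c t) \o c) t 1].
Proof.
move=> cc; apply: measurable_locally => t.
pose x := c t; pose V := c @^-1` phi_dom x.
have oV : open V.
  exact: open_curve_preimage.
exists V; first by split=> //; exact: phi_dom_self.
pose f i s := (phi x (c s)) 0 i.
have cf i : {in V, continuous (f i)}.
  move=> s /set_mem Vs; apply: (continuous_comp (f := phi x \o c) (g := fun v : 'rV[R]_n => v 0 i)); last exact: coord_continuous.
  by apply: continuous_comp; [exact: cc|exact: phi_continuous].
have -> : [set s | derivable (phi (c s) \o c) s 1] `&` V =
    V `&` \bigcap_(i : 'I_n) [set s | V s /\ derivable (f i) s 1].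
  rewrite eqEsubset; split=> s.
    move=> [ds Vs]; split=> // i _; split=> //.
    have := derivable_chart (cc s) (phi_dom_self _) Vs ds.
    by move/derivable_mxP/(_ 0 i).
  move=> [Vs hs]; split=> //=.
  apply: (derivable_chart (x := x)) => //; [exact: cc|exact: phi_dom_self|].
  by apply/derivable_mxP => i j; rewrite ord1; have [] := hs j I.
apply: measurableI; first exact: open_measurable.
apply: fin_bigcap_measurable => // i _.
exact: derivable_measurable_open.
Qed.

Lemma harmonic_dnbhs : (k.+1%:R^-1 : R) @[k --> \oo] --> (0:R)^'.
Proof.
move=> A hA; have h k : (k.+1%:R^-1 : R) != 0 by rewrite invr_eq0 pnatr_eq0.
have hA' : \forall k \near \oo, (k.+1%:R^-1 : R) != 0 -> A (k.+1%:R^-1).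
  exact: (@cvg_harmonic R _ hA).
suff : \forall k \near \oo, A (k.+1%:R^-1) by [].
by apply: filterS hA' => k hk; exact: hk (h k).
Qed.

(** Where the velocity exists it is the limit of difference quotients with steps 1/(k+1), so the
    integrand is there a limit of measurable functions. The set [D] is a parameter because in the
    application it is the differentiability set of a curve in the cover, while [c] is the projected
    curve; off [D] the lifted integrand is evaluated at the default velocity 0. *)
Lemma lagrangian_measurable n (M : manifold R n) (L : M -> 'rV[R]_n -> R) (c : R -> M)
    (D : set R) : TM_smooth L -> continuous c -> measurable D ->
  (forall t, D t -> derivable (phi (c t) \o c) t 1) ->
  measurable_fun setT (fun t => if `[< D t >] then L (c t) (velocity c t) else L (c t) 0).
Proof.
move=> sL cc mD hD; apply: measurable_fun_locally => t.
pose x := c t; pose V := c @^-1` phi_dom x.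
have oV : open V.
  exact: open_curve_preimage.
have mV : measurable V by exact: open_measurable.
exists V; first by split=> //; exact: phi_dom_self.
pose u s := phi x (c s).
have cu s : V s -> {for s, continuous u}.
  by move=> Vs; apply: continuous_comp; [exact: cc|exact: phi_continuous].
pose d k s := k.+1%:R *: (u (k.+1%:R^-1 + s) - u s).
pose Vk k := [set s | V s /\ V (k.+1%:R^-1 + s)].
have oVk k : open (Vk k).
  have cs : continuous (fun s : R => k.+1%:R^-1 + s).
    by move=> s; apply: cvgD; [exact: cvg_cst|exact: cvg_id].
  by apply: openI => //; move/continuousP: cs; apply.
(* The quotient is meaningful in the chart only when the shifted time stays in [V]. The value 0 used
   otherwise affects finitely many [k] for each [s]. *)
pose F k s := if `[< Vk k s >] then TM_local x L (u s, d k s) else 0.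
have mF k : measurable_fun V (F k).
  have -> : V = Vk k `|` (V `\` Vk k).
    by rewrite setDE setUIr setUCr setIT setUidr // => s [].
  apply/measurable_funU; [exact: open_measurable|by apply: measurableD => //; exact: open_measurable|split].
    apply: (eq_measurable_fun (fun s => TM_local x L (u s, d k s))).
      by move=> s /set_mem Vs; rewrite /F asboolT.
    apply: open_continuous_measurable_fun => // s /set_mem [Vs Vs'].
    apply: (continuous_comp (f := fun s => (u s, d k s))).
      apply: continuous_pair_at; first exact: cu.
      apply: continuousZ; first exact: cvg_cst.
      have c1 : {for s, continuous (fun s : R => k.+1%:R^-1 + s)}.
        by apply: continuousD; [exact: cvg_cst|exact: cvg_id].
      have c2 := @continuous_comp R R _ (fun s : R => k.+1%:R^-1 + s) u s c1 (cu _ Vs').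
      exact: (continuousB c2 (cu _ Vs)).
    by apply: TM_local_continuous => //; exact: phi_chart_img.
  apply: (eq_measurable_fun (@cst R R 0)); last exact: measurable_cst.
  by move=> s /set_mem [_ nVs]; rewrite /F asboolF.
have -> : V = (V `&` D) `|` (V `\` D) by rewrite setDE -setIUr setUCr setIT.
apply/measurable_funU; [exact: measurableI|exact: measurableD|split].
  apply: (eq_measurable_fun (fun s => L (c s) (velocity c s))).
    by move=> s /set_mem [_ Ds]; rewrite asboolT.
  apply: (@measurable_fun_cvg _ _ _ _ F).
    by move=> m; apply: measurable_funS (mF m) => // s [].
  move=> s [Vs Ds].
  have ds := derivable_chart (cc s) (phi_dom_self _) Vs (hD s Ds).
  rewrite (velocityE (x := x) (cc s) Vs (derivableP ds)) -TM_local_phi //.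
  have h : TM_local x L (u s, d k s) @[k --> \oo] --> TM_local x L (u s, 'D_1 u s).
    have c2 := TM_local_continuous (v := 'D_1 u s) sL (phi_chart_img Vs).
    have E k : d k s = (fun h : R => h^-1 *: ((u \o shift s) (h *: 1) - u s)) k.+1%:R^-1.
      by rewrite /d /= invrK /GRing.scale /= mulr1.
    have c1 : d k s @[k --> \oo] --> 'D_1 u s.
      by rewrite (funext E); exact: (cvg_comp _ _ harmonic_dnbhs ds).
    exact: (cvg_comp _ _ (cvg_pair (cvg_cst (u s)) c1) c2).
  apply: cvg_trans h; apply: near_eq_cvg.
  have cs : {for (0:R), continuous (fun h => h + s)}.
    by apply: continuousD; [exact: cvg_id|exact: cvg_cst].
  have nV : nbhs (0:R) [set h | V (h + s)].
    by apply: cs; rewrite /= add0r; exact: open_nbhs_nbhs.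
  have nV' : nbhs (0:R)^' [set h | V (h + s)] by exact: nbhs_dnbhs.
  have nO : \forall k \near \oo, V (k.+1%:R^-1 + s) := harmonic_dnbhs nV'.
  apply: filterS nO => k Vks.
  by rewrite /F asboolT.
apply: (eq_measurable_fun (fun s => L (c s) 0)).
  by move=> s /set_mem [_ Ds]; rewrite asboolF.
have h : continuous (fun s : R => L (c s) 0).
  move=> s; apply: (@continuous_comp _ _ _ c (fun q => L q 0)); first exact: cc.
  exact: zero_section_continuous.
by apply: (@measurable_funS _ _ _ _ setT) => //; exact: (continuous_measurable_fun h).
Qed.
End Measurability.

(** * Integrals over a period, possibly infinite *)

Section IntegralBounds.
Variable R : realType.
Local Notation mu := (@lebesgue_measure R).
Variables (p : R) (p0 : 0 < p).
Local Notation D := (`[0, p]%classic : set R).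

Lemma measure_period : mu D = p%:E.
Proof. by rewrite lebesgue_measure_itv /= lte_fin p0 sube0. Qed.

Lemma integral_cst_period (C : R) : (\int[mu]_(t in D) (C%:E) = (p * C)%:E)%E.
Proof.
rewrite integral_cst; last exact: measurable_itv.
by rewrite [X in (_ * X)%E]measure_period -EFinM mulrC.
Qed.

Lemma integrable_cst_period (C : R) : mu.-integrable D (cst C%:E).
Proof.
apply/integrableP; split; first exact: measurable_cst.
under eq_integral do rewrite /= .
by rewrite integral_cst_period ltry.
Qed.

(** The negative part has integral at most [p * |C|], so integrability can fail only through an
    infinite positive part. *)
Lemma bounded_below_integrable (f : R -> R) (C : R) : measurable_fun D f ->
  (forall t, D t -> C <= f t) ->
  (\int[mu]_(t in D) (f t)%:E = +oo)%E \/ mu.-integrable D (EFin \o f).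
Proof.
move=> mf fC; have mD : measurable (D : set (measurableTypeR R)) by exact: measurable_itv.
have mf' : measurable_fun D (EFin \o f) by exact/measurable_EFinP.
have fn : (\int[mu]_(t in D) ((EFin \o f)^\- t) < +oo)%E.
  apply: (@le_lt_trans _ _ (\int[mu]_(t in D) (`|C|%:E))%E); last first.
    by rewrite integral_cst_period ltry.
  apply: ge0_le_integral => //; first exact: measurable_funeneg.
  move=> t Dt; rewrite funenegE ge_max -EFinN !lee_fin normr_ge0 andbT.
  rewrite lerNl; apply: le_trans (fC t Dt); rewrite lerNl -normrN; exact: ler_norm.
have [fp|fp] := eqVneq (\int[mu]_(t in D) ((EFin \o f)^\+ t))%E +oo%E.
  left; rewrite integralE fp addye // eqe_oppLR /= .
  by rewrite lt_eqF.
right; apply/integrableP; split=> //.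
rewrite [X in (X < _)%E](_ : _ = \int[mu]_(t in D) ((EFin \o f)^\+ t + (EFin \o f)^\- t))%E; last first.
  by apply: eq_integral => t _; rewrite -[LHS]/((abse \o (EFin \o f)) t) fune_abse.
rewrite ge0_integralD //; [|exact: measurable_funepos|exact: measurable_funeneg].
by rewrite lte_add_pinfty // ltey.
Qed.

(** If the integral of [g] is infinite there is nothing to prove. Otherwise [f] lies between a
    constant and an integrable function, so it is integrable as well and the integrals are
    finite. *)
Lemma le_integral_shift (f g : R -> R) (C C' e : R) : measurable_fun D f -> measurable_fun D g ->
  (forall t, D t -> C <= f t) -> (forall t, D t -> C' <= g t) ->
  (forall t, D t -> f t <= g t + e) ->
  (\int[mu]_(t in D) (f t)%:E <= \int[mu]_(t in D) (g t)%:E + (p * e)%:E)%E.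
Proof.
move=> mf mg fC gC fg; have mD : measurable (D : set (measurableTypeR R)) by exact: measurable_itv.
have [->|ig] := bounded_below_integrable mg gC; first by rewrite addye // leey.
rewrite -integral_cst_period -integralD //; last exact: integrable_cst_period.
have ig' : mu.-integrable D (fun t => (g t)%:E + e%:E)%E.
  exact: (integrableD mD ig (integrable_cst_period e)).
apply: le_integral => //; last first.
  by move=> t /set_mem Dt; rewrite -EFinD lee_fin; exact: fg.
apply: (@le_integrable _ _ _ mu D mD _ (fun t => `|(g t)%:E + e%:E| + `|C|%:E)%E).
- exact/measurable_EFinP.
- move=> t Dt; rewrite /= lee_fin [leRHS]ger0_norm ?addr_ge0 //.
  rewrite ler_norml; apply/andP; split.
    rewrite lerNl; apply: (@le_trans _ _ `|C|); last by rewrite lerDr.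
    by apply: (@le_trans _ _ (- C)); [rewrite lerN2; exact: fC|rewrite -normrN; exact: ler_norm].
  apply: (le_trans (fg t Dt)).
  by apply: (le_trans (ler_norm _)); rewrite lerDl.
- exact: (integrableD mD (integrable_abse ig') (integrable_cst_period `|C|)).
Qed.

End IntegralBounds.

(** * Critical values and openness *)

Section Mane.
Variables (R : realType) (n : nat) (N : manifold R n) (L : N -> 'rV[R]_n -> R).

Definition nonneg_action (e : R) := forall (p : R) (gamma : R -> N),
    0 < p -> ac_periodic_curve p gamma ->
    (0 <= free_period_action L e p gamma)%E.

Lemma nonneg_action_le e e' : e <= e' -> nonneg_action e -> nonneg_action e'.
Proof.
move=> ee' h p c p0 hc; apply: (le_trans (h p c p0 hc)).
by rewrite /free_period_action leeD2l // lee_fin ler_pM2l.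
Qed.

(** Tested on a constant loop. This bounds the admissible energies from below, so that they have an
    infimum. *)
Lemma nonneg_action_cst e q : nonneg_action e -> - L q 0 <= e.
Proof.
move=> h.
have hc : ac_periodic_curve 1 (cst q : R -> N).
  split=> //; split; first by move=> ?; exact: cvg_cst.
  move=> x a b _ eps eps0; exists 1 => // m s t _ _ _.
  by rewrite big1 // => i _; rewrite /= subrr normr0.
have := h 1 (cst q) ltr01 hc; rewrite /free_period_action.
have vel t : velocity (cst q : R -> N) t = 0.
  by rewrite /velocity (_ : phi _ \o _ = cst (phi q q)) // derive1_cst.
rewrite [X in (_ <= X + _)%E](_ : _ = (1 * L q 0)%:E)%E; last first.
  by rewrite -(integral_cst_period ltr01); apply: eq_integral => t _; rewrite vel.
by rewrite !mul1r -EFinD lee_fin -lerBlDl sub0r.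
Qed.

Hypothesis N0 : [set: N] !=set0.
Variable C : R.
Hypothesis LC : forall q v, C <= L q v.
Hypothesis mL : forall c : R -> N, continuous c ->
  measurable_fun setT (fun t => L (c t) (velocity c t)).

Lemma nonneg_action_bound : nonneg_action (- C).
Proof.
move=> p c p0 [[cc _] _]; rewrite /free_period_action.
have mD : measurable (`[0, p]%classic : set R) by exact: measurable_itv.
have mc : measurable_fun `[0, p]%classic (fun t => L (c t) (velocity c t)).
  by apply: measurable_funS (mL cc).
have := @le_integral_shift R p p0 (cst C) (fun t => L (c t) (velocity c t)) C C 0
   (measurable_cst _) mc.
rewrite integral_cst_period // mulr0 adde0 => h.
rewrite mulrN EFinN sube_ge0 //; apply: h => t _ //.
by rewrite addr0.
Qed.

(** [set_min] falls back to 0 unless the minimum is attained, so attainment has to be proved. For a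
    given loop the action is either affine in [e] or identically [+oo], hence each condition is
    closed in [e] and the infimum satisfies all of them. The value [-oo] of the integral is excluded
    by [nonneg_action_bound]. *)
Lemma mane_spec : nonneg_action (mane_critical_value L) /\
  forall e, nonneg_action e -> mane_critical_value L <= e.
Proof.
have [q _] := N0.
pose A := [set e | nonneg_action e].
have hA : has_inf A.
  split; first by exists (- C); exact: nonneg_action_bound.
  by exists (- L q 0) => e; exact: nonneg_action_cst.
have lA e : A e -> inf A <= e by move=> Ae; apply: ge_inf => //; exact: hA.2.
have Ai : A (inf A).
  move=> p c p0 hc; rewrite /free_period_action.
  have hI e : A e -> (0 <= \int[lebesgue_measure]_(t in `[0%R, p])
     (L (c t) (velocity c t))%:E + (p * e)%:E)%E by apply.
  move: hI; case: (\int[lebesgue_measure]_(t in _) _)%E => [r| |] hI.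
  - rewrite -EFinD lee_fin -lerBlDl sub0r -ler_pdivrMl // mulrC.
    apply: lb_le_inf; first exact: hA.1.
    move=> e /hI; rewrite -EFinD lee_fin -lerBlDl sub0r.
    by rewrite -ler_pdivrMl // mulrC.
  - by rewrite addye // leey.
  - by have := hI _ nonneg_action_bound.
suff -> : mane_critical_value L = inf A by split.
exact: set_minE.
Qed.

End Mane.

Section Lift.
Variables (R : realType) (n : nat) (M N : manifold R n) (rho : N -> M).
Hypothesis rho_smooth : smooth_map_on setT rho.
Hypothesis rho_surj : forall q, exists x, rho x = q.
Hypothesis closedM : closed_manifold M.
Implicit Types L : M -> 'rV[R]_n -> R.

Lemma rho_continuous : continuous rho.
Proof. by move=> x; apply: rho_smooth.1; rewrite inE. Qed.

Lemma lift_measurable L (c : R -> N) : TM_smooth L -> continuous c ->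
  measurable_fun setT (fun t => lift_lagrangian rho L (c t) (velocity c t)).
Proof.
move=> sL cc; pose D := [set t | derivable (phi (c t) \o c) t 1].
have crc : continuous (rho \o c).
  by move=> t; apply: continuous_comp; [exact: cc|exact: rho_continuous].
have hD t : D t -> derivable (phi ((rho \o c) t) \o (rho \o c)) t 1.
  move=> Dt; have h := tangent_velocity rho_smooth I (cc t) Dt.
  exact: (ex_derive (is_derive := h)).
have := lagrangian_measurable sL crc (derivable_measurable cc) hD.
apply: eq_measurable_fun => t _; rewrite /lift_lagrangian.
case: asboolP => Dt.
  by rewrite (tangent_velocityE rho_smooth I (cc t) Dt).
by rewrite (velocity0 Dt) /tangent_map linear0.
Qed.

Lemma c_u_spec L : tonelli L ->
  nonneg_action (lift_lagrangian rho L) (c_u rho L) /\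
  forall e, nonneg_action (lift_lagrangian rho L) e -> c_u rho L <= e.
Proof.
move=> tL; have [C hC] := tonelli_lower_bound closedM tL.
have [_ _ [q _]] := closedM; have [x _] := rho_surj q.
apply: (@mane_spec _ _ _ _ _ C); first by exists x.
  by move=> y v; exact: hC.
by move=> c cc; apply: lift_measurable => //; case: tL.
Qed.

Lemma c_u_le_shift L L' e : tonelli L -> tonelli L' ->
  (forall q v, L' q v <= L q v + e) -> c_u rho L <= c_u rho L' + e.
Proof.
move=> tL tL' h; have [C hC] := tonelli_lower_bound closedM tL.
have [C' hC'] := tonelli_lower_bound closedM tL'.
apply: (c_u_spec tL).2 => p c p0 hc; have [[cc _] _] := hc.
apply: (le_trans ((c_u_spec tL').1 p c p0 hc)).
rewrite /free_period_action mulrDr [(p * _ + _)%R]addrC EFinD addeA; apply: leeD2r.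
have mD : measurable (`[0, p]%classic : set R) by exact: measurable_itv.
apply: (@le_integral_shift R p p0 _ _ C' C).
- by apply: measurable_funS (lift_measurable _ cc) => //; case: tL'.
- by apply: measurable_funS (lift_measurable _ cc) => //; case: tL.
- by move=> t _; exact: hC'.
- by move=> t _; exact: hC.
- by move=> t _; exact: h.
Qed.

Lemma C0_dist_le L L' e q v : (C0_dist L L' < e%:E)%E -> `|L q v - L' q v| <= e.
Proof.
move=> h; rewrite -lee_fin; apply: le_trans (ltW h).
by apply: ereal_sup_ubound; exists (q, v).
Qed.

Lemma tonelli_lt_open : open_in (C0_dist (n:=n) (M:=M)) [set L | tonelli L] (tonelli_lt rho).
Proof.
(* A third of the difference: [c_u] and [e0] each consume at most one third, and a positive third
   remains. *)
move=> L [tL lt]; exists ((c_u rho L - e0 L) / 3); first by rewrite divr_gt0 // subr_gt0.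
set e := _ / 3 => L' tL' d.
have h q v : `|L q v - L' q v| <= e by exact: C0_dist_le d.
have h1 q v : L q v <= L' q v + e.
  by have := h q v; rewrite ler_distl => /andP[].
have h2 q v : L' q v <= L q v + e.
  by have := h q v; rewrite ler_distl => /andP[]; rewrite lerBlDr.
split=> //; have c1 := c_u_le_shift tL tL' h2.
have [q0 hq0] := zero_section_min closedM (let: And3 s _ _ := tL in s).
have [q1 hq1] := zero_section_min closedM (let: And3 s _ _ := tL' in s).
have E : 3 * e = c_u rho L - e0 L by rewrite /e mulrC divfK.
have h3 := h1 q1 0; have h4 := hq0 q1.
rewrite (e0E hq1); rewrite (e0E hq0) in E lt; lra.
Qed.

End Lift.

(** * Cutoff functions *)

Section Bump.
Variable R : realType.

Lemma Ck_real k (f f' : R -> R) : (forall t : R, is_derive t 1 f (f' t)) ->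
  Ck k setT f' -> Ck k.+1 setT f.
Proof.
move=> h Cf'; have df (t : R) : differentiable f t.
  by apply/derivable1_diffP; have [] := h t.
split=> [t _|v]; first exact: df.
apply: (Ck_ext (f := fun t => v * f' t)); first exact: openT.
  move=> t _; rewrite deriveE; last exact: df.
  rewrite -[X in 'd f t X]mulr1 -/(v *: (1:R)) linearZ /= -deriveE; last exact: df.
  by have [_ ->] := h t.
apply: CkM => //; first exact: openT.
exact: Ck_cst.
Qed.

Lemma is_derive_quadratic (f : R -> R) (C : R) : (forall h, `|f h| <= C * h ^+ 2) ->
  is_derive (0:R) 1 f 0.
Proof.
move=> hf.
have f0 : f 0 = 0.
  by apply/eqP; rewrite -normr_le0; apply: le_trans (hf 0) _; rewrite expr0n /= mulr0.
have C0 : 0 <= C.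
  by have := le_trans (normr_ge0 _) (hf 1); rewrite expr1n mulr1.
have l : h^-1 *: ((f \o shift 0) (h *: 1) - f 0) @[h --> (0:R)^'] --> (0:R).
  apply/cvgrPdist_le => e e0; near=> h.
  have h0 : h != 0 by near: h; exact: nbhs_dnbhs_neq.
  rewrite sub0r normrN f0 subr0 /= addr0 /GRing.scale /= mulr1 normrM normfV.
  rewrite ler_pdivrMl ?normr_gt0 //; apply: (le_trans (hf h)).
  rewrite -real_normK ?num_real // expr2 mulrCA ler_wpM2l //.
  have hC : `|h| < e / (C + 1).
    by near: h; apply: dnbhs0_lt; rewrite divr_gt0 // ltr_wpDl.
  apply: (@le_trans _ _ ((C + 1) * `|h|)); first by rewrite ler_wpM2r // lerDl.
  by rewrite mulrC -ler_pdivlMr ?ltr_wpDl // ltW.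
by apply: DeriveDef; [apply/cvg_ex; exists 0|exact: cvg_lim l].
Unshelve. all: by end_near. Qed.

(* Taking monomials in t^-1 as prefactors gives a family stable under derivation. *)
Definition flat (m : nat) (t : R) : R := if 0 < t then t^-1 ^+ m * expR (- t^-1) else 0.

Lemma expR_ge_pow (N : nat) (y : R) : 0 <= y -> (y / N.+1%:R) ^+ N.+1 <= expR y.
Proof.
move=> y0; have N0 : (N.+1%:R : R) != 0 by rewrite pnatr_eq0.
rewrite -{2}(divfK N0 y) expRM_natr lerXn2r ?nnegrE ?divr_ge0 ?expR_ge0 //.
by apply: le_trans (expR_ge1Dx _); rewrite lerDr.
Qed.

(** The exponential dominates the power [m.+2] of [h^-1]; of this, [m] factors absorb the prefactor
    and two remain as [h ^+ 2]. A quadratic bound is what makes the derivative at 0 vanish. *)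
Lemma flat_quadratic m h : `|flat m h| <= m.+2%:R ^+ m.+2 * h ^+ 2.
Proof.
rewrite /flat; case: ifP => [h0|_]; last by rewrite normr0 mulr_ge0 ?sqr_ge0 // exprn_ge0.
rewrite ger0_norm ?mulr_ge0 ?exprn_ge0 ?expR_ge0 ?invr_ge0 ?(ltW h0) //.
have := @expR_ge_pow m.+1 h^-1; rewrite invr_ge0 ltW // => /(_ isT) hh.
set y := h^-1 in hh *; set M : R := m.+2%:R in hh *.
have M0 : M != 0 by rewrite pnatr_eq0.
have -> : y ^+ m = M ^+ m.+2 * h ^+ 2 * (y / M) ^+ m.+2.
  rewrite exprMn [y ^+ _ * _]mulrC mulrACA -exprMn divff // expr1n mul1r.
  by rewrite -[m.+2]add2n exprD mulrA -exprMn divff ?expr1n ?mul1r // gt_eqF.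
rewrite -[leRHS]mulr1 -[leLHS]mulrA; apply: ler_wpM2l.
  by rewrite mulr_ge0 ?sqr_ge0 // exprn_ge0.
by rewrite expRN -ler_pdivlMr ?invr_gt0 ?expR_gt0 // div1r invrK.
Qed.

Lemma flat_derive m (t : R) : is_derive t 1 (flat m) (flat m.+2 t - m%:R * flat m.+1 t).
Proof.
have [t0|t0|->] := ltgtP t 0.
- have e0 j : flat j t = 0 by rewrite /flat ltNge (ltW t0).
  rewrite !e0 mulr0 subr0.
  apply: (near_eq_is_derive (f := @cst R R 0)).
  have := open_nbhs_nbhs (conj (@open_lt R 0) t0).
  by apply: filterS => s /= s0; rewrite /flat ltNge (ltW s0).
- have tn : t != 0 by rewrite gt_eqF.
  have dV : is_derive t 1 (fun s : R => s^-1) (- t^-1 ^+ 2).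
    have h := is_deriveV tn (is_derive_id t 1).
    by rewrite exprVn -[X in is_derive _ _ _ X]mulr1.
  pose g (y : R) := y ^+ m * expR (- y).
  have dg (y : R) : is_derive y 1 g ((m%:R * y ^+ m.-1 - y ^+ m) * expR (- y)).
    have h1 : is_derive y 1 (fun y : R => y ^+ m) (m%:R * y ^+ m.-1).
      apply: DeriveDef; first exact: exprn_derivable.
      by rewrite exp_derive /GRing.scale /= mulr1.
    have h2 := is_derive1_comp (is_derive_expR (- y)) (is_deriveNid y 1).
    have -> : (m%:R * y ^+ m.-1 - y ^+ m) * expR (- y) =
        y ^+ m *: (expR (- y) * -1) + expR (- y) *: (m%:R * y ^+ m.-1).
      by rewrite /GRing.scale /=; ring.
    exact: (is_deriveM h1 h2).
  have dgc := is_derive1_comp (dg t^-1) dV.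
  have E : flat m.+2 t - m%:R * flat m.+1 t =
     ((m%:R * t^-1 ^+ m.-1 - t^-1 ^+ m) * expR (- t^-1)) * (- t^-1 ^+ 2).
    rewrite /flat t0; set a := expR _; set y := t^-1; case: (m) => [|k] /=.
      by rewrite !expr0; ring.
    by rewrite !exprS; move: (k.+1%:R : R) (y ^+ k) => b c; ring.
  rewrite E; apply: near_eq_is_derive dgc.
  have := open_nbhs_nbhs (conj (@open_gt R 0) t0).
  by apply: filterS => s /= s0; rewrite /flat s0.
- have e0 j : flat j 0 = 0 by rewrite /flat ltxx.
  rewrite !e0 mulr0 subr0; exact: is_derive_quadratic (flat_quadratic m).
Qed.

Lemma Ck_flat k m : Ck k setT (flat m).
Proof.
elim: k m => [|k IH] m.
  move=> t _; apply: differentiable_continuous.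
  by apply/derivable1_diffP; have [] := flat_derive m t.
apply: (Ck_real (flat_derive m)); apply: CkB; [exact: openT|exact: IH|].
by apply: CkM; [exact: openT|exact: Ck_cst|exact: IH].
Qed.

Definition bump (t : R) := flat 0 t.

Lemma bump_ge0 t : 0 <= bump t.
Proof. by rewrite /bump /flat; case: ifP => // _; rewrite mulr_ge0 ?expR_ge0. Qed.

Lemma bump_gt0 t : 0 < t -> 0 < bump t.
Proof. by move=> t0; rewrite /bump /flat t0 expr0 mul1r expR_gt0. Qed.

Lemma bump_eq0 t : t <= 0 -> bump t = 0.
Proof. by move=> t0; rewrite /bump /flat ltNge t0. Qed.

Lemma bump_le s t : s <= t -> bump s <= bump t.
Proof.
move=> st; have [s0|s0] := lerP s 0; first by rewrite bump_eq0 // bump_ge0.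
have t0 : 0 < t by exact: lt_le_trans st.
by rewrite /bump /flat s0 t0 !expr0 !mul1r ler_expR lerN2 lef_pV2.
Qed.

Variable n : nat.
Implicit Types (V : normedModType R) (y z w : 'rV[R]_n).

(** Square of the Euclidean norm. The norm of ['rV[R]_n] is the sup norm, which is not smooth enough
    to build cutoffs. *)
Definition sqn y : R := \sum_i (y 0 i) ^+ 2.

Lemma Ck_entry V k (U : set V) (f : V -> 'rV[R]_n) i : open U -> Ck k U f ->
  Ck k U (fun x => f x 0 i).
Proof.
move=> oU Cf; apply: (@Ck_linear R _ _ _ k U f (fun y : 'rV[R]_n => y 0 i)) => //.
  exact: linear_entry.
exact: coord_continuous.
Qed.

Lemma Ck_sqn V k (U : set V) (f : V -> 'rV[R]_n) : open U -> Ck k U f ->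
  Ck k U (fun x => sqn (f x)).
Proof.
move=> oU Cf; apply: Ck_sum => // i _.
apply: (Ck_ext (f := fun x => f x 0 i * f x 0 i)) => //.
by apply: CkM => //; exact: Ck_entry.
Qed.

Lemma norm_entry y i : `|y 0 i| <= `|y|.
Proof.
by rewrite [leRHS]/Num.Def.normr /= mx_normrE; exact: (le_bigmax _ (fun ij => `|y ij.1 ij.2|) (0, i)).
Qed.

Lemma norm_entry_le y (a : R) : 0 <= a -> (forall i, `|y 0 i| <= a) -> `|y| <= a.
Proof.
move=> a0 h; rewrite /Num.Def.normr /= mx_normrE; apply: bigmax_le => //= -[i j] _ /=.
by rewrite ord1.
Qed.

Lemma norm_le_sqn y (a : R) : 0 <= a -> sqn y <= a ^+ 2 -> `|y| <= a.
Proof.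
move=> a0 h; apply: norm_entry_le => // i.
rewrite -(@ler_pXn2r _ 2) ?nnegrE // real_normK ?num_real //.
apply: le_trans h; rewrite /sqn (bigD1 i) //= lerDl.
by apply: sumr_ge0 => j _; exact: sqr_ge0.
Qed.

(* An annular cutoff: only its value 1 on the unit sphere matters, and dispensing
   with a plateau at the center keeps it a single composition with [bump]. *)
Definition chi y : R := bump (1 - (sqn y - 1) ^+ 2) / bump 1.

Lemma bump1_gt0 : 0 < bump 1. Proof. exact: bump_gt0. Qed.

Lemma chi_ge0 y : 0 <= chi y.
Proof. by rewrite divr_ge0 ?bump_ge0. Qed.

Lemma chi_le1 y : chi y <= 1.
Proof.
rewrite ler_pdivrMr ?bump1_gt0 // mul1r; apply: bump_le.
by rewrite gerBl sqr_ge0.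
Qed.

Lemma chi0 : chi 0 = 0.
Proof.
rewrite /chi; have -> : sqn 0 = 0 by apply: big1 => i _; rewrite mxE expr0n.
by rewrite sub0r sqrrN expr1n subrr bump_eq0 // ?mul0r.
Qed.

Lemma chi_circle y : sqn y = 1 -> chi y = 1.
Proof.
by move=> h; rewrite /chi h subrr expr0n /= subr0 divff // gt_eqF // bump1_gt0.
Qed.

(** The cutoff vanishes as soon as [sqn y >= 2]; the radius 2 avoids a square root and is the origin
    of the radius [2 * r] of [supp_ball]. *)
Lemma chi_supp y : 2 < `|y| -> chi y = 0.
Proof.
move=> y2; rewrite /chi bump_eq0 ?mul0r // subr_le0.
have h : 2 <= sqn y.
  rewrite leNgt; apply/negP => h; move: y2; apply/negP; rewrite -leNgt.
  apply: norm_le_sqn => //; apply: le_trans (ltW h) _; rewrite expr2; lra.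
rewrite -[leLHS](expr1n _ 2); apply: lerXn2r; rewrite ?nnegrE; lra.
Qed.

Lemma Ck_bump V k (U : set V) (f : V -> R) : open U -> Ck k U f ->
  Ck k U (fun x => bump (f x)).
Proof.
move=> oU Cf; apply: (@Ck_comp0 _ _ _ k U setT f bump) => //.
- exact: has_basis_R.
- exact: openT.
- exact: Ck_flat.
Qed.

Lemma Ck_chi k : Ck k setT chi.
Proof.
apply: CkM; [exact: openT| |exact: Ck_cst].
apply: Ck_bump; first exact: openT.
apply: CkB; [exact: openT|exact: Ck_cst|].
have h : Ck k setT (fun y => sqn y - 1).
  by apply: CkB; [exact: openT|apply: Ck_sqn; [exact: openT|exact: Ck_id]|exact: Ck_cst].
by apply: (Ck_ext (f := fun y => (sqn y - 1) * (sqn y - 1))); [exact: openT|move=> y _; rewrite expr2|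
  apply: CkM => //; exact: openT].
Qed.

(** Cutoff in the velocity. It is left unnormalized because only its positivity near the zero
    velocity matters. *)
Definition kappa w : R := bump (1 - sqn w).

Lemma kappa_supp w : 1 < `|w| -> kappa w = 0.
Proof.
move=> w1; rewrite /kappa bump_eq0 // subr_le0 leNgt; apply/negP => h.
move: w1; apply/negP; rewrite -leNgt; apply: norm_le_sqn => //.
by rewrite expr1n ltW.
Qed.

Lemma Ck_kappa k : Ck k setT kappa.
Proof.
apply: Ck_bump; first exact: openT.
by apply: CkB; [exact: openT|exact: Ck_cst|apply: Ck_sqn; [exact: openT|exact: Ck_id]].
Qed.

End Bump.

Lemma compact_bounded_fun (R : realType) (T : topologicalType) (K : set T) (f : T -> R) :
  compact K -> (forall x, K x -> {for x, continuous f}) ->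
  exists2 B, 0 < B & forall x, K x -> `|f x| <= B.
Proof.
move=> cK cf; have [K0|/nonemptyPn K0] := pselect (K !=set0); last first.
  by exists 1 => // x; rewrite K0.
have [|c _ h] := @compact_EVT_max _ _ (fun x => `|f x|) _ K0 cK.
  apply: continuous_in_subspaceT => x /set_mem Kx.
  exact: (continuous_comp (cf x Kx) (@norm_continuous _ _ _)).
exists (`|f c| + 1); first by rewrite ltr_wpDl.
by move=> x Kx; apply: le_trans (h x _) _; [rewrite inE|rewrite lerDl].
Qed.

Lemma compact_diff_bound (R : realType) (V W : normedModType R) (K : set V) (f : V -> W) :
  has_basis V -> compact K -> (forall x, K x -> differentiable f x) ->
  (forall v x, K x -> {for x, continuous ('D_v f)}) ->
  exists2 B, 0 < B & forall x v, K x -> `|'d f x v| <= B * `|v|.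
Proof.
move=> [m [e [c [lc cE]]]] cK df cD.
have h (i : 'I_m) : exists2 B : R, 0 < B & forall x v, K x -> `|c i v| * `|'D_(e i) f x| <= B * `|v|.
  have cc : forall x, K x -> {for x, continuous (fun x => `|'D_(e i) f x|)}.
    by move=> x Kx; exact: (continuous_comp (cD (e i) x Kx) (@norm_continuous _ _ _)).
  have [B B0 hB] := compact_bounded_fun cK cc.
  have [l1 l2] := lc i.
  pose dlM := GRing.isLinear.Build _ _ _ _ (c i) l1.
  pose dL : {linear V -> R} := HB.pack (c i) dlM.
  have [C C0 hC] := (@linear_lipschitz R V R dL l2).
  exists (C * B); first exact: mulr_gt0.
  move=> x v Kx; rewrite mulrAC; apply: ler_pM => //; first exact: hC.
  by have := hB x Kx; rewrite normr_id.
pose B i := sval (cid2 (h i)).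
have B0 i : 0 < B i by rewrite /B; case: cid2.
have hB i x v : K x -> `|c i v| * `|'D_(e i) f x| <= B i * `|v|.
  by rewrite /B; case: cid2 => b b0 hb /=; exact: hb.
exists (\sum_i B i + 1); first by rewrite ltr_wpDl // sumr_ge0 // => i _; exact: ltW.
move=> x v Kx; rewrite {1}(cE v) linear_sum.
apply: (le_trans (ler_norm_sum _ _ _)).
apply: (@le_trans _ _ ((\sum_i B i) * `|v|)); last by rewrite ler_wpM2r // lerDl.
rewrite mulr_suml; apply: ler_sum => i _.
by rewrite linearZ normrZ -deriveE; [exact: hB|exact: df].
Qed.

Lemma chi_diff_bound (R : realType) n : exists2 B, 0 < B &
  forall (y v : 'rV[R]_n), `|'d (@chi R n) y v| <= B * `|v|.
Proof.
pose K := [set y : 'rV[R]_n | `|y| <= 2].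
have [dchi Dchi] := @Ck_chi R n 1.
have [B B0 hB] : exists2 B, 0 < B & forall x v, K x -> `|'d (@chi R n) x v| <= B * `|v|.
  apply: compact_diff_bound.
  - exact: has_basis_rV.
  - exact: compact_norm_le.
  - by move=> x _; exact: dchi.
  - by move=> v x _; apply: Dchi; rewrite inE.
exists B => // y v; have [y2|y2] := lerP `|y| 2; first exact: hB.
have E : {near y, cst 0 =1 @chi R n}.
  have o : open [set y : 'rV[R]_n | 2 < `|y|].
    apply: (@open_comp _ _ (fun y : 'rV[R]_n => `|y|) [set t | 2 < t]); last exact: open_gt.
    by move=> z _; exact: norm_continuous.
  by have := open_nbhs_nbhs (conj o y2); apply: filterS => z z2; rewrite chi_supp.
have [_ E'] := near_eq_differentiable E (differentiable_cst 0 y).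
have -> : 'd (@chi R n) y v = 'd (cst 0 : 'rV[R]_n -> R) y v by exact: (congr1 (@^~ v) E').
by rewrite diff_cst normr0 mulr_ge0 // ltW.
Qed.

(** * The Sasaki norm in charts *)

(** The [p] terms are the inhomogeneous parts of the three derivatives of the metric under a change
    of charts: [p1] occurs twice with the same sign, while [p2] and [p3] cancel. *)
Lemma koszul_cancel (R : realType) (p1 p2 p3 d1 d2 d3 : R) :
  2^-1 * ((p1 + p2 + d1) + (p1 + p3 + d2) - (p2 + p3 + d3)) = p1 + 2^-1 * (d1 + d2 - d3).
Proof. lra. Qed.

Section Sasaki.
Variables (R : realType) (n : nat) (M : manifold R n) (g : M -> 'M[R]_n).
Hypothesis rg : riemannian_metric g.
Implicit Types (x q : M) (z u v w a b c : 'rV[R]_n).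

Local Notation e i := (delta_mx 0 i : 'rV[R]_n).

Definition gl x z u w : R := metric_local g x u w z.

Lemma inner_linl (A : 'M[R]_n) s u v w :
  inner A (s *: u + v) w = s * inner A u w + inner A v w.
Proof. by rewrite /inner !mulmxDl -!scalemxAl !mxE. Qed.

Lemma inner_sym (q : M) u w : inner (g q) u w = inner (g q) w u.
Proof.
have [gT _ _] := rg; rewrite /inner -[in RHS](gT q).
have -> : w *m (g q)^T *m u^T = (u *m g q *m w^T)^T by rewrite !trmx_mul trmxK mulmxA.
by rewrite [RHS]mxE.
Qed.

Lemma glC x z u w : gl x z u w = gl x z w u.
Proof. exact: inner_sym. Qed.

Lemma gl_linl x z s u v w : gl x z (s *: u + v) w = s * gl x z u w + gl x z v w.
Proof. by rewrite /gl /metric_local /to_fiber linearP inner_linl. Qed.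

Lemma gl_suml x z w u : gl x z u w = \sum_i u 0 i * gl x z (e i) w.
Proof.
have h : forall (r : seq 'I_n), gl x z (\sum_(i <- r) u 0 i *: e i) w =
    \sum_(i <- r) u 0 i * gl x z (e i) w.
  elim=> [|i r IH]; last by rewrite !big_cons gl_linl IH.
  rewrite !big_nil; have := gl_linl x z (-1) 0 0 w.
  by rewrite scaler0 addr0 mulN1r addNr.
by rewrite {1}[u]row_sum_delta h.
Qed.

Lemma gl_sumr x z w u : gl x z w u = \sum_i u 0 i * gl x z w (e i).
Proof. by rewrite glC gl_suml; apply: eq_bigr => i _; rewrite glC. Qed.

Lemma gl_sum x z u w : gl x z u w = \sum_i \sum_j u 0 i * (w 0 j * gl x z (e i) (e j)).
Proof.
rewrite gl_suml; apply: eq_bigr => i _; rewrite gl_sumr mulr_sumr.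
by apply: eq_bigr.
Qed.

Lemma gl_trans x y z u w : tdom x y z ->
  gl x z u w = gl y (trans x y z) ('d (trans x y) z u) ('d (trans x y) z w).
Proof.
by move=> xyz; rewrite /gl /metric_local -!to_fiber_trans // phi_inv_trans.
Qed.

Lemma gl_id q u w : gl q (phi q q) u w = inner (g q) u w.
Proof. by rewrite /gl /metric_local !to_fiber_id phiK //; exact: phi_dom_self. Qed.

Lemma gl_pos x z u : chart_img x z -> u != 0 -> 0 < gl x z u u.
Proof.
move=> [q xq <-] u0; have [_ gp _] := rg.
rewrite /gl /metric_local phiK //; apply: gp; apply/eqP => h.
move/eqP: u0; apply; rewrite -(to_fiberK u xq) h; exact: linear0.
Qed.

Lemma Ck_gl k x u w : Ck k (chart_img x) (fun z => gl x z u w).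
Proof. by have [_ _ h] := rg; exact: h. Qed.

Lemma differentiable_gl x z u w : chart_img x z -> differentiable (fun z => gl x z u w) z.
Proof. by move=> xz; have [h _] := Ck_gl 1 x u w; exact: h. Qed.

Definition dgl x z c u w : R := 'D_c (fun z => gl x z u w) z.

Lemma is_derive_gl x z c u w : chart_img x z ->
  is_derive z c (fun z => gl x z u w) (dgl x z c u w).
Proof. by move=> xz; apply/derivableP/diff_derivable/differentiable_gl. Qed.

Lemma dgl_sum1 x z c u w : chart_img x z -> dgl x z c u w = \sum_i c 0 i * dgl x z (e i) u w.
Proof.
move=> xz; have d := differentiable_gl u w xz.
rewrite /dgl deriveE // {1}[c]row_sum_delta linear_sum.
by apply: eq_bigr => i _; rewrite linearZ /= deriveE.
Qed.

Lemma dgl_sum2 x z c u w : chart_img x z ->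
  dgl x z c u w = \sum_i \sum_j u 0 i * (w 0 j * dgl x z c (e i) (e j)).
Proof.
move=> xz.
have h : is_derive z c (fun z => gl x z u w) (\sum_i \sum_j u 0 i * (w 0 j * dgl x z c (e i) (e j))).
  have -> : (fun z => gl x z u w) = \sum_i \sum_j (u 0 i * w 0 j) \*: (fun z => gl x z (e i) (e j)).
    apply/funext => t; rewrite gl_sum fct_sumE; apply: eq_bigr => i _; rewrite fct_sumE.
    by apply: eq_bigr => j _; rewrite mulrA.
  apply: is_derive_sum => i; apply: is_derive_sum => j; rewrite mulrA.
  by apply: is_deriveZ; exact: is_derive_gl.
by have [_ <-] := h.
Qed.

(** Christoffel symbols of the first kind in the chart [x]. Unlike [christoffel], they are available
    at every point of a fixed chart, so they can be bounded uniformly on compact sets. *)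
Definition christoffel1 x z a b c : R :=
  2^-1 * (dgl x z a b c + dgl x z b a c - dgl x z c a b).

Lemma metric_unit q : g q \in unitmx.
Proof.
have [_ gp _] := rg; rewrite -row_free_unit -kermx_eq0; apply/eqP/row_matrixP => i.
rewrite row0; apply/eqP; apply/negP => /negP h.
have := gp q _ h; rewrite /inner.
have -> : row i (kermx (g q)) *m g q = 0 by apply/sub_kermxP; exact: row_sub.
by rewrite mul0mx mxE ltxx.
Qed.

(** Lowering the index cancels [invmx (g q)] and leaves the Koszul formula, extended from basis
    vectors to any [c] by linearity. *)
Lemma christoffel_lower q a b c :
  inner (g q) (christoffel g q a b) c = christoffel1 q (phi q q) a b c.
Proof.
have qz : chart_img q (phi q q) by exact/phi_chart_img/phi_dom_self.
rewrite /inner /christoffel mulmxKV ?metric_unit // mxE.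
have lin3 d u : dgl q (phi q q) d u c = \sum_i c 0 i * dgl q (phi q q) d u (e i).
  rewrite dgl_sum2 // exchange_big; apply: eq_bigr => i _ /=.
  rewrite [in RHS]dgl_sum2 // mulr_sumr; apply: eq_bigr => j _.
  rewrite (bigD1 i) //= big1 ?addr0 => [|k ki]; last by rewrite mxE eqxx (negbTE ki) mul0r mulr0.
  by rewrite mxE !eqxx mul1r mulrCA.
rewrite /christoffel1 (dgl_sum1 c) // !lin3 -big_split -sumrB /= mulr_sumr.
apply: eq_bigr => i _; rewrite !mxE /dgl /gl; ring.
Qed.

Section Transformation.
Variables (x q : M).
Hypothesis xq : phi_dom x q.
Let tau := trans q x.
Let z := phi q q.
Let T a := 'd tau z a.
(* The inhomogeneous term in the transformation law of the Christoffel symbols. *)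
Definition hess_trans a b : 'rV[R]_n := 'D_a ('D_b tau) z.
Let H := hess_trans.

Let qx : tdom q x z.
Proof. by apply: tdom_phi => //; exact: phi_dom_self. Qed.

Let qq : chart_img q z.
Proof. exact/phi_chart_img/phi_dom_self. Qed.

Let xz : chart_img x (tau z).
Proof. by rewrite /tau trans_phi; [exact: phi_chart_img|exact: phi_dom_self]. Qed.

Let tauE : tau z = phi x q.
Proof. by rewrite /tau trans_phi //; exact: phi_dom_self. Qed.

Lemma dtrans_derive a b i : is_derive z a (fun t => 'd tau t b 0 i) (H a b 0 i).
Proof.
have [dt Dt] := Ck_trans 2 q x; have [dD _] := Dt b.
have dz : derivable ('D_b tau) z a by apply: diff_derivable; exact: dD.
have h : is_derive z a (fun t => 'D_b tau t 0 i) (H a b 0 i).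
  apply: DeriveDef; first by move/derivable_mxP : dz; exact.
  by rewrite /H /hess_trans derive_mx // mxE.
apply: near_eq_is_derive h; apply: filterS (nbhs_tdom qx) => t tU.
by rewrite deriveE //; exact: dt.
Qed.

Lemma hess_trans_sym a b : H a b = H b a.
Proof.
apply/rowP => i.
have [dt Dt] := Ck_trans 2 q x.
have E c d : H c d 0 i = 'D_c ('D_d (fun t => tau t 0 i)) z.
  have [_ <-] := dtrans_derive c d i; apply: near_eq_derive.
  apply: filterS (nbhs_tdom qx) => t tU.
  have dtt : derivable tau t d by exact/diff_derivable/dt.
  by rewrite -deriveE ?(derive_mx dtt) ?mxE //; exact: dt.
have C2 : Ck 2 (tdom q x) (fun t => tau t 0 i).
  by apply: Ck_entry; [exact: open_tdom|exact: Ck_trans].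
have S := schwarz a b (@open_tdom R n M q x) C2 qx.
exact: etrans (E a b) (etrans (esym S) (esym (E b a))).
Qed.

Lemma gl_trans_derive a u w :
  is_derive z a (fun t => gl x (tau t) u w) (dgl x (tau z) (T a) u w).
Proof.
have dt := differentiable_trans qx.
have dg := differentiable_gl u w xz.
have dc := differentiable_comp dt dg.
apply: DeriveDef; first exact: diff_derivable.
rewrite (deriveE a dc) /dgl (deriveE _ dg).
exact: (congr1 (@^~ a) (diff_comp dt dg)).
Qed.

(** Leibniz rule in coordinates: the first two terms come from differentiating the transported
    vectors, the last one from differentiating the metric coefficients. *)
Lemma dgl_trans a b c : dgl q z a b c =
  gl x (tau z) (H a b) (T c) + gl x (tau z) (T b) (H a c) + dgl x (tau z) (T a) (T b) (T c).
Proof.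
pose A i t := 'd tau t b 0 i; pose B j t := 'd tau t c 0 j.
pose m i j t := gl x (tau t) (e i) (e j).
have hm i j := gl_trans_derive a (e i) (e j).
pose V i j := A i z *: (B j z *: dgl x (tau z) (T a) (e i) (e j) + m i j z *: H a c 0 j) +
   (B j z * m i j z) *: H a b 0 i.
have h : is_derive z a (fun t => gl q t b c) (\sum_i \sum_j V i j).
  apply: (near_eq_is_derive (f := \sum_i \sum_j (A i * (B j * m i j)))).
    apply: filterS (nbhs_tdom qx) => t tU.
    rewrite (gl_trans b c tU) gl_sum fct_sumE; apply: eq_bigr => i _.
    by rewrite fct_sumE; apply: eq_bigr.
  apply: is_derive_sum => i; apply: is_derive_sum => j.
  exact: (is_deriveM (dtrans_derive a b i) (is_deriveM (dtrans_derive a c j) (hm i j))).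
rewrite [LHS](@derive_val _ _ _ _ _ _ _ h).
rewrite !gl_sum dgl_sum2 // -!big_split; apply: eq_bigr => i _ /=.
rewrite -!big_split; apply: eq_bigr => j _ /=.
rewrite /V /A /B /m /T /GRing.scale /=; ring.
Qed.

Lemma christoffel1_trans a b c : christoffel1 q z a b c =
  gl x (tau z) (H a b) (T c) + christoffel1 x (tau z) (T a) (T b) (T c).
Proof.
rewrite /christoffel1 !dgl_trans.
rewrite (hess_trans_sym b a) (hess_trans_sym c a) (hess_trans_sym c b).
rewrite (glC x (tau z) (T b) (H a c)) (glC x (tau z) (T a) (H b c)).
exact: koszul_cancel.
Qed.

(* Transformation law of the Christoffel symbols: this is Gamma in the chart x,
   characterized by the Koszul formula there. *)
Definition christoffel_defect a b : 'rV[R]_n := T (christoffel g q a b) - H a b.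

(** Every [c] is of the form [T c'], and against such vectors the term in [H] of
    [christoffel1_trans] is the one subtracted in the defect. *)
Lemma christoffel_defectE a b c :
  gl x (tau z) (christoffel_defect a b) c = christoffel1 x (tau z) (T a) (T b) c.
Proof.
have Tc : T (to_fiber x (tau z) c) = c.
  by rewrite tauE; exact: (to_fiberK c xq).
rewrite -[in LHS]Tc -[in RHS]Tc; set c' := to_fiber _ _ _.
have := christoffel_lower q a b c'; rewrite -gl_id christoffel1_trans (gl_trans _ _ qx).
rewrite -/tau -/z -/(T _) -/(T _) => h.
have := gl_linl x (tau z) (-1) (H a b) (T (christoffel g q a b)) (T c').
rewrite scaleN1r addrC /christoffel_defect => ->; rewrite h; ring.
Qed.

End Transformation.

End Sasaki.

Section SasakiBound.
Variables (R : realType) (n : nat) (M : manifold R n) (g : M -> 'M[R]_n).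
Hypothesis rg : riemannian_metric g.
Implicit Types (x q : M) (z u v w a b c : 'rV[R]_n).

Local Notation e i := (delta_mx 0 i : 'rV[R]_n).

(** Differential of the vector part of the change of charts of TM. In the fiber direction the map is
    linear; in the base direction the second derivative of the transition map appears. *)
Lemma dtangent_trans x q v a b : phi_dom x q ->
  let Psi := fun p : 'rV[R]_n * 'rV[R]_n => 'd (trans q x) (p.1 : 'rV[R]_n) p.2 in
  differentiable Psi (phi q q, v) /\
  'd Psi (phi q q, v) (a, b) = 'd (trans q x) (phi q q) b + hess_trans x q a v.
Proof.
move=> xq Psi; set z := phi q q; set tau := trans q x in Psi *.
have qx : tdom q x z by apply: tdom_phi => //; exact: phi_dom_self.
have [dt Dt] := Ck_trans 2 q x; have [dD _] := Dt v.
have [dPsi _] := Ck_tangent (has_basis_rV R n) (has_basis_rV R n) (@open_tdom R n M q x) (Ck_trans 2 q x).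
have dP : differentiable Psi (z, v) by apply: dPsi.
split=> //.
have -> : (a, b) = (a, 0) + (0, b) by apply: injective_projections; rewrite /= ?addr0 ?add0r.
rewrite linearD addrC; congr (_ + _).
  pose iota w : 'rV[R]_n * 'rV[R]_n := (z, w).
  have di : is_diff v iota (fun w => (0, w)).
    exact: (is_diff_pair (is_diff_cst z v) (is_diff_id v)).
  have [di' dE] := di.
  have E1 : 'd (Psi \o iota) v b = 'd Psi (z, v) (0, b).
    rewrite (diff_comp di' dP) /=.
    by rewrite dE.
  rewrite -E1; have [_ E2] := linear_diff (f := 'd tau z) (@linearP _ _ _ _ _) (diff_continuous (dt z qx)) v.
  exact: (congr1 (@^~ b) E2).
pose iota t : 'rV[R]_n * 'rV[R]_n := (t, v).
have di : is_diff z iota (fun t => (t, 0)).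
  exact: (is_diff_pair (is_diff_id z) (is_diff_cst v z)).
have [di' dE] := di.
have E1 : 'd (Psi \o iota) z a = 'd Psi (z, v) (a, 0).
  rewrite (diff_comp di' dP) /=.
  by rewrite dE.
rewrite -E1 /hess_trans -/tau -/z deriveE; last exact: dD.
have E2 : {near z, 'D_v tau =1 Psi \o iota}.
  by apply: filterS (nbhs_tdom qx) => t tU; rewrite deriveE //; exact: dt.
have [_ E3] := near_eq_differentiable E2 (dD z qx).
exact: (congr1 (@^~ a) E3).
Qed.

Lemma TM_local_diff x q F v a b : phi_dom x q ->
  differentiable (TM_local x F) (phi x q, vcoord x q v) ->
  'd (TM_local q F) (phi q q, v) (a, b) =
  'd (TM_local x F) (phi x q, vcoord x q v)
     (vcoord x q a, vcoord x q b + hess_trans x q a v).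
Proof.
move=> xq dF; set z := phi q q; set tau := trans q x.
have qx : tdom q x z by apply: tdom_phi => //; exact: phi_dom_self.
have tauE : tau z = phi x q by rewrite /tau trans_phi //; exact: phi_dom_self.
have [dP EP] := dtangent_trans v a b xq.
set Psi := (fun p : 'rV[R]_n * 'rV[R]_n => _) in dP EP.
pose f0 (p : 'rV[R]_n * 'rV[R]_n) := tau p.1.
have [df1 Ef1] := linear_diff (@linear_fst R 'rV[R]_n 'rV[R]_n) (@continuous_fst R _ _) (z, v).
have dtau : differentiable tau ((z, v) : 'rV[R]_n * 'rV[R]_n).1 by exact: differentiable_trans.
have d0 : differentiable f0 (z, v) := differentiable_comp df1 dtau.
have E0 : 'd f0 (z, v) (a, b) = vcoord x q a.
  transitivity ('d tau z ('d (@fst 'rV[R]_n 'rV[R]_n) (z, v) (a, b))).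
    exact: (congr1 (@^~ (a, b)) (diff_comp df1 dtau)).
  by rewrite Ef1.
pose Phi p := (f0 p, Psi p).
have dPhi : is_diff (z, v) Phi (fun h => ('d f0 (z, v) h, 'd Psi (z, v) h)).
  exact: (is_diff_pair (differentiableP d0) (differentiableP dP)).
have PhiE : Phi (z, v) = (phi x q, vcoord x q v) by rewrite /Phi /f0 /= tauE.
have dF' : differentiable (TM_local x F) (Phi (z, v)) by rewrite PhiE.
have E : {near (z, v), TM_local x F \o Phi =1 TM_local q F}.
  have nn : nbhs (z, v) (tdom q x `*` setT).
    by apply: open_nbhs_nbhs; split; [exact/open_setXT/open_tdom|].
  by apply: filterS nn => -[t w] [/= tU _]; rewrite (TM_local_trans _ _ tU).
have [dPhi' dPhiE] := dPhi.
have [_ E'] := near_eq_differentiable E (differentiable_comp dPhi' dF').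
transitivity ('d (TM_local x F \o Phi) (z, v) (a, b)); first exact: (congr1 (@^~ (a, b)) E').
transitivity ('d (TM_local x F) (Phi (z, v)) ('d Phi (z, v) (a, b))).
  exact: (congr1 (@^~ (a, b)) (diff_comp dPhi' dF')).
have -> : 'd Phi (z, v) (a, b) = (vcoord x q a, vcoord x q b + hess_trans x q a v).
  have := congr1 (@^~ (a, b)) dPhiE; rewrite /= => ->.
  by apply: injective_projections; [exact: E0|exact: EP].
by rewrite PhiE.
Qed.

Lemma sqr_norm_bound (t s : R) : t ^+ 2 <= s -> t <= 1 + s.
Proof.
move=> h; have : 0 <= (t - 1) ^+ 2 by exact: sqr_ge0.
have : 0 <= t ^+ 2 by exact: sqr_ge0.
rewrite !expr2 in h *; nra.
Qed.

Lemma christoffel1_bound (B d1 d2 d3 : R) : `|d1| <= B -> `|d2| <= B -> `|d3| <= B ->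
  2^-1 * (d1 + d2 - d3) <= 2 * B.
Proof. by rewrite !ler_norml => /andP[? ?] /andP[? ?] /andP[? ?]; lra. Qed.

(** On the compact product of [K] and the unit sphere, the reciprocal of the metric is continuous,
    hence bounded; homogeneity of degree 2 extends the bound to all vectors. *)
Lemma gl_lower_bound x (K : set 'rV[R]_n) : compact K -> K `<=` chart_img x ->
  exists2 c0 : R, 0 < c0 & forall z u, K z -> c0 * `|u| ^+ 2 <= gl g x z u u.
Proof.
move=> cK Kx.
pose S := [set u : 'rV[R]_n | `|u| = 1].
have cS : compact S.
  apply: (@subclosed_compact _ _ [set u : 'rV[R]_n | `|u| <= 1]); last 2 first.
  - exact: compact_norm_le.
  - by move=> u; rewrite /S /= => ->.
  apply: (@preimage_closed _ _ (fun v : 'rV[R]_n => `|v|) [set y | y = 1]); last exact: closed_eq.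
  by move=> v _; exact: norm_continuous.
have pos p : (K `*` S) p -> 0 < gl g x p.1 p.2 p.2.
  move=> [Kp Sp]; apply: gl_pos => //; first exact: Kx.
  by rewrite -normr_eq0 Sp oner_eq0.
have [|B B0 hB] := @compact_bounded_fun R _ (K `*` S) (fun p => (gl g x p.1 p.2 p.2)^-1) (compact_setX cK cS).
  move=> p KSp; apply: continuousV; first by rewrite gt_eqF // pos.
  have C0 : Ck 0 (chart_img x `*` [set: 'rV[R]_n]) (fun p : 'rV[R]_n * 'rV[R]_n => gl g x p.1 p.2 p.2).
    have oU : open (chart_img x `*` [set: 'rV[R]_n]) by exact/open_setXT/open_chart_img.
    apply: (Ck_ext (f := fun p : 'rV[R]_n * 'rV[R]_n => \sum_i \sum_j p.2 0 i * (p.2 0 j * gl g x p.1 (e i) (e j))) oU).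
      by move=> [z u] _ /=; rewrite [RHS]gl_sum.
    apply: Ck_sum => // i _; apply: Ck_sum => // j _; apply: CkM => //.
      by apply: Ck_entry => //; exact: Ck_snd.
    apply: CkM => //; first by apply: Ck_entry => //; exact: Ck_snd.
    apply: (@Ck_comp0 _ _ _ 0 _ (chart_img x) fst (fun z => gl g x z (e i) (e j))) => //.
    - exact: has_basis_rV.
    - exact: open_chart_img.
    - by move=> ? [].
    - exact: Ck_fst.
    - exact: Ck_gl.
  by apply: C0; rewrite inE; split=> //; apply: Kx; case: KSp.
exists B^-1; first by rewrite invr_gt0.
move=> z u Kz; have [->|u0] := eqVneq u 0.
  by rewrite normr0 expr0n mulr0 gl_suml // big1 // => i _; rewrite mxE mul0r.
have nu : 0 < `|u| by rewrite normr_gt0.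
pose u1 := `|u|^-1 *: u.
have Su1 : S u1 by rewrite /S /= normrZ normfV normr_id mulVf // gt_eqF.
have h := hB (z, u1) (conj Kz Su1); have p1 := pos (z, u1) (conj Kz Su1).
rewrite /= in h p1.
have h1 : B^-1 <= gl g x z u1 u1.
  rewrite -[leRHS]invrK lef_pV2 ?posrE ?invr_gt0 //.
  by apply: le_trans h; exact: ler_norm.
have uE : u = `|u| *: u1 by rewrite scalerA divff ?scale1r // gt_eqF.
have -> : gl g x z u u = `|u| ^+ 2 * gl g x z u1 u1.
  rewrite {1 2}uE gl_suml // [in RHS]gl_suml // mulr_sumr; apply: eq_bigr => i _.
  rewrite gl_sumr // [in RHS]gl_sumr // !mulr_sumr; apply: eq_bigr => j _.
  by rewrite !mxE expr2; ring.
by rewrite mulrC ler_wpM2l // sqr_ge0.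
Qed.

Lemma dgl_bound x (K : set 'rV[R]_n) : compact K -> K `<=` chart_img x ->
  exists2 C : R, 0 < C & forall z a b c, K z -> `|dgl g x z a b c| <= C * (`|a| * `|b| * `|c|).
Proof.
move=> cK Kx.
have h i j : exists2 B : R, 0 < B & forall z a, K z -> `|dgl g x z a (e i) (e j)| <= B * `|a|.
  have [d D] := Ck_gl rg 1 x (e i) (e j).
  have [B B0 hB] : exists2 B, 0 < B & forall z a, K z ->
      `|'d (fun z => gl g x z (e i) (e j)) z a| <= B * `|a|.
    apply: compact_diff_bound => //; first exact: has_basis_rV.
      by move=> z Kz; apply: d; exact: Kx.
    by move=> v z Kz; apply: D; rewrite inE; exact: Kx.
  exists B => // z a Kz; rewrite /dgl deriveE; first exact: hB.
  by apply: d; exact: Kx.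
pose B i j := sval (cid2 (h i j)).
have B0 i j : 0 < B i j by rewrite /B; case: cid2.
have hB i j z a : K z -> `|dgl g x z a (e i) (e j)| <= B i j * `|a|.
  by rewrite /B; case: cid2 => b b0 hb /=; exact: hb.
have S0 : 0 <= \sum_i \sum_j B i j.
  by apply: sumr_ge0 => i _; apply: sumr_ge0 => j _; exact: ltW.
exists (\sum_i \sum_j B i j + 1); first by rewrite ltr_wpDl.
move=> z a b c Kz; apply: (@le_trans _ _ ((\sum_i \sum_j B i j) * (`|a| * `|b| * `|c|))); last first.
  by rewrite ler_wpM2r ?mulr_ge0 // lerDl.
rewrite dgl_sum2 //; last exact: Kx.
rewrite mulr_suml; apply: le_trans (ler_norm_sum _ _ _) _; apply: ler_sum => i _.
rewrite mulr_suml; apply: le_trans (ler_norm_sum _ _ _) _; apply: ler_sum => j _.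
rewrite !normrM.
have -> : B i j * (`|a| * `|b| * `|c|) = `|b| * (`|c| * (B i j * `|a|)) by ring.
apply: ler_pM => //; first exact: norm_entry.
by apply: ler_pM => //; [exact: norm_entry|exact: hB].
Qed.

(** Expresses a vector of Sasaki norm at most 1 by components in the fixed chart [x], with a
    constant uniform over [K]. The symbols [christoffel g q] live in charts that change with [q] and
    have no evident uniform bound; [christoffel_defect] trades them, together with the second
    derivatives of the transition map, for the symbols of the chart [x]. The vertical component is
    controlled only up to the factor [1 + |v|], since the Christoffel term is linear in [v]. *)
Lemma sasaki_local_bound x (K : set 'rV[R]_n) : compact K -> K `<=` chart_img x ->
  exists2 C : R, 0 < C & forall q v xi F, phi_dom x q -> K (phi x q) ->
    sasaki_sqnorm g q v xi <= 1 -> differentiable (TM_local x F) (phi x q, vcoord x q v) ->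
    exists a k, [/\ `|a| <= C, `|k| <= C * (1 + `|vcoord x q v|) &
      'd (TM_local q F) (phi q q, v) xi = 'd (TM_local x F) (phi x q, vcoord x q v) (a, k)].
Proof.
move=> cK Kx; have [c0 c00 hc0] := gl_lower_bound cK Kx.
have [D D0 hD] := dgl_bound cK Kx.
(* [A] bounds the coordinates of a vector with [g(u, u) <= 1], by [t <= 1 + t ^+ 2] in place of a
   square root; [E] bounds the Christoffel term per unit of [|v|]. *)
pose A := 1 + c0^-1; pose E := 2 * D / c0 * A.
have A0 : 0 < A by rewrite addr_gt0 // invr_gt0.
have E0 : 0 < E by rewrite mulr_gt0 // divr_gt0 // mulr_gt0.
exists (A + E); first by rewrite addr_gt0.
move=> q v [a b] F xq Kq hs dF.
have tauE : trans q x (phi q q) = phi x q by rewrite trans_phi //; exact: phi_dom_self.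
have qx : tdom q x (phi q q) by apply: tdom_phi => //; exact: phi_dom_self.
have [_ gp _] := rg.
have g0 u : 0 <= inner (g q) u u.
  have [->|u0] := eqVneq u 0; last exact/ltW/gp.
  by rewrite /inner !mul0mx mxE.
have small u : inner (g q) u u <= 1 -> `|vcoord x q u| <= A.
  move=> h; apply: sqr_norm_bound; rewrite -(ler_pM2l c00) divff ?gt_eqF //.
  apply: le_trans (hc0 _ _ Kq) _.
  by move: h; rewrite -gl_id (gl_trans _ _ _ qx) tauE.
rewrite /sasaki_sqnorm /= in hs; set k := b + christoffel g q a v in hs.
have ha := small a (le_trans (ler_wpDr (g0 _) (lexx _)) hs).
have hk := small k (le_trans (ler_wpDl (g0 _) (lexx _)) hs).
pose y := christoffel_defect g x q a v.
(* The metric evaluated at [(y, y)] is at least [c0 * |y| ^+ 2], while by the Koszul formula it is a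
   Christoffel symbol tested against [y], hence linear in [y]; one factor [|y|] is divided out. *)
have hy : `|y| <= E * `|vcoord x q v|.
  have [->|y0] := eqVneq y 0; first by rewrite normr0 mulr_ge0 // ltW.
  have ny : 0 < `|y| by rewrite normr_gt0.
  have h1 := hc0 _ y Kq.
  have := christoffel_defectE rg xq a v y; rewrite tauE -/y => h2.
  rewrite h2 in h1.
  have h3 : c0 * `|y| ^+ 2 <= 2 * D * (`|vcoord x q a| * `|vcoord x q v| * `|y|).
    apply: (le_trans h1); rewrite /christoffel1.
    have d1 := hD _ (vcoord x q a) (vcoord x q v) y Kq.
    have d2 := hD _ (vcoord x q v) (vcoord x q a) y Kq.
    have d3 := hD _ y (vcoord x q a) (vcoord x q v) Kq.
    set m := `|vcoord x q a| * `|vcoord x q v| * `|y| in d1 *.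
    have m2 : `|vcoord x q v| * `|vcoord x q a| * `|y| = m by rewrite /m; ring.
    have m3 : `|y| * `|vcoord x q a| * `|vcoord x q v| = m by rewrite /m; ring.
    rewrite m2 in d2; rewrite m3 in d3.
    have m0 : 0 <= D * m by apply: le_trans d1; exact: normr_ge0.
    by rewrite -[leRHS]mulrA; exact: christoffel1_bound d1 d2 d3.
  have h4 : c0 * `|y| <= 2 * D * (`|vcoord x q a| * `|vcoord x q v|).
    by rewrite -(ler_pM2r ny) -[leLHS]mulrA -expr2 -[leRHS]mulrA.
  rewrite -(ler_pM2l c00); apply: le_trans h4 _; rewrite /E.
  have -> : c0 * (2 * D / c0 * A * `|vcoord x q v|) = 2 * D * (A * `|vcoord x q v|).
    by rewrite [c0 * _]mulrC; field; rewrite gt_eqF.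
  by rewrite ler_wpM2l ?mulr_ge0 ?(ltW D0) // ler_wpM2r.
exists (vcoord x q a), (vcoord x q k - y); split.
- by apply: le_trans ha _; rewrite lerDl ltW.
- apply: le_trans (ler_normB _ _) _.
  apply: (@le_trans _ _ (A + E * `|vcoord x q v|)); first exact: lerD.
  rewrite mulrDr mulr1 -[leRHS]addrA lerD2l; apply: (@le_trans _ _ (E * `|vcoord x q v|)) => //.
  rewrite -[leLHS]add0r; apply: lerD; first exact: ltW.
  by rewrite ler_wpM2r // lerDr ltW.
- have -> : vcoord x q k - y = vcoord x q b + hess_trans x q a v.
    rewrite /y /christoffel_defect /k /vcoord; set G := christoffel g q a v.
    by rewrite linearD opprB [X in _ + X]addrC addrA addrK.
  exact: TM_local_diff.
Qed.
End SasakiBound.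

(** * The perturbation *)

Section Perturbation.
Variables (R : realType) (n : nat) (M : manifold R n) (L : M -> 'rV[R]_n -> R) (q0 : M).
Variables (i0 i1 : 'I_n) (r : R).
Hypothesis sL : TM_smooth L.
Hypothesis r0 : 0 < r.
Implicit Types (q : M) (z v w a b : 'rV[R]_n).
Local Notation z0 := (phi q0 q0).
Local Notation Lx := (TM_local q0 L).

Definition cutoff z : R := chi (r^-1 *: (z - z0)).

(** The form x dy - y dx centered at [z0], in the plane of the coordinates [i0] and [i1]. Its
    differential is twice the area form. *)
Definition rot_form (p : 'rV[R]_n * 'rV[R]_n) : R :=
  (p.1 - z0) 0 i0 * p.2 0 i1 - (p.1 - z0) 0 i1 * p.2 0 i0.

Definition pert_pot z : R := cutoff z * (L q0 0 - Lx (z, 0 : 'rV[R]_n)).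
Definition pert_form (p : 'rV[R]_n * 'rV[R]_n) : R :=
  cutoff p.1 * (kappa p.2 * rot_form p).
Definition pert s (p : 'rV[R]_n * 'rV[R]_n) : R := pert_pot p.1 + s * pert_form p.
Definition pert_lagrangian s q v : R := L q v + ext_TM q0 (pert s) q v.

Definition supp_ball : set 'rV[R]_n := [set z | `|z - z0| <= 2 * r].
Hypothesis ball_chart : supp_ball `<=` chart_img q0.

Lemma Ck_shift k (U : set 'rV[R]_n) : open U -> Ck k U (fun z => z - z0).
Proof. by move=> oU; apply: CkB => //; [exact: Ck_id|exact: Ck_cst]. Qed.

Lemma Ck_cutoff k : Ck k setT cutoff.
Proof.
have oT : open [set: 'rV[R]_n] := openT.
apply: (@Ck_comp0 _ _ _ k setT setT (fun z => r^-1 *: (z - z0)) (@chi R n)) => //.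
- exact: has_basis_rV.
- apply: (@CkSc R _ _ k setT (cst r^-1)) => //; first exact: has_basis_rV.
  + exact: Ck_cst.
  + exact: Ck_shift.
- exact: Ck_chi.
Qed.

Lemma cutoff_supp z : ~ supp_ball z -> cutoff z = 0.
Proof.
move=> h; apply: chi_supp; rewrite normrZ gtr0_norm ?invr_gt0 // mulrC.
rewrite ltr_pdivlMr // ltNge; exact/negP.
Qed.

Lemma cutoff_ge0 z : 0 <= cutoff z. Proof. exact: chi_ge0. Qed.
Lemma cutoff_le1 z : cutoff z <= 1. Proof. exact: chi_le1. Qed.
Lemma cutoff_center : cutoff z0 = 0.
Proof. by rewrite /cutoff subrr scaler0 chi0. Qed.

Lemma Ck_zero_section k : Ck k (chart_img q0) (fun z => Lx (z, 0 : 'rV[R]_n)).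
Proof.
apply: (@Ck_comp0 _ _ _ k _ (chart_img q0 `*` setT) (fun z => (z, 0 : 'rV[R]_n)) Lx).
- exact: has_basis_prod (has_basis_rV _ _) (has_basis_rV _ _).
- exact: open_chart_img.
- exact/open_setXT/open_chart_img.
- by move=> z zx; split.
- by apply: Ck_pair; [exact: open_chart_img|exact: Ck_id|exact: Ck_cst].
- exact: sL.
Qed.

Lemma Ck_pert_pot k : Ck k (chart_img q0) pert_pot.
Proof.
have o := @open_chart_img R n M q0.
apply: CkM => //; first exact: (Ck_sub (@subsetT _ _)) (Ck_cutoff k).
by apply: CkB => //; [exact: Ck_cst|exact: Ck_zero_section].
Qed.

Lemma Ck_pert_form k : Ck k setT pert_form.
Proof.
have oT : open [set: 'rV[R]_n * 'rV[R]_n] := openT.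
have oT' : open [set: 'rV[R]_n] := openT.
have cf (h : 'rV[R]_n -> R) : Ck k setT h -> Ck k setT (fun p : 'rV[R]_n * 'rV[R]_n => h p.1).
  move=> Ch; apply: (@Ck_comp0 _ _ _ k setT setT fst h) => //; first exact: has_basis_rV.
  exact: Ck_fst.
have cs (h : 'rV[R]_n -> R) : Ck k setT h -> Ck k setT (fun p : 'rV[R]_n * 'rV[R]_n => h p.2).
  move=> Ch; apply: (@Ck_comp0 _ _ _ k setT setT snd h) => //; first exact: has_basis_rV.
  exact: Ck_snd.
have ce i : Ck k setT (fun z : 'rV[R]_n => (z - z0) 0 i) by apply: Ck_entry => //; exact: Ck_shift.
have ce' i : Ck k setT (fun z : 'rV[R]_n => z 0 i) by apply: Ck_entry => //; exact: Ck_id.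
apply: CkM => //; first by apply: cf; exact: Ck_cutoff.
apply: CkM => //; first by apply: cs; exact: Ck_kappa.
by apply: CkB => //; apply: CkM => //; [exact: (cf _ (ce i0))|exact: (cs _ (ce' i1))|
  exact: (cf _ (ce i1))|exact: (cs _ (ce' i0))].
Qed.

Lemma Ck_pert k s : Ck k (chart_img q0 `*` setT) (pert s).
Proof.
have o := @open_setXT R _ 'rV[R]_n _ (@open_chart_img R n M q0).
apply: CkD => //.
  apply: (@Ck_comp0 _ _ _ k _ (chart_img q0) fst pert_pot) => //.
  - exact: has_basis_rV.
  - exact: open_chart_img.
  - by move=> p [].
  - exact: Ck_fst.
  - exact: Ck_pert_pot.
apply: CkM => //; first exact: Ck_cst.
exact: (Ck_sub (@subsetT _ _)) (Ck_pert_form k).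
Qed.

Lemma compact_supp_ball : compact supp_ball.
Proof.
apply: bounded_closed_compact.
  exists (`|z0| + 2 * r); split; first exact: num_real.
  move=> t rt z /= zr; apply: le_trans (ltW rt).
  have -> : `|z| = `|z0 + (z - z0)| by rewrite addrC subrK.
  by apply: le_trans (ler_normD _ _) _; rewrite lerD2l.
apply: (@preimage_closed _ _ (fun z : 'rV[R]_n => `|z - z0|) [set y | y <= 2 * r]); last exact: closed_le.
move=> z _; have c1 : {for z, continuous (fun z : 'rV[R]_n => z - z0)}.
  by apply: (@Ck_shift 0 setT openT); rewrite inE.
exact: (@continuous_comp _ _ _ (fun z => z - z0) (fun y : 'rV[R]_n => `|y|) z c1 (@norm_continuous _ _ _)).
Qed.

Lemma pert_supp s z v : ~ supp_ball z -> pert s (z, v) = 0.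
Proof. by move=> h; rewrite /pert /pert_pot /pert_form /= cutoff_supp // !mul0r mulr0 addr0. Qed.

Lemma TM_smoothD F G : TM_smooth F -> @TM_smooth R n M G -> TM_smooth (fun q v => F q v + G q v).
Proof. by move=> sF sG x k; apply: CkD; [exact/open_setXT/open_chart_img|exact: sF|exact: sG]. Qed.

Lemma ext_pert_smooth s : TM_smooth (ext_TM q0 (pert s)).
Proof.
apply: (@ext_TM_smooth _ _ _ _ _ supp_ball) => //.
- exact: compact_supp_ball.
- by move=> k; exact: Ck_pert.
- by move=> z v; exact: pert_supp.
Qed.

Lemma pert_lagrangian_smooth s : TM_smooth (pert_lagrangian s).
Proof. by apply: TM_smoothD => //; exact: ext_pert_smooth. Qed.

Lemma rot_form0 z : rot_form (z, 0 : 'rV[R]_n) = 0.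
Proof. by rewrite /rot_form /= !mxE !mulr0 subrr. Qed.

Lemma pert_zero_section s q : pert_lagrangian s q 0 =
  if `[< phi_dom q0 q >] then L q 0 + cutoff (phi q0 q) * (L q0 0 - L q 0) else L q 0.
Proof.
rewrite /pert_lagrangian /ext_TM; case: asboolP => [xq|_]; last by rewrite addr0.
have -> : vcoord q0 q 0 = 0 by exact: linear0.
rewrite /pert /pert_form rot_form0 /= !mulr0 addr0 /pert_pot.
by rewrite -(zero_section_local L xq).
Qed.

Lemma pert_zero_section_center s : pert_lagrangian s q0 0 = L q0 0.
Proof. by rewrite pert_zero_section; case: asboolP => // _; rewrite cutoff_center mul0r addr0. Qed.

Hypothesis L_min : forall q, L q0 0 <= L q 0.

(** The new value at zero velocity is a convex combination of [L q 0] and the minimum [L q0 0],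
    because the cutoff takes values in [0, 1]. *)
Lemma pert_zero_section_min s q : pert_lagrangian s q0 0 <= pert_lagrangian s q 0.
Proof.
rewrite pert_zero_section_center pert_zero_section; case: asboolP => // _.
have c0 := cutoff_ge0 (phi q0 q); have c1 := cutoff_le1 (phi q0 q); have := L_min q.
set c := cutoff _ in c0 c1 *; move: (L q0 0) (L q 0) => l0 l1 h; nra.
Qed.

End Perturbation.

(** The difference quotients of the two sides coincide term by term, so the identity holds whether
    or not they converge. *)
Lemma derive_affine (R : realType) (V W X : normedModType R) (A : V -> W) (F : W -> X) w w' v :
  (forall (h : R) u, A (h *: w + u) = h *: w' + A u) -> 'D_w (F \o A) v = 'D_w' F (A v).
Proof.
move=> hA; rewrite /derive.
have -> // : (fun h : R => h^-1 *: ((F \o A \o shift v) (h *: w) - (F \o A) v)) =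
  (fun h : R => h^-1 *: ((F \o shift (A v)) (h *: w') - F (A v))).
by apply/funext => h; rewrite /= hA.
Qed.

Lemma derive2_affine (R : realType) (V W X : normedModType R) (A : V -> W) (F : W -> X) w w' v :
  (forall (h : R) u, A (h *: w + u) = h *: w' + A u) ->
  'D_w ('D_w (F \o A)) v = 'D_w' ('D_w' F) (A v).
Proof.
move=> hA; transitivity ('D_w ('D_w' F \o A) v); last exact: (@derive_affine _ _ _ _ A).
by congr ('D_w _ v); apply/funext => u; exact: (@derive_affine _ _ _ _ A).
Qed.

Lemma derive_zero_open (R : realType) (V : normedModType R) (U : set V) (F : V -> R) d x :
  open U -> (forall y, U y -> F y = 0) -> U x -> 'D_d F x = 0.
Proof.
move=> oU F0 Ux; rewrite (near_eq_derive (g := cst 0)) ?derive_cst //.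
exact: open_near_eq Ux F0.
Qed.

Lemma small_perturb_pos (R : realType) (a b B : R) : 0 < B -> B^-1 <= a ->
  `|b| <= (2 * B)^-1 -> 0 < a + b.
Proof.
move=> B0 aB; rewrite invfM ler_norml => /andP[bB _].
have : 0 < B^-1 by rewrite invr_gt0.
by move: (B^-1) aB bB => c; lra.
Qed.

(** * Fiber Hessians and the Tonelli property of the perturbation *)

Section FiberHessian.
Variables (R : realType) (n : nat).
Implicit Types (z v w : 'rV[R]_n).
Local Notation V2 := ('rV[R]_n * 'rV[R]_n)%type.
Local Notation e i := ((0, delta_mx 0 i) : V2).

(** Second derivative of [F] at [p.1] in the fiber direction [p.2], written in coordinates so as to
    be jointly continuous in base point, velocity and direction, which the compactness arguments
    require. *)
Definition fiber_hess (F : V2 -> R) (p : V2 * 'rV[R]_n) : R :=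
  \sum_i \sum_j p.2 0 i * (p.2 0 j * 'D_(e j) ('D_(e i) F) p.1).

Lemma inr_sum w : ((0, w) : V2) = \sum_i w 0 i *: e i.
Proof.
have fE (I : Type) (r : seq I) (F : I -> V2) : (\sum_(i <- r) F i).1 = \sum_(i <- r) (F i).1.
  by elim/big_rec2: _ => //= i y1 y2 _ ->.
have sE (I : Type) (r : seq I) (F : I -> V2) : (\sum_(i <- r) F i).2 = \sum_(i <- r) (F i).2.
  by elim/big_rec2: _ => //= i y1 y2 _ ->.
apply: injective_projections; rewrite ?fE ?sE /=.
  by rewrite big1 // => i _; exact: scaler0.
exact: row_sum_delta.
Qed.

Lemma fiber_hessE (U : set V2) F p w : open U -> Ck 2 U F -> U p ->
  'D_(0, w) ('D_(0, w) F) p = fiber_hess F (p, w).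
Proof.
move=> oU CF Up; have [dF DF] := CF.
have D1 t : U t -> 'D_(0, w) F t = \sum_i w 0 i * 'D_(e i) F t.
  move=> Ut; rewrite deriveE; last exact: dF.
  rewrite inr_sum linear_sum; apply: eq_bigr => i _.
  by rewrite linearZ -deriveE //; exact: dF.
have h : is_derive p (0, w) (fun t => 'D_(0, w) F t) (\sum_i w 0 i * 'D_(0, w) ('D_(e i) F) p).
  apply: (near_eq_is_derive (f := \sum_i w 0 i \*: 'D_(e i) F)).
    have := open_nbhs_nbhs (conj oU Up); apply: filterS => t Ut.
    by rewrite D1 // fct_sumE.
  apply: is_derive_sum => i; apply: is_deriveZ; apply/derivableP/diff_derivable.
  by have [dD _] := DF (e i); exact: dD.
rewrite [LHS](@derive_val _ _ _ _ _ _ _ h) /fiber_hess /=; apply: eq_bigr => i _.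
have [dD _] := DF (e i); rewrite deriveE; last exact: dD.
rewrite (inr_sum w) linear_sum mulr_sumr; apply: eq_bigr => j _.
by rewrite linearZ -deriveE //; exact: dD.
Qed.

Lemma fiber_hess_continuous (U : set V2) F p w : open U -> Ck 2 U F -> U p ->
  {for (p, w), continuous (fiber_hess F)}.
Proof.
move=> oU CF Up; have [_ DF] := CF.
have oUT := @open_setXT R _ 'rV[R]_n U oU.
have C0 : Ck 0 (U `*` [set: 'rV[R]_n]) (fiber_hess F).
  have ce i : Ck 0 (U `*` [set: 'rV[R]_n]) (fun p : V2 * 'rV[R]_n => p.2 0 i).
    by apply: Ck_entry => //; exact: Ck_snd.
  apply: Ck_sum => // i _; apply: Ck_sum => // j _; apply: CkM => //; apply: CkM => //.
  have [_ DD] := DF (e i).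
  apply: (@Ck_comp0 _ _ _ 0 _ U fst ('D_(e j) ('D_(e i) F))) => //.
  - exact: has_basis_prod (has_basis_rV _ _) (has_basis_rV _ _).
  - by move=> ? [].
  - exact: Ck_fst.
  - exact: DD.
by apply: C0; rewrite inE.
Qed.

Lemma fiber_hessZ F p (l : R) w : fiber_hess F (p, l *: w) = l ^+ 2 * fiber_hess F (p, w).
Proof.
rewrite /fiber_hess /= mulr_sumr; apply: eq_bigr => i _.
rewrite mulr_sumr; apply: eq_bigr => j _; rewrite !mxE expr2; ring.
Qed.

End FiberHessian.

Section TonelliPert.
Variables (R : realType) (n : nat) (M : manifold R n) (L : M -> 'rV[R]_n -> R) (q0 : M).
Variables (i0 i1 : 'I_n) (r : R).
Hypothesis tL : tonelli L.
Hypothesis r0 : 0 < r.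
Hypothesis ball_chart : supp_ball q0 r `<=` chart_img q0.
Implicit Types (q : M) (z v w : 'rV[R]_n).
Local Notation Lx := (TM_local q0 L).
Local Notation V2 := ('rV[R]_n * 'rV[R]_n)%type.
Local Notation K := (supp_ball q0 r).
Local Notation form := (pert_form q0 i0 i1 r).
Local Notation UT := (chart_img q0 `*` [set: 'rV[R]_n]).

Let sL : TM_smooth L. Proof. by case: tL. Qed.
Let oUT : open UT. Proof. exact/open_setXT/open_chart_img. Qed.

Lemma fiber_coord_affine q w (h : R) v :
  (phi q0 q, vcoord q0 q (h *: w + v)) = h *: ((0, vcoord q0 q w) : V2) + (phi q0 q, vcoord q0 q v).
Proof.
apply: injective_projections; first by rewrite /= scaler0 add0r.
by rewrite /= /vcoord linearP.
Qed.

Lemma fiber_hess_lagrangian q v w : phi_dom q0 q ->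
  'D_w ('D_w (L q)) v = fiber_hess Lx ((phi q0 q, vcoord q0 q v), vcoord q0 q w).
Proof.
move=> xq.
have -> : L q = Lx \o (fun v => (phi q0 q, vcoord q0 q v)).
  by apply/funext => u; rewrite /= -TM_local_vcoord.
rewrite (derive2_affine _ _ (@fiber_coord_affine q w)).
apply: (@fiber_hessE _ _ UT) => //; first exact: sL.
by split => //; exact: phi_chart_img.
Qed.

Lemma fiber_hess_pos z v w : chart_img q0 z -> w != 0 -> 0 < fiber_hess Lx ((z, v), w).
Proof.
move=> [q xq <-] w0; have [_ _ cL] := tL.
rewrite -(to_fiberK v xq) -(to_fiberK w xq) -fiber_hess_lagrangian //; apply: cL.
apply/eqP => h; move/eqP: w0; apply.
by rewrite -(to_fiberK w xq) h; exact: linear0.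
Qed.

Lemma form_outside : open [set p : V2 | 1 < `|p.2|] /\
  forall p : V2, 1 < `|p.2| -> form p = 0.
Proof.
split.
  apply: (@open_comp _ _ (fun p : V2 => `|p.2|) [set t | 1 < t]); last exact: open_gt.
  move=> p _; exact: (continuous_comp (@continuous_snd _ _ _ p) (@norm_continuous _ _ _)).
by move=> p p1; rewrite /pert_form kappa_supp // mul0r mulr0.
Qed.

Lemma form_bounded : exists2 B : R, 0 < B & forall p, `|form p| <= B.
Proof.
have cK := compact_setX (@compact_supp_ball R n M q0 r) (@compact_norm_le R n 1).
have [|B B0 hB] := @compact_bounded_fun R _ _ form cK.
  by move=> p _; apply: (Ck_pert_form q0 i0 i1 r 0); rewrite inE.
exists B => // -[z v]; have [Kz|nKz] := pselect (K z); last first.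
  by rewrite /pert_form /= cutoff_supp // mul0r normr0 ltW.
have [v1|v1] := lerP `|v| 1; first exact: hB.
by rewrite form_outside.2 // normr0 ltW.
Qed.

(** By homogeneity the direction can be taken on the unit sphere. For [|v| > 1] the form vanishes on
    an open set and contributes nothing. For [|v| <= 1] all the variables range over a compact set,
    where the Hessian of [L] is at least [B1^-1] and that of the form at most [B2] in absolute
    value; the choice of [s1] lets the latter consume at most half of the former. *)
Lemma pert_hess_pos : exists2 s1 : R, 0 < s1 & forall s z v w, `|s| <= s1 -> K z -> w != 0 ->
  0 < fiber_hess Lx ((z, v), w) + s * fiber_hess form ((z, v), w).
Proof.
have cS : compact [set w : 'rV[R]_n | `|w| = 1].
  apply: (@subclosed_compact _ _ [set u : 'rV[R]_n | `|u| <= 1]); last 2 first.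
  - exact: compact_norm_le.
  - by move=> u /= ->.
  apply: (@preimage_closed _ _ (fun v : 'rV[R]_n => `|v|) [set y | y = 1]); last exact: closed_eq.
  by move=> v _; exact: norm_continuous.
have cK := compact_setX (compact_setX (@compact_supp_ball R n M q0 r) (@compact_norm_le R n 1)) cS.
have nz w : `|w| = 1 -> w != 0 by move=> w1; rewrite -normr_eq0 w1 oner_eq0.
have [|B1 B10 hB1] := @compact_bounded_fun R _ _ (fun p => (fiber_hess Lx p)^-1) cK.
  move=> [[z v] w] [/= [Kz _] w1].
  have cz : chart_img q0 z by exact: ball_chart.
  apply: continuousV; first by rewrite gt_eqF // fiber_hess_pos // nz.
  by apply: (@fiber_hess_continuous _ _ UT) => //; exact: sL.
have [|B2 B20 hB2] := @compact_bounded_fun R _ _ (fiber_hess form) cK.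
  move=> [[z v] w] _; apply: (@fiber_hess_continuous _ _ setT) => //; first exact: openT.
  exact: Ck_pert_form.
exists (2 * B1 * B2)^-1; first by rewrite invr_gt0 !mulr_gt0.
move=> s z v w hs Kz w0.
have cz : chart_img q0 z by exact: ball_chart.
have nw : 0 < `|w| by rewrite normr_gt0.
pose w1 := `|w|^-1 *: w.
have nw1 : `|w1| = 1 by rewrite /w1 normrZ normfV normr_id mulVf // gt_eqF.
have wE : w = `|w| *: w1 by rewrite scalerA divff ?scale1r // gt_eqF.
have hz F : fiber_hess F ((z, v), w) = `|w| ^+ 2 * fiber_hess F ((z, v), w1).
  by rewrite -fiber_hessZ -wE.
rewrite (hz Lx) (hz form) mulrCA -mulrDr; apply: mulr_gt0; first exact: exprn_gt0.
clear hz wE; clearbody w1.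
have [v1|v1] := lerP `|v| 1; last first.
  have [oU U0] := form_outside.
  have -> : fiber_hess form ((z, v), w1) = 0.
    rewrite /fiber_hess big1 // => i _; rewrite big1 // => j _ /=.
    rewrite (derive_zero_open _ oU _ (v1 : [set p : V2 | 1 < `|p.2|] (z, v))) ?mulr0 // => p p1.
    exact: (derive_zero_open _ oU U0 p1).
  by rewrite mulr0 addr0 fiber_hess_pos // nz.
have p1 : 0 < fiber_hess Lx ((z, v), w1) by rewrite fiber_hess_pos // nz.
have h1 := hB1 ((z, v), w1) (conj (conj Kz v1) nw1).
have h2 := hB2 ((z, v), w1) (conj (conj Kz v1) nw1).
rewrite /= gtr0_norm ?invr_gt0 // in h1.
have h3 : B1^-1 <= fiber_hess Lx ((z, v), w1).
  by rewrite -[leRHS]invrK lef_pV2 ?posrE ?invr_gt0.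
have h4 : `|s * fiber_hess form ((z, v), w1)| <= (2 * B1)^-1.
  rewrite normrM; apply: (@le_trans _ _ ((2 * B1 * B2)^-1 * B2)); first exact: ler_pM.
  by rewrite invfM -mulrA mulVf ?mulr1 // gt_eqF.
exact: small_perturb_pos B10 h3 h4.
Qed.

Lemma pert_lagrangian_tonelli : exists2 s1 : R, 0 < s1 & forall s, `|s| <= s1 ->
  tonelli (pert_lagrangian L q0 i0 i1 r s).
Proof.
have [s1 s10 hs1] := pert_hess_pos; exists s1; first exact: s10.
move=> s hs.
have [_ supL cL] := tL.
split.
- exact: pert_lagrangian_smooth.
(* The slope [A + 1] leaves a spare [|v|], which absorbs the perturbation, bounded by [C] in this
   fiber, once [|v| >= C]. *)
- move=> q A; have [t ht] := supL q (A + 1); have [B B0 hB] := form_bounded.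
  pose C := `|pert_pot L q0 r (phi q0 q)| + `|s| * B.
  have C0 : 0 <= C by rewrite addr_ge0 // mulr_ge0 // ltW.
  have hC v : - C <= ext_TM q0 (pert L q0 i0 i1 r s) q v.
    rewrite /ext_TM; case: asboolP => _; last by rewrite oppr_le0.
    rewrite lerNl; apply: le_trans (ler_norm _) _; rewrite normrN.
    apply: le_trans (ler_normD _ _) _; rewrite lerD2l normrM ler_wpM2l //.
  exists (Num.max t C) => v; rewrite ge_max => /andP[tv Cv].
  have h1 := ht v tv; have h2 := hC v; rewrite /pert_lagrangian.
  rewrite mulrDl mul1r in h1; lra.
- move=> q v w w0.
  have [[xq Kq]|nq] := pselect (phi_dom q0 q /\ K (phi q0 q)); last first.
    have -> : pert_lagrangian L q0 i0 i1 r s q = L q; last exact: cL.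
    apply/funext => u; rewrite /pert_lagrangian /ext_TM; case: asboolP => xq; last by rewrite addr0.
    by rewrite pert_supp ?addr0 // => Kq; apply: nq.
  pose h u := form (phi q0 q, vcoord q0 q u).
  have Eq : pert_lagrangian L q0 i0 i1 r s q = fun u => L q u + (pert_pot L q0 r (phi q0 q) + s * h u).
    by apply/funext => u; rewrite /pert_lagrangian ext_TME.
  have hh u d : 'D_d h u = 'D_(0, vcoord q0 q d) form (phi q0 q, vcoord q0 q u).
    exact: (derive_affine _ _ (@fiber_coord_affine q d)).
  have Ch : Ck 2 setT h.
    apply: (@Ck_comp0 _ _ _ 2 setT setT (fun u => (phi q0 q, vcoord q0 q u)) form).
    - exact: has_basis_prod (has_basis_rV _ _) (has_basis_rV _ _).
    - exact: openT.
    - exact: openT.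
    - by [].
    - apply: Ck_pair; [exact: openT|exact: Ck_cst|].
      apply: (@Ck_linear _ _ _ _ 2 setT id (vcoord q0 q)); [exact: openT|exact: linearP| |exact: Ck_id].
      apply: diff_continuous; apply: differentiable_trans; apply: tdom_phi => //.
      exact: phi_dom_self.
    - exact: Ck_pert_form.
  have D2h : 'D_w ('D_w h) v = fiber_hess form ((phi q0 q, vcoord q0 q v), vcoord q0 q w).
    rewrite (derive2_affine _ _ (@fiber_coord_affine q w)).
    by apply: (@fiber_hessE _ _ setT) => //; [exact: openT|exact: Ck_pert_form].
  have CL := fiber_Ck q 2 sL.
  have [dL DL] := CL; have [dh Dh] := Ch.
  have [dDL _] := DL w; have [dDh _] := Dh w.
  have add2 (f1 f2 : 'rV[R]_n -> R) (c : R) u : differentiable f1 u -> differentiable f2 u ->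
      'D_w (fun u => f1 u + (c + s * f2 u)) u = 'D_w f1 u + s * 'D_w f2 u.
    move=> /(@diff_derivable _ _ _ _ _ w)/derivableP d1 /(@diff_derivable _ _ _ _ _ w)/derivableP d2.
    have d3 := is_deriveD d1 (is_deriveD (is_derive_cst c u w) (is_deriveZ s d2)).
    by have [_ ->] := d3; rewrite add0r.
  have -> : 'D_w (pert_lagrangian L q0 i0 i1 r s q) = fun u => 'D_w (L q) u + (0 + s * 'D_w h u).
    by apply/funext => u; rewrite Eq add2 ?add0r //; [exact: dL|exact: dh].
  rewrite add2; [|exact: dDL|exact: dDh].
  rewrite fiber_hess_lagrangian // D2h; apply: hs1 => //.
  apply/eqP => h0; move/eqP: w0; apply.
  by rewrite -(vcoordK w xq) h0 to_fiber0.
Qed.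

End TonelliPert.

Lemma sub_addl (V : zmodType) (a b : V) : a - (a + b) = - b.
Proof. by rewrite opprD addrA subrr add0r. Qed.

(** * C^1-smallness of the perturbation *)

Section C1Small.
Variables (R : realType) (n : nat) (M : manifold R n) (L : M -> 'rV[R]_n -> R) (q0 : M).
Variables (i0 i1 : 'I_n).
Hypothesis sL : TM_smooth L.
Hypothesis L_min : forall q, L q0 0 <= L q 0.
Implicit Types (q : M) (z v w a k : 'rV[R]_n).
Local Notation z0 := (phi q0 q0).
Local Notation Lx := (TM_local q0 L).
Local Notation V2 := ('rV[R]_n * 'rV[R]_n)%type.
Local Notation UT := (chart_img q0 `*` [set: 'rV[R]_n]).

Definition gap z : R := L q0 0 - Lx (z, 0 : 'rV[R]_n).

Lemma Ck_gap j : Ck j (chart_img q0) gap.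
Proof.
have o := @open_chart_img R n M q0.
by apply: CkB => //; [exact: Ck_cst|exact: Ck_zero_section].
Qed.

Lemma gap_le0 z : chart_img q0 z -> gap z <= 0.
Proof.
by move=> [q xq <-]; rewrite /gap -(zero_section_local L xq) subr_le0.
Qed.

Lemma gap_center : gap z0 = 0.
Proof. by rewrite /gap -(zero_section_local L (phi_dom_self q0)) subrr. Qed.

Lemma center_chart_img : chart_img q0 z0.
Proof. exact/phi_chart_img/phi_dom_self. Qed.

(** Along every line through [z0], [gap] has an interior maximum at [z0]. *)
Lemma gap_critical a : 'D_a gap z0 = 0.
Proof.
have [dg _] := Ck_gap 1.
pose c (t : R) := z0 + t *: a.
have cc : continuous c.
  by move=> t; apply: cvgD; [exact: cvg_cst|apply: cvgZr_tmp; exact: cvg_id].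
have nc : nbhs (0 : R) (c @^-1` chart_img q0).
  by apply: (cc 0); rewrite /c scale0r addr0; exact/nbhs_chart_img/center_chart_img.
have [d /= d0 hd] := (nbhs_ballP _ _).1 nc.
have hin t : t \in `]- d, d[ -> chart_img q0 (c t).
  rewrite in_itv /= => /andP[t1 t2]; apply: hd; rewrite /ball /= sub0r normrN.
  by rewrite ltr_norml t1.
have dc (t : R) : chart_img q0 (c t) -> is_derive t 1 (gap \o c) ('d gap (c t) a).
  move=> ct; apply: is_derive_diff_comp; first exact: dg.
  exact: is_derive_line.
have z00 : 0 \in `]- d, d[ by rewrite in_itv /= oppr_lt0 d0.
have dd : d - - d > 0 by rewrite opprK addr_gt0.
have h : is_derive (0 : R) 1 (gap \o c) 0.
  apply: (@derive1_at_max _ _ (- d) d).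
  - by rewrite ge0_cp // ltW.
  - by move=> t /hin ct; have [] := dc t ct.
  - exact: z00.
  - move=> t /hin ct; rewrite /= {2}/c scale0r addr0 gap_center; exact: gap_le0.
have [_ E1] := dc 0 (hin 0 z00); have [_ E2] := h.
rewrite E2 /c scale0r addr0 in E1.
by rewrite deriveE; [rewrite E1|exact/dg/center_chart_img].
Qed.

Lemma gap_flat (m : R) : 0 < m -> exists2 rho : R, 0 < rho & forall z, `|z - z0| <= rho ->
  chart_img q0 z /\ forall a, `|'d gap z a| <= m * `|a|.
Proof.
move=> m0; have [dg Dg] := Ck_gap 1.
pose e i := delta_mx 0 i : 'rV[R]_n.
(* The [n] coordinate directions contribute at most [m'] each; the added 1 makes the denominator
   visibly positive. *)
pose m' := m / (n%:R + 1).
have m'0 : 0 < m' by rewrite divr_gt0 // ltr_wpDl.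
have hi i : nbhs z0 [set z | `|'D_(e i) gap z| < m'].
  have c : {for z0, continuous ('D_(e i) gap)} by apply: Dg; rewrite inE; exact: center_chart_img.
  have c' := continuous_comp c (@norm_continuous _ _ _).
  apply: (c' [set t | t < m']); apply: open_nbhs_nbhs; split; first exact: open_lt.
  by rewrite /= gap_critical normr0.
have hall : nbhs z0 [set z | forall i, `|'D_(e i) gap z| < m'] by exact: filter_forall hi.
have [d /= d0 hd] := (nbhs_ballP _ _).1 (filterI (nbhs_chart_img center_chart_img) hall).
exists (d / 2); first by rewrite divr_gt0.
move=> z zd.
have [cz hz] : chart_img q0 z /\ forall i, `|'D_(e i) gap z| < m'.
  apply: hd; rewrite -ball_normE /= distrC; apply: le_lt_trans zd _.
  by rewrite ltr_pdivrMr // mulr_natr mulr2n ltrDl.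
split=> // a; rewrite {1}[a]row_sum_delta linear_sum.
apply: le_trans (ler_norm_sum _ _ _) _.
apply: (@le_trans _ _ (\sum_(i < n) m' * `|a|)).
  apply: ler_sum => i _; rewrite linearZ normrZ mulrC -deriveE; last exact: dg.
  by apply: ler_pM => //; [exact: ltW|exact: norm_entry].
rewrite sumr_const card_ord -mulr_natr /m' mulrAC ler_wpM2r //.
rewrite -mulrA ler_piMr ?(ltW m0) // mulrC ler_pdivrMr ?ltr_wpDl // mul1r lerDl.
by [].
Qed.

Lemma gap_small (m rho : R) : (forall z, `|z - z0| <= rho ->
  chart_img q0 z /\ forall a, `|'d gap z a| <= m * `|a|) ->
  forall z, `|z - z0| <= rho -> `|gap z| <= m * `|z - z0|.
Proof.
move=> h z zr; have [dg _] := Ck_gap 1.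
pose c (t : R) := z0 + t *: (z - z0).
have hc t : 0 <= t <= 1 -> `|c t - z0| <= rho.
  move=> /andP[t0 t1]; rewrite /c addrC addKr normrZ ger0_norm //.
  by apply: le_trans zr; rewrite ler_piMl.
have dc (t : R) : 0 <= t <= 1 -> is_derive t 1 (gap \o c) ('d gap (c t) (z - z0)).
  move=> /hc/h[ct _]; apply: is_derive_diff_comp; first exact: dg.
  exact: is_derive_line.
have [t] : exists2 t, t \in `]0, 1[ & (gap \o c) 1 - (gap \o c) 0 = 'd gap (c t) (z - z0) * (1 - 0).
  apply: (@MVT _ (gap \o c) (fun t => 'd gap (c t) (z - z0))); first exact: ltr01.
    by move=> t; rewrite in_itv /= => /andP[t0 t1]; apply: dc; rewrite !ltW.
  apply: derivable_within_continuous => t; rewrite in_itv /= => t01.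
  by have [] := dc t t01.
have c1 : c 1 = z by rewrite /c scale1r addrC subrK.
have c0 : c 0 = z0 by rewrite /c scale0r addr0.
rewrite in_itv /= c1 c0 gap_center !subr0 mulr1 => /andP[t0 t1] ->.
by apply: (h _ (hc t _)).2; rewrite !ltW.
Qed.

Variable r : R.
Hypothesis r0 : 0 < r.
Hypothesis ball_chart : supp_ball q0 r `<=` chart_img q0.
Local Notation K := (supp_ball q0 r).
Local Notation form := (pert_form q0 i0 i1 r).

Lemma cutoff_diff B z a : (forall y v, `|'d (@chi R n) y v| <= B * `|v|) ->
  `|'d (cutoff q0 r) z a| <= B / r * `|a|.
Proof.
move=> hB; have [dc _] := @Ck_cutoff R n M q0 r 1; have [dchi _] := @Ck_chi R n 1.
rewrite -deriveE; last exact: dc.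
rewrite (@derive_affine _ _ _ _ (fun z => r^-1 *: (z - z0)) (@chi R n) a (r^-1 *: a)); last first.
  by move=> h u; rewrite -addrA scalerDr !scalerA mulrC.
rewrite deriveE; last exact: dchi.
by apply: le_trans (hB _ _) _; rewrite normrZ gtr0_norm ?invr_gt0 // mulrA.
Qed.

(** The differential of the cutoff is of order [1 / r], but [gap] is at most [m * (2 * r)] on the
    ball, so the radius cancels and the bound is proportional to [m]. For second derivatives the
    same balance would give boundedness only, which is why the approximation is C^1. *)
Lemma pert_pot_diff B m z a : 0 < B -> 0 < m ->
  (forall y v, `|'d (@chi R n) y v| <= B * `|v|) ->
  (forall z, `|z - z0| <= 2 * r -> chart_img q0 z /\ forall a, `|'d gap z a| <= m * `|a|) ->
  K z -> `|'d (pert_pot L q0 r) z a| <= (1 + 2 * B) * m * `|a|.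
Proof.
move=> B0 m0 hB hm Kz; have [cz hz] := hm z Kz.
have [dc _] := @Ck_cutoff R n M q0 r 1; have [dg _] := Ck_gap 1.
have dcz : derivable (cutoff q0 r) z a by exact/diff_derivable/dc.
have dgz : derivable gap z a by exact/diff_derivable/dg.
have [dp _] := @Ck_pert_pot R n M L q0 r sL 1.
rewrite -deriveE; last exact: dp.
have E : 'D_a (pert_pot L q0 r) z = cutoff q0 r z * 'D_a gap z + gap z * 'D_a (cutoff q0 r) z.
  exact: (deriveM dcz dgz).
rewrite E !deriveE; [|exact: dc|exact: dg].
have h1 := gap_small hm Kz; have h2 := cutoff_diff z a hB.
have h3 := cutoff_le1 q0 r z; have h4 := cutoff_ge0 q0 r z.
apply: le_trans (ler_normD _ _) _.
have -> : (1 + 2 * B) * m * `|a| = m * `|a| + (m * (2 * r)) * (B / r * `|a|).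
  by field; rewrite gt_eqF.
apply: lerD; rewrite normrM.
  rewrite -[leRHS]mul1r; apply: ler_pM => //; first by rewrite ger0_norm.
apply: ler_pM => //; apply: le_trans h1 _.
by rewrite ler_pM2l.
Qed.

(** The [if] records that the form is locally zero for [|v| > 1]. This offsets the growth [1 + |v|]
    of the vertical components in [sasaki_local_bound]. *)
Lemma form_diff_bound : exists2 B : R, 0 < B & forall z v a k, K z ->
  `|'d form (z, v) (a, k)| <= B * (if `|v| <= 1 then `|((a, k) : V2)| else 0).
Proof.
have cK := compact_setX (@compact_supp_ball R n M q0 r) (@compact_norm_le R n 1).
have [df Df] := @Ck_pert_form R n M q0 i0 i1 r 1.
have [|||B B0 hB] := @compact_diff_bound R _ _ _ form _ cK.
- exact: has_basis_prod (has_basis_rV _ _) (has_basis_rV _ _).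
- by move=> p _; exact: df.
- by move=> d p _; apply: Df; rewrite inE.
exists B => // z v a k Kz; case: ifPn => v1; first exact: (hB (z, v) (a, k) (conj Kz v1)).
have [oU U0] := @form_outside R n M q0 i0 i1 r.
rewrite -deriveE; last exact: df.
rewrite (derive_zero_open _ oU U0) ?normr0 ?mulr0 //=.
by rewrite ltNge.
Qed.

Lemma pert_diff s z v a k : chart_img q0 z ->
  'd (pert L q0 i0 i1 r s) (z, v) (a, k) = 'd (pert_pot L q0 r) z a + s * 'd form (z, v) (a, k).
Proof.
move=> cz; have [dp _] := @Ck_pert R n M L q0 i0 i1 r sL 1 s; have [df _] := @Ck_pert_form R n M q0 i0 i1 r 1.
have [dpp _] := @Ck_pert_pot R n M L q0 r sL 1.
have cU : UT (z, v) by split.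
have E1 : 'D_(a, k) (pert_pot L q0 r \o fst : V2 -> R) (z, v) = 'D_a (pert_pot L q0 r) z.
  exact: (@derive_affine _ _ _ _ fst).
have d1 : differentiable (pert_pot L q0 r \o fst : V2 -> R) (z, v).
  by apply: differentiable_comp; [have [] := linear_diff (@linear_fst R 'rV[R]_n 'rV[R]_n) (@continuous_fst R _ _) (z, v)|exact: dpp].
rewrite -deriveE; last exact: dp.
have -> : pert L q0 i0 i1 r s = (pert_pot L q0 r \o fst) + s *: form by [].
have d2 : differentiable form (z, v) by exact: df.
rewrite deriveD; [|exact: diff_derivable|exact/derivableZ/diff_derivable].
rewrite E1 deriveZ; last exact: diff_derivable.
by rewrite !deriveE //; exact: dpp.
Qed.

(** As in [ext_TM_smooth], the support is closed in the manifold, so the perturbation vanishes near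
    [q] even when [q] lies outside the domain of the chart. *)
Lemma local_diff_zero s q v xi : ~ (phi_dom q0 q /\ K (phi q0 q)) ->
  'd (TM_local q (fun q v => L q v - pert_lagrangian L q0 i0 i1 r s q v)) (phi q q, v) xi = 0.
Proof.
move=> nq.
pose KM := phi_inv q0 @` K.
have cKM : closed KM.
  apply: compact_closed; first exact: manifold_hausdorff.
  apply: continuous_compact; last exact: compact_supp_ball.
  apply: continuous_in_subspaceT => t /set_mem Kt.
  exact/phi_inv_continuous/ball_chart.
pose B := chart_img q `&` phi_inv q @^-1` (~` KM).
have oB : open B.
  rewrite openE => t [yt KMt]; apply: filterI; first exact: nbhs_chart_img.
  apply: (phi_inv_continuous yt); apply: open_nbhs_nbhs; split => //.
  exact: closed_openC.
have qq := phi_dom_self q.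
have Bq : B (phi q q).
  split; first exact: phi_chart_img.
  rewrite /= phiK // => -[t Kt tq]; apply: nq; rewrite -tq.
  by have /chart_imgP[h1 h2] := ball_chart Kt; rewrite h2.
have E : {near (phi q q, v), cst 0 =1 TM_local q (fun q v => L q v - pert_lagrangian L q0 i0 i1 r s q v)}.
  have nn : nbhs (phi q q, v) (B `*` setT).
    by apply: open_nbhs_nbhs; split; [exact: open_setXT|].
  apply: filterS nn => -[t w] [/= [yt KMt] _].
  rewrite /TM_local /pert_lagrangian /= sub_addl /ext_TM.
  case: asboolP => xt; last by rewrite oppr0.
  rewrite pert_supp // ?oppr0 // => Kt; apply: KMt.
  by exists (phi q0 (phi_inv q t)) => //; rewrite phiK.
have [_ E'] := near_eq_differentiable E (differentiable_cst 0 (phi q q, v)).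
have := congr1 (@^~ xi) E'; rewrite /= => ->.
by rewrite diff_cst.
Qed.

Lemma local_diff_pert s v q a k : phi_dom q0 q ->
  let F := TM_local q0 (fun q v => L q v - pert_lagrangian L q0 i0 i1 r s q v) in
  differentiable F (phi q0 q, v) /\
  'd F (phi q0 q, v) (a, k) = - 'd (pert L q0 i0 i1 r s) (phi q0 q, v) (a, k).
Proof.
move=> xq F.
have [dp _] := @Ck_pert R n M L q0 i0 i1 r sL 1 s.
have cU : UT (phi q0 q, v) by split => //; exact: phi_chart_img.
have dpz := dp _ cU.
have E : {near (phi q0 q, v), - pert L q0 i0 i1 r s =1 F}.
  have nn : nbhs (phi q0 q, v) UT by apply: open_nbhs_nbhs; split => //; exact/open_setXT/open_chart_img.
  apply: filterS nn => -[t w] [/= ct _].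
  rewrite /F /TM_local /pert_lagrangian /= sub_addl.
  by have := TM_local_ext (pert L q0 i0 i1 r s) w ct; rewrite /TM_local /= => ->.
have [dF E'] := near_eq_differentiable E (differentiableN dpz).
split=> //.
have := congr1 (@^~ (a, k)) E'; rewrite /= => ->.
by rewrite diffN.
Qed.

End C1Small.

Section PertC1.
Variables (R : realType) (n : nat) (M : manifold R n) (L : M -> 'rV[R]_n -> R) (q0 : M).
Variables (i0 i1 : 'I_n) (g : M -> 'M[R]_n) (r1 : R).
Hypothesis tL : tonelli L.
Hypothesis rg : riemannian_metric g.
Hypothesis L_min : forall q, L q0 0 <= L q 0.
Hypothesis r10 : 0 < r1.
Hypothesis ball_chart : supp_ball q0 r1 `<=` chart_img q0.
Local Notation z0 := (phi q0 q0).

Let sL : TM_smooth L. Proof. by case: tL. Qed.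

Lemma supp_ball_le (r r' : R) : r <= r' -> supp_ball q0 r `<=` supp_ball q0 r'.
Proof. by move=> rr' z /= zr; apply: le_trans zr _; rewrite ler_pM2l. Qed.

(** The Sasaki constant [C] is taken on the fixed ball of radius [r1], before [r] is known; this
    breaks the circularity, since [m] depends on [C] and [r] on [m]. The constants of the 1-form do
    depend on [r] and are compensated by [s], chosen last. *)
Lemma pert_C1_small (eps : R) : 0 < eps -> exists r : R, [/\ 0 < r, r <= r1 &
  exists2 s2 : R, 0 < s2 & forall s, `|s| <= s2 ->
    (C1_dist g L (pert_lagrangian L q0 i0 i1 r s) < eps%:E)%E].
Proof.
move=> eps0.
have [C C0 hC] := sasaki_local_bound rg (@compact_supp_ball R n M q0 r1) ball_chart.
have [B B0 hB] := chi_diff_bound R n.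
(* [m * D] bounds the whole contribution of the potential: the summand 2 accounts for its value, at
   most [2 * m] because [r <= 1], and the rest for its differential. Below, [G] plays this role for
   the 1-form, with [2 * C] bounding [C * (1 + |v|)] when [|v| <= 1]. *)
pose D := (1 + 2 * B) * C + 2.
have D0 : 0 < D by rewrite addr_gt0 // mulr_gt0 // addr_gt0 // mulr_gt0.
pose m := eps / (4 * D).
have m0 : 0 < m by rewrite divr_gt0 // mulr_gt0.
have mD : m * D = eps / 4 by rewrite /m; field; rewrite gt_eqF.
have [rho rho0 hrho] := gap_flat sL L_min m0.
pose r := Num.min (Num.min (rho / 2) r1) 1.
have r0 : 0 < r by rewrite !lt_min r10 ltr01 divr_gt0.
have r_rho : 2 * r <= rho.
  by rewrite mulrC -ler_pdivlMr // /r !ge_min lexx.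
have r_r1 : r <= r1 by rewrite /r !ge_min lexx orbT.
have r_1 : r <= 1 by rewrite /r !ge_min lexx !orbT.
exists r; split => //.
have KK := supp_ball_le r_r1.
have Kc : supp_ball q0 r `<=` chart_img q0 by move=> z /KK; exact: ball_chart.
have hm z : `|z - z0| <= 2 * r -> chart_img q0 z /\ forall a, `|'d (gap L q0) z a| <= m * `|a|.
  by move=> h; apply: hrho; exact: le_trans h r_rho.
have [B4 B40 hB4] := @form_bounded R n M q0 i0 i1 r r0.
have [B5 B50 hB5] := @form_diff_bound R n M q0 i0 i1 r.
pose G := B4 + B5 * (2 * C).
have G0 : 0 < G by rewrite addr_gt0 // !mulr_gt0.
exists (eps / (4 * G)); first by rewrite divr_gt0 // mulr_gt0.
move=> s hs.
have sG : `|s| * G <= eps / 4.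
  apply: (@le_trans _ _ (eps / (4 * G) * G)); first by rewrite ler_pM2r.
  by rewrite le_eqVlt; apply/orP; left; apply/eqP; field; rewrite gt_eqF.
have val q v : `|L q v - pert_lagrangian L q0 i0 i1 r s q v| <= 2 * m + `|s| * B4.
  rewrite /pert_lagrangian sub_addl normrN /ext_TM; case: asboolP => xq; last first.
    by rewrite normr0 addr_ge0 // mulr_ge0 // ltW.
  have [Kq|nK] := pselect (supp_ball q0 r (phi q0 q)); last first.
    by rewrite pert_supp // normr0 addr_ge0 // mulr_ge0 // ltW.
  have hg : `|gap L q0 (phi q0 q)| <= 2 * m.
    apply: le_trans (gap_small sL hm Kq) _; rewrite mulrC ler_pM2r //.
    by apply: le_trans Kq _; rewrite ler_piMr.
  apply: le_trans (ler_normD _ _) _; apply: lerD; last first.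
    by rewrite normrM; apply: ler_wpM2l.
  rewrite normrM /= -[leRHS]mul1r; apply: ler_pM => //.
  by rewrite ger0_norm ?cutoff_ge0 // cutoff_le1.
have dif q v : (diff_norm g (fun q v => (L q v - pert_lagrangian L q0 i0 i1 r s q v)%R) q v <=
    ((1 + 2 * B) * m * C + `|s| * (B5 * (2 * C)))%:E)%E.
  apply: ge_ereal_sup => _ [xi hxi <-]; rewrite lee_fin.
  have nn : 0 <= (1 + 2 * B) * m * C + `|s| * (B5 * (2 * C)).
    have b1 : 0 <= 1 + 2 * B by rewrite addr_ge0 // mulr_ge0 // ltW.
    have m1 := ltW m0; have c1 := ltW C0; have b5 := ltW B50.
    apply: addr_ge0; first by rewrite mulr_ge0 // mulr_ge0.
    by rewrite mulr_ge0 // mulr_ge0 // mulr_ge0.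
  have [[xq Kq]|nq] := pselect (phi_dom q0 q /\ supp_ball q0 r (phi q0 q)); last first.
    by rewrite (local_diff_zero L i0 i1 r0 Kc s v xi nq) normr0.
  have [dF _] := local_diff_pert i0 i1 sL r s (vcoord q0 q v) 0 0 xq.
  have [a [k [ha hk E]]] := hC q v xi _ xq (KK _ Kq) hxi dF.
  have [_ E2] := local_diff_pert i0 i1 sL r s (vcoord q0 q v) a k xq.
  have E3 := pert_diff i0 i1 sL r s (vcoord q0 q v) a k (Kc _ Kq).
  rewrite E E2 E3 normrN; apply: le_trans (ler_normD _ _) _; apply: lerD.
    apply: le_trans (pert_pot_diff sL r0 a B0 m0 hB hm Kq) _.
    by rewrite ler_wpM2l // mulr_ge0 ?(ltW m0) // addr_ge0 // mulr_ge0 // ltW.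
  rewrite normrM; apply: ler_wpM2l => //; apply: le_trans (hB5 _ _ _ _ Kq) _.
  rewrite ler_wpM2l ?(ltW B50) //; case: ifPn => v1; last by rewrite mulr_ge0 // ltW.
  rewrite prod_normE /= ge_max; apply/andP; split.
    by apply: le_trans ha _; rewrite ler_peMl ?(ltW C0) // ler1n.
  by apply: le_trans hk _; rewrite mulrC ler_pM2r // -[leRHS]/(1 + 1) lerD2l.
(* A supremum inherits only a weak inequality, hence the detour through [eps / 2], a quarter for the
   potential and a quarter for the form. *)
apply: (@le_lt_trans _ _ ((eps / 2)%:E)); last first.
  by rewrite lte_fin ltr_pdivrMr // ltr_pMr // ltr1n.
apply: ge_ereal_sup => _ [[q v] _ <-] /=.
have -> : eps / 2 = eps / 4 + eps / 4 by lra.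
apply: (@le_trans _ _ ((2 * m + `|s| * B4)%:E + ((1 + 2 * B) * m * C + `|s| * (B5 * (2 * C)))%:E)%E).
  by apply: leeD; [rewrite lee_fin; exact: val|exact: dif].
rewrite -EFinD lee_fin.
have -> : 2 * m + `|s| * B4 + ((1 + 2 * B) * m * C + `|s| * (B5 * (2 * C))) = m * D + `|s| * G.
  by rewrite /D /G; ring.
by rewrite mD lerD2l.
Qed.
End PertC1.

(** * Loops around a circle *)

Lemma is_derive_scalel (R : realType) (V : normedModType R) (f : R -> R) (t df : R) (v : V) :
  is_derive t 1 f df -> is_derive t 1 (fun s => f s *: v) (df *: v).
Proof.
move=> hf; pose l (a : R) := a *: v.
have ll : linear l by move=> a b c; rewrite /l scalerDl scalerA.
have cl : continuous l by move=> a; apply: cvgZr_tmp; exact: cvg_id.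
have [dl El] := linear_diff ll cl (f t).
have h := is_derive_diff_comp dl hf.
by rewrite El in h.
Qed.

Section Circle.
Variables (R : realType) (n : nat) (z0 : 'rV[R]_n) (i0 i1 : 'I_n) (r : R).
Hypothesis i01 : i0 != i1.
Hypothesis r0 : 0 < r.
Local Notation e i := (delta_mx 0 i : 'rV[R]_n).

Definition circle_dir (th : R) : 'rV[R]_n := (r * cos th) *: e i0 + (r * sin th) *: e i1.
Definition circle_tan (th : R) : 'rV[R]_n := (- (r * sin th)) *: e i0 + (r * cos th) *: e i1.
Definition circle (th : R) : 'rV[R]_n := z0 + circle_dir th.

Lemma plane_entry (a b : R) i : (a *: e i0 + b *: e i1) 0 i =
  if i == i0 then a else if i == i1 then b else 0.
Proof.
rewrite !mxE !eqxx /=; case: (eqVneq i i0) => [->|ne].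
  by rewrite (negbTE i01) mulr1 mulr0 addr0.
by case: (eqVneq i i1) => _; rewrite ?mulr1 mulr0 ?mulr0 add0r.
Qed.

Lemma plane_norm (a b c : R) : `|a| <= c -> `|b| <= c -> `|a *: e i0 + b *: e i1| <= c.
Proof.
move=> ac bc; have c0 : 0 <= c by exact: le_trans ac.
apply: norm_entry_le => // i; rewrite plane_entry.
by case: ifP => // _; case: ifP => // _; rewrite normr0.
Qed.

Lemma plane_sqn (a b : R) : sqn (a *: e i0 + b *: e i1) = a ^+ 2 + b ^+ 2.
Proof.
rewrite /sqn (bigD1 i0) //= (bigD1 i1) 1?eq_sym //= big1 => [|i /andP[h0 h1]].
  by rewrite !plane_entry !eqxx eq_sym (negbTE i01) addr0.
by rewrite plane_entry (negbTE h0) (negbTE h1) expr0n.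
Qed.

Lemma cos_bound (th : R) : `|r * cos th| <= r /\ `|r * sin th| <= r.
Proof.
rewrite !normrM gtr0_norm //; split; rewrite ler_piMr ?(ltW r0) // ler_norml.
  by rewrite cos_geN1 cos_le1.
by rewrite sin_geN1 sin_le1.
Qed.

Lemma circle_norm th : `|circle th - z0| <= r.
Proof.
by rewrite /circle addrC addKr; have [? ?] := cos_bound th; exact: plane_norm.
Qed.

Lemma circle_tan_norm th : `|circle_tan th| <= r.
Proof. by have [? ?] := cos_bound th; apply: plane_norm => //; rewrite normrN. Qed.

Lemma circle_sqn th : sqn (r^-1 *: (circle th - z0)) = 1.
Proof.
rewrite /circle addrC addKr /circle_dir scalerDr !scalerA !mulrA mulVf ?gt_eqF // !mul1r.
by rewrite plane_sqn cos2Dsin2.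
Qed.

Lemma circle_tan_sqn th (om : R) : sqn (om *: circle_tan th) = r ^+ 2 * om ^+ 2.
Proof.
rewrite /circle_tan scalerDr !scalerA plane_sqn.
transitivity (r ^+ 2 * om ^+ 2 * (cos th ^+ 2 + sin th ^+ 2)); first ring.
by rewrite cos2Dsin2 mulr1.
Qed.

Lemma circle_derive (th : R) : is_derive th 1 circle (circle_tan th).
Proof.
have hc : is_derive th 1 (fun t : R => r * cos t) (- (r * sin th)).
  by rewrite -mulrN; exact: (is_deriveZ r (is_derive_cos th)).
have hs : is_derive th 1 (fun t : R => r * sin t) (r * cos th).
  exact: (is_deriveZ r (is_derive_sin th)).
have h := is_deriveD (is_derive_cst z0 th 1)
  (is_deriveD (is_derive_scalel (e i0) hc) (is_derive_scalel (e i1) hs)).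
by rewrite add0r in h.
Qed.

Lemma circle_continuous : continuous circle.
Proof.
move=> th; apply: differentiable_continuous; apply/derivable1_diffP.
by have [] := circle_derive th.
Qed.

Lemma circle_tan_continuous : continuous circle_tan.
Proof.
move=> th; apply: cvgD; apply: cvgZr_tmp.
  by apply: cvgN; apply: cvgMl_tmp; exact: continuous_sin.
by apply: cvgMl_tmp; exact: continuous_cos.
Qed.

Lemma circle_periodic th : circle (th + 2 * pi) = circle th.
Proof.
by rewrite /circle /circle_dir mulr_natl cosD2pi sinD2pi.
Qed.

Lemma circle_tan_periodic th : circle_tan (th + 2 * pi) = circle_tan th.
Proof.
by rewrite /circle_tan mulr_natl cosD2pi sinD2pi.
Qed.

End Circle.

Lemma reflect_integral (R : realType) (p : R) (F : R -> R) : 0 < p -> continuous F ->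
  (\int[lebesgue_measure]_(t in `[0%R, p]) (F t)%:E =
   \int[lebesgue_measure]_(t in `[0%R, p]) (F (p - t))%:E)%E.
Proof.
move=> p0 cF.
have dp (t : R) : is_derive t 1 (fun t => p - t) (- 1).
  by rewrite -[X in is_derive _ _ _ X]add0r; exact: (is_deriveB (is_derive_cst p t 1) (is_derive_id t 1)).
have dF : derive1 (fun t : R => p - t) = cst (- 1).
  by apply/funext => t; rewrite derive1E; have [_ ->] := dp t.
have := @integration_by_substitution_decreasing R (fun t => p - t) F 0 p (ltW p0).
rewrite subrr subr0 => -> //.
- apply: eq_integral => t _; rewrite !fctE /= dF.
  by rewrite opprK mulr1.
- by move=> s t _ _; rewrite ltrD2l ltrN2.
- by move=> t _; rewrite dF; exact: cvg_cst.
- by rewrite dF; exact: is_cvg_cst.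
- by rewrite dF; exact: is_cvg_cst.
- have cp : continuous (fun t => p - t).
    by move=> t; apply: cvgB; [exact: cvg_cst|exact: cvg_id].
  split; first by move=> t _; have [] := dp t.
    by apply: cvg_at_right_filter; exact: cp.
  by apply: cvg_at_left_filter; exact: cp.
- exact: continuous_subspaceT.
Qed.

Lemma continuous_integrable_period (R : realType) (p : R) (F : R -> R) : 0 < p -> continuous F ->
  (@lebesgue_measure R).-integrable `[0, p]%classic (EFin \o F).
Proof.
move=> p0 cF; apply: continuous_compact_integrable; first exact: segment_compact.
exact: continuous_subspaceT.
Qed.

(** The second loop runs backwards. Reversing its time brings both loops to the same point of the
    circle simultaneously, so that their integrands can be added pointwise. *)
Lemma reflected_sum_bound (R : realType) (p a m : R) (F1 F2 : R -> R) : 0 < p ->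
  continuous F1 -> continuous F2 ->
  (0 <= \int[lebesgue_measure]_(t in `[0%R, p]) (F1 t)%:E + (p * a)%:E)%E ->
  (0 <= \int[lebesgue_measure]_(t in `[0%R, p]) (F2 t)%:E + (p * a)%:E)%E ->
  (forall t, 0 <= t <= p -> F1 t + F2 (p - t) <= m) -> 0 <= m + 2 * a.
Proof.
move=> p0 c1 c2 h1 h2 hm.
have c2' : continuous (fun t => F2 (p - t)).
  move=> t; apply: (@continuous_comp _ _ _ (fun t => p - t) F2); last exact: c2.
  by apply: cvgB; [exact: cvg_cst|exact: cvg_id].
have i1 := continuous_integrable_period p0 c1.
have i2 := continuous_integrable_period p0 c2'.
rewrite (reflect_integral p0 c2) in h2.
have mD : measurable (`[0, p]%classic : set (measurableTypeR R)) by exact: measurable_itv.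
have h3 := adde_ge0 h1 h2; rewrite addeACA -integralD // in h3.
have h4 : (\int[lebesgue_measure]_(t in `[0%R, p]) ((F1 t)%:E + (F2 (p - t))%:E) <= (p * m)%:E)%E.
  rewrite -(integral_cst_period p0 m); apply: le_integral => //.
  - exact: (integrableD mD i1 i2).
  - exact: integrable_cst_period.
  - by move=> t /set_mem /=; rewrite in_itv /= => tp; rewrite -EFinD lee_fin; exact: hm.
have h5 := le_trans h3 (leeD2r _ h4).
rewrite -!EFinD lee_fin in h5.
have : 0 <= p * (m + 2 * a) by apply: le_trans h5 _; rewrite le_eqVlt; apply/orP; left; apply/eqP; ring.
by rewrite pmulr_rge0.
Qed.

Lemma loop_small_arith (R : realType) (a b l d1 d2 d0 om delta : R) : 0 < om ->
  a - l = d1 * om -> l - b = d2 * om -> `|d1 - d0| < delta / 2 -> `|d2 - d0| < delta / 2 ->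
  a + b - 2 * l <= delta * om.
Proof.
move=> o0 E1 E2; rewrite !ltr_distl => /andP[h1 h2] /andP[h3 h4].
have -> : a + b - 2 * l = (d1 - d2) * om by rewrite mulrBl -E1 -E2; ring.
by rewrite ler_pM2r //; lra.
Qed.

(** * Cancellation of the first order terms at small speed *)

Section SmallSum.
Variables (R : realType) (n : nat) (M : manifold R n) (L : M -> 'rV[R]_n -> R) (q0 : M).
Variables (i0 i1 : 'I_n) (r : R).
Hypothesis sL : TM_smooth L.
Local Notation z0 := (phi q0 q0).
Local Notation Lx := (TM_local q0 L).
Local Notation V2 := ('rV[R]_n * 'rV[R]_n)%type.
Local Notation e i := ((0, delta_mx 0 i) : V2).
Local Notation c := (circle z0 i0 i1 r).
Local Notation T := (circle_tan i0 i1 r).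
Hypothesis circle_chart : forall th, chart_img q0 (c th).

Definition loop_lagr (th om : R) : R := Lx (c th, om *: T th).

Lemma loop_lagr_continuous2 : continuous (fun p : R * R => (c p.2, p.1 *: T p.2) : V2).
Proof.
move=> p; have c1 := continuous_comp (@continuous_snd _ _ _ p) (@circle_continuous R n z0 i0 i1 r p.2).
have c2 := continuous_comp (@continuous_snd _ _ _ p) (@circle_tan_continuous R n i0 i1 r p.2).
exact: (cvg_pair c1 (cvgZ (@continuous_fst _ _ _ p) c2)).
Qed.

Definition loop_deriv (p : R * R) : R :=
  \sum_i (T p.2) 0 i * 'D_(e i) Lx (c p.2, p.1 *: T p.2).

Lemma loop_deriv_continuous : continuous loop_deriv.
Proof.
have [_ DL] := sL q0 1.
suff : Ck 0 setT loop_deriv by move=> h p; apply: h; rewrite inE.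
apply: Ck_sum; first exact: openT.
move=> i _ p _.
have c2 := continuous_comp (@continuous_snd _ _ _ p) (@circle_tan_continuous R n i0 i1 r p.2).
have c3 := continuous_comp c2 (@coord_continuous _ _ _ 0 i _).
have c4 : {for (c p.2, p.1 *: T p.2), continuous ('D_(e i) Lx)}.
  by apply: DL; rewrite inE; split => //; exact: circle_chart.
exact: (continuousM c3 (continuous_comp (@loop_lagr_continuous2 p) c4)).
Qed.

Lemma loop_lagr_derive (th om : R) : is_derive om 1 (loop_lagr th) (loop_deriv (om, th)).
Proof.
have [dL _] := sL q0 1.
have dp : differentiable Lx (c th, om *: T th) by apply: dL; split => //; exact: circle_chart.
have dc : is_derive om 1 (fun s : R => (c th, s *: T th) : V2) (0, T th).
  have -> : (fun s : R => (c th, s *: T th) : V2) = fun s => (c th, 0) + s *: ((0, T th) : V2).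
    apply/funext => s; apply: injective_projections; rewrite /= ?add0r //.
    by rewrite scaler0 addr0.
  exact: is_derive_line.
have h := is_derive_diff_comp dp dc.
suff -> : loop_deriv (om, th) = 'd Lx (c th, om *: T th) (0, T th) by [].
rewrite (inr_sum (T th)) linear_sum; apply: eq_bigr => i _.
by rewrite linearZ /= deriveE.
Qed.

(** The mean value theorem in the speed, on each side of 0, writes the left-hand side as [om] times
    a difference of two values of [loop_deriv] at the same angle. Both are close to the value at
    speed 0, uniformly in the angle by compactness of the interval of angles. *)
Lemma loop_lagr_small (delta : R) : 0 < delta -> exists2 om0 : R, 0 < om0 &
  forall om th, 0 < om < om0 -> 0 <= th <= 2 * pi ->
    loop_lagr th om + loop_lagr th (- om) - 2 * Lx (c th, 0 : 'rV[R]_n) <= delta * om.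
Proof.
move=> d0.
have cK : compact (`[0, 2 * pi]%classic : set R) by exact: segment_compact.
pose G (p : R * R) := delta / 2 - `|loop_deriv p - loop_deriv (0, p.2)|.
have cG : continuous G.
  move=> p.
  have c1 : {for p, continuous (fun p : R * R => (0 : R, p.2))}.
    by apply: continuous_pair_at; [exact: cvg_cst|exact: cvg_snd].
  have c2 := @continuous_comp _ _ _ _ loop_deriv p c1 (@loop_deriv_continuous _).
  have c3 := continuousB (@loop_deriv_continuous p) c2.
  have c4 := continuous_comp c3 (@norm_continuous _ _ _).
  exact: (continuousB (cvg_cst (delta / 2)) c4).
have near0 := @compact_near_pos R R R `[0, 2 * pi]%classic 0 G cK (fun v _ => cG (0, v)).
have [|om0 /= om00 hom] := (nbhs_ballP _ _).1 (near0 _).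
  by move=> v _; rewrite /G /= subrr normr0 subr0 divr_gt0.
exists om0; first exact: om00.
move=> om th /andP [w0 ww] thK.
have hG x : `|x| < om0 -> `|loop_deriv (x, th) - loop_deriv (0, th)| < delta / 2.
  move=> xo; have := hom x; rewrite /ball /= sub0r normrN => /(_ xo th).
  by rewrite /= in_itv /= => /(_ thK); rewrite subr_gt0.
have cL (a b : R) : {within `[a, b], continuous (loop_lagr th)}.
  by apply: derivable_within_continuous => s _; have [] := loop_lagr_derive th s.
have [x1 x1in E1] := MVT w0 (fun x _ => loop_lagr_derive th x) (cL _ _).
have no0 : - om < 0 by rewrite oppr_lt0.
have [x2 x2in E2] := MVT no0 (fun x _ => loop_lagr_derive th x) (cL _ _).
have E0 : loop_lagr th 0 = Lx (c th, 0 : 'rV[R]_n) by rewrite /loop_lagr scale0r.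
move: x1in x2in; rewrite !in_itv /= => /andP[a1 b1] /andP[a2 b2].
have h1 := hG x1; have h2 := hG x2.
have hx1 : `|x1| < om0 by rewrite gtr0_norm //; exact: lt_trans b1 ww.
have hx2 : `|x2| < om0 by rewrite ltr0_norm // ltrNl; apply: lt_trans a2; rewrite ltrN2.
have {}h1 := h1 hx1; have {}h2 := h2 hx2.
rewrite subr0 E0 in E1; rewrite sub0r opprK E0 in E2.
exact: loop_small_arith w0 E1 E2 h1 h2.
Qed.

End SmallSum.

(** * Lifted loops and their absolute continuity *)

Lemma lipschitz_abs_continuous (R : realType) (V : normedModType R) (a b C : R) (f : R -> V) :
  (forall s t, a <= s -> s <= t -> t <= b -> `|f t - f s| <= C * (t - s)) ->
  abs_continuous a b f.
Proof.
move=> h eps eps0; have C0 : 0 < `|C| + 1 by rewrite ltr_wpDl.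
exists (eps / (`|C| + 1)); first by rewrite divr_gt0.
move=> m s t hst _ hd.
apply: (@le_lt_trans _ _ ((`|C| + 1) * \sum_(i < m) (t i - s i))); last first.
  by rewrite mulrC -ltr_pdivlMr.
rewrite mulr_sumr; apply: ler_sum => i _; have [as_ st tb] := hst i.
apply: le_trans (h _ _ as_ st tb) _; rewrite ler_wpM2r ?subr_ge0 //.
by apply: le_trans (ler_norm _) _; rewrite lerDl.
Qed.

(** The scalar mean value theorem is applied to each coordinate, at its own intermediate point; with
    the sup norm nothing is lost in the constant. *)
Lemma mean_value_norm (R : realType) n (f : R -> 'rV[R]_n) (df : R -> 'rV[R]_n) (s t C : R) :
  s <= t -> (forall x : R, s <= x <= t -> is_derive x 1 f (df x) /\ `|df x| <= C) ->
  `|f t - f s| <= C * (t - s).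
Proof.
move=> st h.
have C0 : 0 <= C.
  by have [_] := h s (introT andP (conj (lexx _) st)); apply: le_trans.
apply: norm_entry_le; first by rewrite mulr_ge0 // subr_ge0.
move=> i; pose fi x := f x 0 i.
have dfi (x : R) : s <= x <= t -> is_derive x 1 fi (df x 0 i).
  move=> xst; have [[dx Ex] _] := h x xst; apply: DeriveDef.
    by move/derivable_mxP : dx; exact.
  by rewrite -Ex derive_mx // mxE.
have [x xst E] : exists2 x, x \in `[s, t] & fi t - fi s = df x 0 i * (t - s).
  apply: (@MVT_segment _ fi (fun x => df x 0 i)) => //.
    by move=> x; rewrite in_itv /= => /andP[? ?]; apply: dfi; rewrite !ltW.
  by apply: derivable_within_continuous => x; rewrite in_itv /= => /dfi[].
rewrite !mxE -/(fi t) -/(fi s) E normrM [X in _ * X]ger0_norm ?subr_ge0 //.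
rewrite ler_wpM2r ?subr_ge0 //; apply: le_trans (norm_entry _ _) _.
by move: xst; rewrite in_itv /= => /h[].
Qed.

Section Covering.
Variables (R : realType) (n : nat) (M N : manifold R n) (rho : N -> M).
Hypothesis cov : smooth_covering rho.

Lemma covering_local_section q0 : exists (U : set M) (s : M -> N),
  [/\ open U, U q0, smooth_map_on U s & forall y, U y -> rho (s y) = y].
Proof.
have [_ surj h] := cov; have [U [sheets [oU Uq _ E hS]]] := h q0.
have [x xq] := surj q0.
have : (rho @^-1` U) x by rewrite /= xq.
rewrite -E => -[S sS _]; have [_ [s [h1 h2 _]]] := hS S sS.
by exists U, s; split => // y /h2[].
Qed.

End Covering.

Section Loop.
Variables (R : realType) (n : nat) (M N : manifold R n) (rho : N -> M).
Variables (U : set M) (sec : M -> N) (q0 : M) (u du : R -> 'rV[R]_n) (C : R).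
Hypothesis rho_smooth : smooth_map_on setT rho.
Hypothesis oU : open U.
Hypothesis sec_smooth : smooth_map_on U sec.
Hypothesis secK : forall y, U y -> rho (sec y) = y.
Hypothesis u_derive : forall t : R, is_derive t 1 u (du t).
Hypothesis du_bound : forall t, `|du t| <= C.
Hypothesis u_chart : forall t, chart_img q0 (u t).
Hypothesis u_U : forall t, U (phi_inv q0 (u t)).

Definition base_loop (t : R) : M := phi_inv q0 (u t).
(** Lifting through a local section makes the lift close up as soon as the base loop does. *)
Definition lift_loop (t : R) : N := sec (base_loop t).

Lemma u_continuous : continuous u.
Proof.
move=> t; apply: differentiable_continuous; apply/derivable1_diffP.
by have [] := u_derive t.
Qed.

Lemma base_loop_continuous : continuous base_loop.
Proof.
by move=> t; exact: (continuous_comp (@u_continuous t) (phi_inv_continuous (u_chart t))).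
Qed.

Lemma lift_loop_continuous : continuous lift_loop.
Proof.
move=> t; apply: (@continuous_comp _ _ _ base_loop sec); first exact: base_loop_continuous.
by apply: sec_smooth.1; rewrite inE; exact: u_U.
Qed.

Lemma base_loop_dom t : phi_dom q0 (base_loop t).
Proof. by have /chart_imgP[] := u_chart t. Qed.

Lemma phi_base_loop t : phi q0 (base_loop t) = u t.
Proof. by have /chart_imgP[] := u_chart t. Qed.

Lemma base_loop_derive (t : R) : is_derive t 1 (phi q0 \o base_loop) (du t).
Proof.
have -> : phi q0 \o base_loop = u by apply/funext => s; exact: phi_base_loop.
exact: u_derive.
Qed.

Lemma base_loop_velocity t : velocity base_loop t = to_fiber q0 (u t) (du t).
Proof.
by rewrite (velocityE (@base_loop_continuous t) (base_loop_dom t) (base_loop_derive t)) phi_base_loop.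
Qed.

Lemma rho_lift_loop : rho \o lift_loop = base_loop.
Proof. by apply/funext => t; rewrite /= secK //; exact: u_U. Qed.

Lemma lift_loop_lagrangian (L : M -> 'rV[R]_n -> R) t :
  lift_lagrangian rho L (lift_loop t) (velocity lift_loop t) = TM_local q0 L (u t, du t).
Proof.
have db : derivable (phi (base_loop t) \o base_loop) t 1.
  apply: (derivable_chart (x := q0)); [exact: base_loop_continuous|exact: base_loop_dom|
    exact: phi_dom_self|].
  by have [] := base_loop_derive t.
have [dl _] := tangent_velocity sec_smooth (u_U t) (@base_loop_continuous t) db.
rewrite /lift_lagrangian.
rewrite (tangent_velocityE rho_smooth I (@lift_loop_continuous t) dl) rho_lift_loop.
rewrite base_loop_velocity -phi_base_loop TM_local_phi; last exact: base_loop_dom.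
by rewrite /lift_loop secK //; exact: u_U.
Qed.

(** Read in a chart of the cover, the lift is a C^1 map composed with [u]. The differential of that
    map is bounded on the compact arc described by [u], and [u] has bounded derivative, so the
    composite is Lipschitz. *)
Lemma lift_loop_ac : abs_continuous_curve lift_loop.
Proof.
split; first exact: lift_loop_continuous.
move=> y a b hab.
pose F := phi y \o sec \o phi_inv q0.
pose W := phi q0 @` (phi_dom q0 `&` U `&` sec @^-1` phi_dom y).
have WE z : W z <-> [/\ chart_img q0 z, U (phi_inv q0 z) & phi_dom y (sec (phi_inv q0 z))].
  split=> [[q [[xq Uq] yq] <-]|[[q xq <-]]].
    by rewrite phiK //; split=> //; exact: phi_chart_img.
  by rewrite phiK // => Uq yq; exists q.
have CF : Ck 1 W F by have [_ h] := sec_smooth; exact: h.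
have [dF DF] := CF.
pose K := u @` `[a, b].
have cK : compact K.
  apply: continuous_compact; last exact: segment_compact.
  by apply: continuous_subspaceT; exact: u_continuous.
have KW : K `<=` W.
  move=> _ [t tab <-]; apply/WE; split=> //; apply: hab; by exists t.
have [B B0 hB] : exists2 B, 0 < B & forall z v, K z -> `|'d F z v| <= B * `|v|.
  apply: compact_diff_bound => //; first exact: has_basis_rV.
    by move=> z /KW; exact: dF.
  by move=> v z /KW Wz; apply: DF; rewrite inE.
apply: (@lipschitz_abs_continuous _ _ _ _ (B * C)) => s t as_ st tb.
have E : phi y \o lift_loop = F \o u by [].
rewrite E; apply: (@mean_value_norm _ _ _ (fun x => 'd F (u x) (du x))) => // x /andP[sx xt].
have Kx : K (u x).
  by exists x => //=; rewrite in_itv /= (le_trans as_ sx) (le_trans xt tb).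
split.
  exact: (is_derive_diff_comp (dF _ (KW _ Kx)) (u_derive x)).
by apply: le_trans (hB _ _ Kx) _; rewrite ler_wpM2l // ltW.
Qed.

End Loop.

Section PertLoop.
Variables (R : realType) (n : nat) (M : manifold R n) (L : M -> 'rV[R]_n -> R) (q0 : M).
Variables (i0 i1 : 'I_n) (r : R).
Hypothesis i01 : i0 != i1.
Hypothesis sL : TM_smooth L.
Hypothesis r0 : 0 < r.
Hypothesis ball_chart : supp_ball q0 r `<=` chart_img q0.
Local Notation z0 := (phi q0 q0).
Local Notation Lx := (TM_local q0 L).
Local Notation c := (circle z0 i0 i1 r).
Local Notation T := (circle_tan i0 i1 r).

Lemma circle_supp th : supp_ball q0 r (c th).
Proof. by apply: le_trans (circle_norm _ i01 r0 th) _; rewrite ler_peMl ?(ltW r0) // ler1n. Qed.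

Lemma circle_chart th : chart_img q0 (c th).
Proof. exact/ball_chart/circle_supp. Qed.

(** The cutoff is 1 on the circle. The term in [s] is [kappa] times x dy - y dx on the velocity of a
    uniform rotation; it is odd in [om], hence favors one direction of travel. *)
Lemma pert_on_circle s th om : TM_local q0 (pert_lagrangian L q0 i0 i1 r s) (c th, om *: T th) =
  loop_lagr L q0 i0 i1 r th om + (L q0 0 - Lx (c th, 0 : 'rV[R]_n)) +
  s * (bump (1 - r ^+ 2 * om ^+ 2) * (r ^+ 2 * om)).
Proof.
have -> : TM_local q0 (pert_lagrangian L q0 i0 i1 r s) (c th, om *: T th) =
    Lx (c th, om *: T th) + TM_local q0 (ext_TM q0 (pert L q0 i0 i1 r s)) (c th, om *: T th) by [].
rewrite TM_local_ext; last exact: circle_chart.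
rewrite -addrA; congr (_ + _); rewrite /pert /pert_pot /pert_form /=.
have -> : cutoff q0 r (c th) = 1 by apply: chi_circle; exact: circle_sqn.
have -> : kappa (om *: T th) = bump (1 - r ^+ 2 * om ^+ 2) by rewrite /kappa circle_tan_sqn.
have -> : rot_form q0 i0 i1 (c th, om *: T th) = r ^+ 2 * om.
  rewrite /rot_form /=.
  have -> : c th - z0 = circle_dir i0 i1 r th by rewrite /circle addrC addKr.
  have i10 : (i1 == i0) = false by rewrite eq_sym (negbTE i01).
  have h0 : circle_dir i0 i1 r th 0 i0 = r * cos th by rewrite /circle_dir plane_entry // eqxx.
  have h1 : circle_dir i0 i1 r th 0 i1 = r * sin th.
    by rewrite /circle_dir plane_entry // i10 eqxx.
  have k0 : (om *: T th) 0 i0 = om * - (r * sin th).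
    by rewrite /circle_tan mxE plane_entry // eqxx.
  have k1 : (om *: T th) 0 i1 = om * (r * cos th).
    by rewrite /circle_tan mxE plane_entry // i10 eqxx.
  rewrite h0 h1 k0 k1.
  transitivity (r ^+ 2 * om * (cos th ^+ 2 + sin th ^+ 2)); first ring.
  by rewrite cos2Dsin2 mulr1.
by rewrite !mul1r.
Qed.

Definition speed_loop (om t : R) := c (om * t).
Definition speed_loop_tan (om t : R) := om *: T (om * t).

Lemma speed_loop_derive (om t : R) : is_derive t 1 (speed_loop om) (speed_loop_tan om t).
Proof.
have [dc Ec] := circle_derive z0 i0 i1 r (om * t).
have dc' : differentiable c (om * t) by apply/derivable1_diffP.
have dl : is_derive t 1 (fun t : R => om * t) om.
  have h := is_deriveZ om (is_derive_id t (1:R)).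
  by rewrite [om *: _]mulr1 in h.
have h := is_derive_diff_comp dc' dl.
suff -> : speed_loop_tan om t = 'd c (om * t) om by [].
rewrite /speed_loop_tan -Ec (deriveE _ dc') -linearZ; congr ('d c _ _).
by rewrite /GRing.scale /= mulr1.
Qed.

Lemma speed_loop_tan_bound (om t : R) : `|speed_loop_tan om t| <= `|om| * r.
Proof. by rewrite normrZ ler_wpM2l // circle_tan_norm. Qed.

Lemma speed_loop_tan_continuous om : continuous (speed_loop_tan om).
Proof.
move=> t; have c1 : {for t, continuous (fun t : R => om * t)} by apply: cvgMl_tmp; exact: cvg_id.
have c2 := @continuous_comp _ _ _ _ T t c1 (@circle_tan_continuous R n i0 i1 r _).
exact: (cvgZ (cvg_cst om) c2).
Qed.

End PertLoop.

Lemma loop_sum_arith (R : realType) (l1 l2 l3 l4 s b x om m : R) : l1 + l2 - 2 * l3 <= m ->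
  l1 + (l4 - l3) + (l2 + (l4 - l3) + s * (b * (x * - om))) <= m + 2 * l4 - s * (b * (x * om)).
Proof. rewrite !mulrN; move: (s * (b * (x * om))) => y; lra. Qed.

(** * Density: actions of the two opposite loops *)

Section Density.
Variables (R : realType) (n : nat) (M N : manifold R n) (rho : N -> M) (g : M -> 'M[R]_n).
Hypothesis n1 : (1 < n)%N.
Hypothesis closedM : closed_manifold M.
Hypothesis cov : smooth_covering rho.
Hypothesis rg : riemannian_metric g.

(** The speed may have either sign, the period being [2 * pi / |om|]. The action of the lift is
    rewritten as the integral of a continuous function in the chart at [q0], to which the time
    reflection applies. *)
Lemma ac_loop_action (L : M -> 'rV[R]_n -> R) (q0 : M) (U : set M) (sec : M -> N)
    (i0 i1 : 'I_n) (r s om : R) :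
  i0 != i1 -> TM_smooth L -> 0 < r -> supp_ball q0 r `<=` chart_img q0 ->
  open U -> smooth_map_on U sec -> (forall y, U y -> rho (sec y) = y) ->
  (forall z, supp_ball q0 r z -> U (phi_inv q0 z)) -> om != 0 ->
  let L' := pert_lagrangian L q0 i0 i1 r s in
  let F t := TM_local q0 L' (speed_loop q0 i0 i1 r om t, speed_loop_tan i0 i1 r om t) in
  forall e, nonneg_action (lift_lagrangian rho L') e ->
  continuous F /\
  (0 <= \int[lebesgue_measure]_(t in `[0%R, (2 * pi / `|om|)%R]) (F t)%:E + ((2 * pi / `|om|)%R * e)%:E)%E.
Proof.
move=> i01 sL r0 ball oU ss sK bU om0 L' F e he.
have [rs surj _] := cov.
have chart t : chart_img q0 (speed_loop q0 i0 i1 r om t) by exact: circle_chart.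
have inU t : U (phi_inv q0 (speed_loop q0 i0 i1 r om t)) by apply: bU; exact: circle_supp.
have ud (t : R) := speed_loop_derive q0 i0 i1 r om t.
pose gam := lift_loop sec q0 (speed_loop q0 i0 i1 r om).
have ac : abs_continuous_curve gam.
  exact: (lift_loop_ac ss ud (speed_loop_tan_bound i01 r0 om) chart inU).
have per : forall t, gam (t + 2 * pi / `|om|) = gam t.
  move=> t; rewrite /gam /lift_loop /base_loop; congr (sec (phi_inv q0 _)).
  rewrite /speed_loop mulrDr.
  have [op|on] := ltP 0 om.
    have -> : om * (2 * pi / `|om|) = 2 * pi by rewrite gtr0_norm // mulrC divfK.
    exact: circle_periodic.
  have -> : om * (2 * pi / `|om|) = - (2 * pi) by rewrite ler0_norm // invrN mulrN mulrN mulrC divfK.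
  by rewrite -(circle_periodic _ _ _ _ (om * t - 2 * pi)) subrK.
have p0 : 0 < 2 * pi / `|om| by rewrite divr_gt0 ?normr_gt0 // mulr_gt0 // pi_gt0.
have h := he _ gam p0 (conj ac per).
split.
  move=> t; have sL' : TM_smooth L' by apply: pert_lagrangian_smooth.
  apply: (@continuous_comp _ _ _ (fun t => (speed_loop q0 i0 i1 r om t, speed_loop_tan i0 i1 r om t))
    (TM_local q0 L')); last exact: TM_local_continuous.
  apply: continuous_pair_at; last exact: speed_loop_tan_continuous.
  exact: (u_continuous ud).
apply: le_trans h _; rewrite /free_period_action; apply: leeD2r.
rewrite le_eqVlt; apply/orP; left; apply/eqP; apply: eq_integral => t _.
by rewrite (lift_loop_lagrangian rs ss sK ud chart inU).
Qed.

Lemma tonelli_lt_dense : dense_in (C1_dist g) [set L | tonelli L] (tonelli_lt rho).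
Proof.
move=> L tL eps eps0; have sL : TM_smooth L by case: tL.
have [rs surj _] := cov.
have [q0 hmin] := zero_section_min closedM sL.
have [U [sec [oU Uq ss sK]]] := covering_local_section cov q0.
pose i0 : 'I_n := Ordinal (ltnW n1); pose i1 : 'I_n := Ordinal n1.
have i01 : i0 != i1 by [].
have zc := center_chart_img q0.
have nU : nbhs (phi q0 q0) (phi_inv q0 @^-1` U).
  apply: (phi_inv_continuous zc); rewrite phiK; last exact: phi_dom_self.
  exact: open_nbhs_nbhs.
have [d /= d0 hd] := (nbhs_ballP _ _).1 (filterI (nbhs_chart_img zc) nU).
(* [supp_ball] has radius [2 * r1], which must be less than [d]. *)
pose r1 := d / 3.
have r10 : 0 < r1 by rewrite divr_gt0.
have ball1 z : supp_ball q0 r1 z -> chart_img q0 z /\ U (phi_inv q0 z).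
  move=> hz; apply: hd; rewrite -ball_normE /= distrC; apply: le_lt_trans hz _.
  by rewrite /r1 mulrCA gtr_pMr // ltr_pdivrMr // mul1r ltr_nat.
have [r [r0 rr1 [s2 s20 hs2]]] := pert_C1_small i0 i1 tL rg hmin r10 (fun z hz => (ball1 z hz).1) eps0.
have ball z : supp_ball q0 r z -> chart_img q0 z /\ U (phi_inv q0 z).
  by move=> /(supp_ball_le rr1); exact: ball1.
have bc : supp_ball q0 r `<=` chart_img q0 by move=> z /ball[].
have bU z : supp_ball q0 r z -> U (phi_inv q0 z) by move=> /ball[].
have [s1 s10 hs1] := pert_lagrangian_tonelli i0 i1 tL r0 bc.
pose s := Num.min s1 s2.
have s0 : 0 < s by rewrite lt_min s10.
have ss1 : `|s| <= s1 by rewrite gtr0_norm // /s ge_min lexx.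
have ss2 : `|s| <= s2 by rewrite gtr0_norm // /s ge_min lexx orbT.
pose LL t := pert_lagrangian L q0 i0 i1 r t.
have n0 : `|0 : R| <= s1 by rewrite normr0 ltW.
have n0' : `|0 : R| <= s2 by rewrite normr0 ltW.
have e0LL t : e0 (LL t) = - L q0 0.
  have hq q : LL t q0 0 <= LL t q 0 by exact: pert_zero_section_min.
  rewrite (e0E hq); congr (- _); exact: pert_zero_section_center.
(* If the inequality fails for both Lagrangians, both have nonnegative actions at their common
   energy [- L q0 0], which is to be refuted. *)
have [lt0|ge0] := ltP (e0 (LL 0)) (c_u rho (LL 0)).
  exists (LL 0); last exact: (hs2 _ n0').
  by split; [exact: (hs1 _ n0)|exact: lt0].
have [lts|ges] := ltP (e0 (LL s)) (c_u rho (LL s)).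
  exists (LL s); last exact: (hs2 _ ss2).
  by split; [exact: (hs1 _ ss1)|exact: lts].
exfalso.
have nn0 := nonneg_action_le ge0 (c_u_spec rs surj closedM (hs1 _ n0)).1.
have nns := nonneg_action_le ges (c_u_spec rs surj closedM (hs1 _ ss1)).1.
rewrite e0LL in nn0; rewrite e0LL in nns.
(* [delta * om] is half of the gain per unit of time that the 1-form guarantees once [kappa] is at
   least [bump (1 / 2)]. *)
pose delta := s * (r ^+ 2 * bump (1 / 2)) / 2.
have b2 : 0 < bump (1 / 2 : R) by apply: bump_gt0; rewrite divr_gt0.
have delta0 : 0 < delta by rewrite divr_gt0 // mulr_gt0 // mulr_gt0 // exprn_gt0.
have [om0 om00 hom] := loop_lagr_small sL (circle_chart i01 r0 bc) delta0.
(* The second bound keeps the speed [r * om] at most 1/2, so that [kappa] is at least [bump (1 / 2)]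
   along the loop. *)
pose om := Num.min (om0 / 2) (2 * r)^-1.
have omp : 0 < om by rewrite lt_min divr_gt0 // invr_gt0 mulr_gt0.
have om_lt : om < om0.
  apply: (@le_lt_trans _ _ (om0 / 2)); first by rewrite /om ge_min lexx.
  by rewrite ltr_pdivrMr // ltr_pMr // ltr1n.
have om_r : r ^+ 2 * om ^+ 2 <= 1 / 2.
  have h : r * om <= 1 / 2.
    apply: (@le_trans _ _ (r * (2 * r)^-1)); first by rewrite ler_pM2l // /om ge_min lexx orbT.
    by rewrite invfM mulrCA divff ?gt_eqF // mulr1 mul1r.
  rewrite -exprMn; apply: (@le_trans _ _ ((1 / 2) ^+ 2)).
    by apply: lerXn2r; rewrite ?nnegrE ?mulr_ge0 // ltW.
  by rewrite expr2 ger_pMl ?divr_gt0 // ler_pdivrMr // mul1r ler1n.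
have bump_om : bump (1 / 2) <= bump (1 - r ^+ 2 * om ^+ 2) by apply: bump_le; lra.
have omn : om != 0 by rewrite gt_eqF.
have omn' : - om != 0 by rewrite oppr_eq0.
have [c1 A1] := ac_loop_action i01 sL r0 bc oU ss sK bU omn nn0.
have [c2 A2] := ac_loop_action i01 sL r0 bc oU ss sK bU omn' nns.
rewrite normrN gtr0_norm // in A2; rewrite gtr0_norm // in A1.
have p0 : 0 < 2 * pi / om by rewrite divr_gt0 // mulr_gt0 // pi_gt0.
set b := bump (1 - r ^+ 2 * om ^+ 2) in bump_om.
(* The pointwise bound on the sum of the integrands; adding twice the energy [- L q0 0] leaves
   [delta * om] minus the gain, which is negative. *)
have := @reflected_sum_bound R _ _ (delta * om + 2 * L q0 0 - s * (b * (r ^+ 2 * om))) _ _ p0 c1 c2 A1 A2.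
have E m : m + 2 * L q0 0 - s * (b * (r ^+ 2 * om)) + 2 * - L q0 0 = m - s * (b * (r ^+ 2 * om)) by ring.
rewrite E => h; have {h} := h _; rewrite subr_ge0.
have lt1 : delta * om < s * (b * (r ^+ 2 * om)).
  have -> : delta * om = (s * (r ^+ 2 * om)) * (bump (1 / 2) / 2) by rewrite /delta; field.
  have -> : s * (b * (r ^+ 2 * om)) = (s * (r ^+ 2 * om)) * b by ring.
  rewrite ltr_pM2l; last by rewrite mulr_gt0 // mulr_gt0 // exprn_gt0.
  apply: lt_le_trans bump_om; rewrite ltr_pdivrMr // ltr_pMr // ltr1n.
  by [].
move=> h; move: lt1; rewrite ltNge h //.
move=> t /andP[t0 tp].
rewrite /speed_loop /speed_loop_tan !pert_on_circle //.
(* At the reflected time the backward loop is at the angle [om * t] up to a full turn. *)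
have -> : - om * (2 * pi / om - t) = om * t - 2 * pi by rewrite mulrBr mulNr mulrC divfK // mulNr opprK addrC.
have cp : circle (phi q0 q0) i0 i1 r (om * t - 2 * pi) = circle (phi q0 q0) i0 i1 r (om * t).
  by rewrite -[in RHS](subrK (2 * pi) (om * t)) circle_periodic.
have tp' : circle_tan i0 i1 r (om * t - 2 * pi) = circle_tan i0 i1 r (om * t).
  by rewrite -[in RHS](subrK (2 * pi) (om * t)) circle_tan_periodic.
have lp : loop_lagr L q0 i0 i1 r (om * t - 2 * pi) (- om) = loop_lagr L q0 i0 i1 r (om * t) (- om).
  by rewrite /loop_lagr cp tp'.
rewrite lp cp sqrrN -/b mul0r addr0.
have th : 0 <= om * t <= 2 * pi.
  rewrite mulr_ge0 ?(ltW omp) //= mulrC -ler_pdivlMr //.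
have := hom om (om * t) (introT andP (conj omp om_lt)) th.
set l1 := loop_lagr _ _ _ _ _ _ om; set l2 := loop_lagr _ _ _ _ _ _ (- om).
set l3 := TM_local _ _ _; set l4 := L q0 0.
exact: loop_sum_arith.
Qed.

End Density.

Theorem proposition4p2 (R : realType) (n : nat) (M : manifold R n)
    (N : manifold R n) (rho : N -> M) (g : M -> 'M[R]_n) :
  (1 < n)%N -> closed_manifold M -> universal_cover rho ->
  riemannian_metric g ->
  open_in (C0_dist (n:=n) (M:=M)) [set L | tonelli L] (tonelli_lt rho) /\
  dense_in (C1_dist g) [set L | tonelli L] (tonelli_lt rho).
Proof.
move=> n1 cM [_ cov] rg; have [rs surj _] := cov; split.
  exact: tonelli_lt_open.
exact: tonelli_lt_dense.
Qed.
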